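(* Let $0<\epsilon<1$, and suppose that - $n/6\ge\max\{r_1,r_2,r'\}$; - $m_1\ge r_1'(n-r_1)$; - $m_2\ge r_2'(n-r_2)$; - $m_1+m_2\ge r_1'(n-r_1)+r_2'(n-r_2)+r'(n-r')$. Suppose also that every column of $\mathbf{\Omega}$ has at least $l$ nonzero entries, where $$l>\max\Big\{9\log\tfrac{n}{\epsilon}+3\max\{\log\tfrac{3r_1'}{\epsilon},\log\tfrac{3r_2'}{\epsilon},\log\tfrac{3r'}{\epsilon}\}+6,\;2r_1,\;2r_2\Big\}.$$ Then, with probability at least $1-\epsilon$ (over the random sampling pattern), $\mathbf{U}$ is finitely completable.
   Context: Setup: Let $n,m_1,m_2$ be positive integers and $r,r_1,r_2$ integers with $1\le r_1,r_2\le r\le \min\{n,r_1+r_2\}$. The matrix $\mathbf{U}=[\mathbf{U}_1|\mathbf{U}_2]\in\mathbb{R}^{n\times(m_1+m_2)}$ is generic (outside a Lebesgue-null set), with views $\mathbf{U}_1\in\mathbb{R}^{n\times m_1}$ and $\mathbf{U}_2\in\mathbb{R}^{n\times m_2}$, and satisfies $\mathrm{rank}(\mathbf{U}_1)=r_1$, $\mathrm{rank}(\mathbf{U}_2)=r_2$, $\mathrm{rank}(\mathbf{U})=r$. Set $r_1'=r-r_2$, $r_2'=r-r_1$, $r'=r_1+r_2-r$. Sampling pattern: $\mathbf{\Omega}\in\{0,1\}^{n\times(m_1+m_2)}$ marks the observed entries. Within each column, the locations of the observed entries are chosen uniformly at random, independently across columns. Completions: a completion is any matrix that agrees with $\mathbf{U}$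 on the observed entries and satisfies the three rank constraints. $\mathbf{U}$ is finitely completable if it has only finitely many completions. *)

(* Defs.v *)
From Stdlib Require Import Reals.
From mathcomp Require Import all_boot.
Set Implicit Arguments. Unset Strict Implicit. Unset Printing Implicit Defensive.

Local Open Scope R_scope.

Definition mat (a b : nat) := 'I_a -> 'I_b -> R.

Definition rsum (I : finType) (f : I -> R) : R :=
  foldr Rplus 0 [seq f i | i <- enum I].

Definition lin_comb_col a b (M : mat a b) (c : 'I_b -> R) (s : seq 'I_b)
  (i : 'I_a) : R := foldr (fun j acc => c j * M i j + acc) 0 s.

Definition col_indep a b (M : mat a b) (s : seq 'I_b) : Prop :=
  uniq s /\ forall c : 'I_b -> R,
    (forall i, lin_comb_col M c s i = 0) -> forall j, j \in s -> c j = 0.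

Definition has_rank a b (M : mat a b) (k : nat) : Prop :=
  (exists s, size s = k /\ col_indep M s) /\
  (forall s, col_indep M s -> (size s <= k)%N).

Definition view1 n m1 m2 (M : mat n (m1 + m2)) : mat n m1 :=
  fun i j => M i (lshift m2 j).
Definition view2 n m1 m2 (M : mat n (m1 + m2)) : mat n m2 :=
  fun i j => M i (rshift m1 j).

Definition rank_ok n m1 m2 (r1 r2 r : nat) (M : mat n (m1 + m2)) : Prop :=
  has_rank (view1 M) r1 /\ has_rank (view2 M) r2 /\ has_rank M r.

(* sampling patterns: Om j = set of observed rows in column j *)
Definition pattern (n M : nat) := {ffun 'I_M -> {set 'I_n}}.

Definition is_completion n m1 m2 (r1 r2 r : nat) (U X : mat n (m1 + m2))
  (Om : pattern n (m1 + m2)) : Prop :=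
  (forall i j, i \in Om j -> X i j = U i j) /\ rank_ok r1 r2 r X.

Definition finitely_completable n m1 m2 (r1 r2 r : nat) (U : mat n (m1 + m2))
  (Om : pattern n (m1 + m2)) : Prop :=
  exists L : seq (mat n (m1 + m2)),
    forall X, is_completion r1 r2 r U X Om ->
      exists Y, List.In Y L /\ forall i j, X i j = Y i j.

(* patterns with exactly k j observed entries in column j (the uniform
   sampling model picks one of these uniformly at random) *)
Definition valid_patterns n M (k : 'I_M -> nat) : {set pattern n M} :=
  [set Om : pattern n M | [forall j, #|Om j| == k j]].

Definition box (T : finType) := ((T -> R) * (T -> R))%type.
Definition in_box (T : finType) (b : box T) (x : T -> R) : Prop :=
  forall t, b.1 t <= x t <= b.2 t.
Definition box_vol (T : finType) (b : box T) : R :=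
  foldr Rmult 1 [seq Rmax 0 (b.2 t - b.1 t) | t <- enum T].
Definition lebesgue_null (T : finType) (Z : (T -> R) -> Prop) : Prop :=
  forall d, 0 < d -> exists bs : nat -> box T,
    (forall x, Z x -> exists k, in_box (bs k) x) /\
    (forall N, sum_f_R0 (fun k => box_vol (bs k)) N <= d).

(* Parameter space of [U_1|U_2] with rank(U_1)=r1, rank(U_2)=r2, rank U = r:
   U_1 = A Ta + B Tb, U_2 = A Pa + C Pc, where A : n x r', B : n x r1',
   C : n x r2' (r' = r1+r2-r, r1' = r-r2, r2' = r-r1). *)
Definition param_index (n m1 m2 r r1 r2 : nat) : finType :=
  ('I_n * 'I_(r1 + r2 - r)                       (* A  *)
   + ('I_n * 'I_(r - r2)                         (* B  *)
   + ('I_n * 'I_(r - r1)                         (* C  *)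
   + ('I_(r1 + r2 - r) * 'I_m1                   (* Ta *)
   + ('I_(r - r2) * 'I_m1                        (* Tb *)
   + ('I_(r - r1) * 'I_m2                        (* Pc *)
   + ('I_(r1 + r2 - r) * 'I_m2)))))))%type.      (* Pa *)

Definition gen_matrix (n m1 m2 r r1 r2 : nat)
  (p : param_index n m1 m2 r r1 r2 -> R) : mat n (m1 + m2) :=
  fun i j =>
    match split j with
    | inl j1 =>
        rsum (fun k : 'I_(r1 + r2 - r) =>
                p (inl (i, k)) * p (inr (inr (inr (inl (k, j1))))))
      + rsum (fun k : 'I_(r - r2) =>
                p (inr (inl (i, k))) * p (inr (inr (inr (inr (inl (k, j1)))))))
    | inr j2 =>
        rsum (fun k : 'I_(r1 + r2 - r) =>
                p (inl (i, k)) * p (inr (inr (inr (inr (inr (inr (k, j2))))))))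
      + rsum (fun k : 'I_(r - r1) =>
                p (inr (inr (inl (i, k)))) *
                p (inr (inr (inr (inr (inr (inl (k, j2))))))))
    end.

(* Main.v *)
(** Finitely many completions: write [U_1 = [A B] T_1], [U_2 = [A C] T_2] and cut down the
    changes of basis by normalizing the top rows of [A], [B], [C]. If the differential of the
    resulting map onto the observed entries is injective at one point, then as many observed
    entries as there are parameters are algebraically independent, whereas any entry of the
    matrix is algebraically dependent on them. Hence off the zero set of a polynomial each
    entry of a completion is a root of a nonzero polynomial determined by the observations.

    To find such a point, let the columns of [T_1] and [T_2] be basis vectors. A block of
    columns of view [i] sharing a basis vector then determines the corresponding column of
    [A], [B] or [C] modulo the column space of the view, for generic [A], [B], [C], as soon as
    any [s] of its columns together observe at least [min(n, 2s + r_i + 1)] rows. A column has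
    more than [2 r_i] observed entries and is used here for two constraints instead of one, so
    that blocks of [(n - r_i)/2] columns suffice. This leaves enough columns to determine one
    of the views by blocks alone; the other view then only needs blocks for the columns of [B]
    (or [C]) and one more column for each column of [A].

    A block violates the condition with probability at most [3 eps / (2 n)], by a union bound
    over the sets of [s] columns and of [min(n - 1, 2s + r_i)] rows containing all their
    observed entries; there are at most [r <= n / 3] blocks. *)

From HB Require Import structures.
Require Import Defs.
From Stdlib Require Import Reals Classical_Prop IndefiniteDescription.
From mathcomp Require Import all_boot.
From mathcomp Require Import all_order all_algebra perm mpoly Rstruct zify.
From mathcomp Require ring lra.
From Stdlib Require Import Lra Psatz.
Set Implicit Arguments. Unset Strict Implicit. Unset Printing Implicit Defensive.
Import Order.TTheory GRing.Theory Num.Theory.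

(** * Multivariate polynomials *)

Section Mpoly.
Local Open Scope ring_scope.
Variable K : numFieldType.

(** A completion is the image of an arbitrary parameter, possibly degenerate and outside the normal
    form. The relation between an entry and the observed ones is therefore extended by density from
    the normal forms to an identity on the whole parameter space. Only its leading coefficient must
    be nonzero, and this depends on the observed values alone, hence on the generic matrix.

    A block works for generic bases as soon as it works for one. Such a basis spans the kernel of a
    sparse matrix with [n - r_i] rows, each supported in the observed rows of one column of the
    block. Any [n - r_i] columns of this matrix have to be independent; by Hall's theorem this is
    possible if any [t] of the supports cover [t + r_i] rows. Using every column of the block for
    two supports gives the [2s], and the support left over when [n - r_i] is odd gives the [+ 1].

    In the view without blocks for [A] one column per column of [A] is enough: the other view has
    already put the variation of that column in the span of [[A C]], say, and the part along [C] is
    excluded because more than [2 max(r_1, r_2) >= r] rows are observed. *)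

Lemma mpoly_ring_ind n (P : {mpoly K[n]} -> Prop) :
  (forall c, P c%:MP) -> (forall i, P 'X_i) ->
  (forall p q, P p -> P q -> P (p + q)) ->
  (forall p q, P p -> P q -> P (p * q)) -> forall p, P p.
Proof.
move=> PC PX PD PM; apply: mpolyind => [|c m p _ _ Pp].
  by rewrite -mpolyC0; apply: PC.
apply: (PD _ _ _ Pp); rewrite -mul_mpolyC; apply: (PM _ _ (PC c)).
rewrite mpolyXE_id; elim/big_rec: _ => [|i q _ Pq]; first by rewrite -mpolyC1.
apply: (PM _ _ _ Pq).
by elim: (m i) => [|k IHk]; [rewrite expr0 -mpolyC1 | rewrite exprS; apply: (PM)].
Qed.

Lemma meval_muni n (f : {mpoly K[n.+1]}) (v : 'I_n.+1 -> K) :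
  f.@[v] = (map_poly (meval (fun i : 'I_n => v (widen_ord (leqnSn n) i))) (muni f)).[v ord_max].
Proof.
elim/mpoly_ring_ind: f => [c|i|p q IHp IHq|p q IHp IHq].
- by rewrite muniC mevalC map_polyC /= mevalC hornerC.
- rewrite /muni mmapX mmap1U mevalXU /=; case: fintype.splitP => j ij.
    rewrite map_polyC /= mevalXU hornerC; congr v; exact: val_inj.
  rewrite map_polyX hornerX; congr v; apply: val_inj; move: ij => /= ->.
  by case: j => [[]] //=; rewrite addn0.
- by rewrite muniD mevalD rmorphD hornerD IHp IHq.
- by rewrite muniM mevalM rmorphM hornerM IHp IHq.
Qed.

Definition unmuni n (p : {poly {mpoly K[n]}}) : {mpoly K[n.+1]} :=
  (map_poly (@mwiden n K) p).['X_ord_max].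

Lemma muniK n : cancel (@muni n K) (@unmuni n).
Proof.
move=> f; rewrite /unmuni; elim/mpoly_ring_ind: f => [c|i|p q IHp IHq|p q IHp IHq].
- by rewrite muniC map_polyC /= hornerC mwidenC.
- rewrite /muni mmapX mmap1U /=; case: fintype.splitP => j ij.
    rewrite map_polyC /= hornerC mwidenX mnmwiden1; congr ('X__); exact: val_inj.
  rewrite map_polyX hornerX; congr ('X__); apply: val_inj; move: ij => /= ->.
  by case: j => [[]] //=; rewrite addn0.
- by rewrite muniD rmorphD hornerD; congr (_ + _).
- by rewrite muniM rmorphM hornerM; congr (_ * _).
Qed.

Lemma muni_neq0 n (f : {mpoly K[n.+1]}) : f != 0 -> muni f != 0.
Proof.
apply: contra_neq => f0; rewrite -[f]muniK f0 /unmuni.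
by rewrite map_poly0 horner0.
Qed.

Lemma nonroot_exists (p : {poly K}) : p != 0 -> exists x, p.[x] != 0.
Proof.
move=> p0; have [/allP rt|/allPn[x _ nr]] := boolP (all (root p) [seq i%:R | i <- iota 0 (size p)]).
  have := max_poly_roots p0 (introT allP rt); rewrite map_inj_uniq ?iota_uniq => [|i j].
    by move/(_ isT); rewrite size_map size_iota ltnn.
  by move/eqP; rewrite eqr_nat => /eqP.
by exists x.
Qed.

Lemma mpoly_nonzero_point n (f : {mpoly K[n]}) : f != 0 -> exists v, f.@[v] != 0.
Proof.
elim: n f => [|n IHn] f f0.
  exists (fun=> 0); case: (ltnP 1 (msize f)) => [|/msize1_polyC fC].
    rewrite msizeE => lt1; exfalso; move: lt1; apply/negP; rewrite -leqNgt.
    apply/bigmax_leqP_seq => m _ _.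
    by rewrite mdegE big_ord0.
  by move: f0; rewrite fC mevalC mpolyC_eq0.
have := muni_neq0 f0; rewrite -lead_coef_eq0 => /IHn[v Hv].
have /nonroot_exists[x Hx] : map_poly (meval v) (muni f) != 0.
  apply: contra_neq Hv => /(congr1 (coefp (size (muni f)).-1)).
  by rewrite /= coef_map coef0.
exists (fun i => if unlift ord_max i is Some j then v j else x).
rewrite meval_muni unlift_none; apply: contra_neq Hx => <-; congr (_.[_]).
apply: eq_map_poly => c; apply: meval_eq => i.
have -> : widen_ord (leqnSn n) i = lift ord_max i by apply/val_inj; rewrite /= /bump leqNgt ltn_ord.
by rewrite liftK.
Qed.

Lemma mpoly_eval_eq0 n (f : {mpoly K[n]}) : (forall v, f.@[v] = 0) -> f = 0.
Proof.
move=> f0; apply/eqP; apply: contraT => /mpoly_nonzero_point[v].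
by rewrite f0 eqxx.
Qed.

Lemma mderiv_comp n k (p : {mpoly K[n]}) (f : n.-tuple {mpoly K[k]}) (i : 'I_k) :
  (p \mPo f)^`M(i) = \sum_(j < n) (p^`M(j) \mPo f) * (tnth f j)^`M(i).
Proof.
elim/mpoly_ring_ind: p => [c|j|p q IHp IHq|p q IHp IHq].
- rewrite comp_mpolyC mderivC big1 // => j _.
  by rewrite mderivC comp_mpoly0 mul0r.
- rewrite comp_mpolyXU (bigD1 j) //= big1 => [|l lj].
    have UU0 : (U_(j) - U_(j) = 0)%MM by apply/mnmP => l; rewrite mnmBE subnn mnm0E.
    by rewrite mderivX mnm1E eqxx scale1r UU0 mpolyX0 comp_mpoly1 mul1r addr0 (tnth_nth 0).
  by rewrite mderivX mnm1E eq_sym (negPf lj) scale0r comp_mpoly0 mul0r.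
- rewrite comp_mpolyD mderivD IHp IHq -big_split; apply: eq_bigr => j _ /=.
  by rewrite mderivD comp_mpolyD mulrDl.
- rewrite rmorphM mderivM IHp IHq mulr_suml mulr_sumr -big_split.
  apply: eq_bigr => j _ /=; rewrite mderivM comp_mpolyD !rmorphM /= mulrDl.
  by congr (_ + _); [rewrite -!mulrA [X in _ * X]mulrC | rewrite mulrA].
Qed.

(** By the chain rule, a relation [c] makes the row of its partial derivatives, composed with [f], a
    left kernel vector of the Jacobian matrix, whose determinant is a nonzero polynomial. So every
    partial derivative of [c] is again a relation, of smaller degree, and in characteristic zero one
    of them is nonzero. *)
Lemma jac_alg_indep D (f : D.-tuple {mpoly K[D]}) (q : 'I_D -> K) :
  \det (\matrix_(i, j) ((tnth f i)^`M(j)).@[q]) != 0 ->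
  forall c, c != 0 -> c \mPo f != 0.
Proof.
set J := \matrix_(i, j) _ => detJ c.
pose JX := \matrix_(i < D, j < D) (tnth f i)^`M(j).
have detJX : \det JX != 0.
  apply: contra_neq detJ => /(congr1 (meval q)); rewrite meval0 => <-.
  by rewrite -det_map_mx; congr (\det _); apply/matrixP => i j; rewrite !mxE.
have [k] := ubnP (msize c); elim: k c => // k IHk c sz_c c0.
have [sc|sc] := leqP (msize c) 1.
  by rewrite (msize1_polyC sc) comp_mpolyC -(msize1_polyC sc).
have [m mc m0] : exists2 m, m \in msupp c & m != 0%MM.
  exists (mlead c); first by rewrite mlead_supp.
  by apply: contraTneq sc => l0; rewrite -mlead_deg // l0 mdeg0.
have [i mi] : exists i, m i != 0%N.
  apply/existsP; apply: contra_neqT m0; rewrite negb_exists => /forallP m0.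
  by apply/mnmP => i; rewrite mnm0E; apply/eqP; rewrite -[_ == _]negbK.
have dc : c^`M(i) != 0.
  apply: contraTneq mc => /(congr1 (mcoeff (m - U_(i))%MM)).
  rewrite mcoeff0 mcoeff_deriv submK; last first.
    by apply/mnm_lepP => j; rewrite mnm1E; case: eqP => // <-; rewrite lt0n.
  by move/eqP; rewrite mulrn_eq0 /= -mcoeff_eq0.
have sz_dc : (msize c^`M(i) < k)%N.
  apply: leq_trans (_ : msize c <= k)%N; last by rewrite -ltnS.
  have lt0 : (0 < msize c)%N by apply: leq_trans sc.
  rewrite msizeE -(prednK lt0) ltnS; apply/bigmax_leqP_seq => l lc _.
  have : (l + U_(i))%MM \in msupp c.
    move: lc; rewrite !mcoeff_msupp mcoeff_deriv; apply: contra_neq => ->.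
    by rewrite mul0rn.
  move/msize_mdeg_lt; rewrite mdegD mdeg1 addn1 => lt.
  by rewrite -ltnS prednK.
apply: contraNneq (IHk _ sz_dc dc) => cf0.
pose v := \row_j (c^`M(j) \mPo f).
have vJ : v *m JX = 0.
  apply/rowP => j; rewrite !mxE; have := congr1 (mderiv j) cf0.
  rewrite mderiv0 mderiv_comp => {2}<-.
  by apply: eq_bigr => l _; rewrite !mxE.
have : \det JX *: v = 0.
  by rewrite -mul_mx_scalar -mul_mx_adj mulmxA vJ mul0mx.
move/rowP/(_ i); rewrite !mxE => /eqP.
by rewrite mulf_eq0 (negPf detJX).
Qed.

Lemma msize_mulS n (p q : {mpoly K[n]}) a b :
  (msize p <= a.+1 -> msize q <= b.+1 -> msize (p * q) <= (a + b).+1)%N.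
Proof.
have [->|p0] := eqVneq p 0; first by rewrite mul0r msize0.
have [->|q0] := eqVneq q 0; first by rewrite mulr0 msize0.
rewrite msizeM // => pa qb; rewrite -ltnS -addSn -addnS prednK ?leq_add //.
by rewrite addn_gt0 lt0n msize_poly_eq0 p0.
Qed.

Lemma msize_expS n (p : {mpoly K[n]}) a k :
  (msize p <= a.+1 -> msize (p ^+ k) <= (k * a).+1)%N.
Proof.
move=> pa; elim: k => [|k IHk]; first by rewrite expr0 msize1.
by rewrite exprS mulSn msize_mulS.
Qed.

(** Dimension count: the [k ^ D.+1] products of powers of [g] and the components of [f] with
    exponents below [k] have degree below [B], so they involve at most [B ^ D] monomials. As
    [B <= c * k] with [c] independent of [k], the choice [k > c ^ D] forces a linear relation. *)
Lemma alg_dep D (f : D.-tuple {mpoly K[D]}) (g : {mpoly K[D]}) :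
  exists2 P : {poly {mpoly K[D]}}, P != 0 &
    \sum_(j < size P) (P`_j \mPo f) * g ^+ j = 0.
Proof.
have [d fd gd] : exists2 d, forall i, (msize (tnth f i) <= d.+1)%N & (msize g <= d.+1)%N.
  exists (msize g + \max_(i < D) msize (tnth f i))%N => [i|].
    by apply/leqW/(leq_trans _ (leq_addl _ _))/(leq_bigmax i).
  by apply/leqW/leq_addr.
pose c := (D.+1 * d).+1; pose k := (c ^ D).+1; pose B := (D.+1 * (k * d)).+1.
pose I : finType := ({ffun 'I_D -> 'I_k} * 'I_k)%type.
pose J : finType := {ffun 'I_D -> 'I_B}.
pose h (a : I) := \prod_(i < D) tnth f i ^+ a.1 i * g ^+ a.2.
pose mnm (b : J) : 'X_{1..D} := [multinom (b i : nat) | i < D].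
pose Mx := \matrix_(a < #|I|, b < #|J|) (h (enum_val a))@_(mnm (enum_val b)).
have ltJI : (#|J| < #|I|)%N.
  rewrite card_prod !card_ffun !card_ord -expnSr.
  apply: (@leq_ltn_trans ((c * k) ^ D)).
    have leB : (B <= c * k)%N by rewrite /B /c [leqRHS]mulSn -mulnA (mulnC d) -add1n leq_add.
    by have [->|D0] := posnP D; rewrite // leq_exp2r.
  by rewrite expnMn expnS ltn_pmul2r // expn_gt0.
have /rowV0Pn[u /sub_kermxP uM u0] : kermx Mx != 0.
  rewrite kermx_eq0 /row_free neq_ltn; apply/orP; left.
  exact: leq_ltn_trans (rank_leq_col _) ltJI.
pose uf (a : I) := u 0 (enum_rank a).
pose mf (a : {ffun 'I_D -> 'I_k}) : 'X_{1..D} := [multinom (a i : nat) | i < D].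
have mf_inj : injective mf.
  move=> a b /mnmP ab; apply/ffunP => i; apply/val_inj.
  by have := ab i; rewrite !mnmE.
pose cP (j : 'I_k) := \sum_a uf (a, j) *: 'X_[mf a].
pose P := \poly_(j < k) cP (inord j).
have PE (j : 'I_k) : P`_j = cP j by rewrite coef_poly ltn_ord inord_val.
exists P.
  have [a0 ua0] : exists a, u 0 a != 0.
    apply/existsP; apply: contra_neqT u0; rewrite negb_exists => /forallP u0.
    by apply/rowP => a; rewrite mxE; apply/eqP; rewrite -[_ == _]negbK.
  have [a ua] : exists a, uf a != 0 by exists (enum_val a0); rewrite /uf enum_valK.
  apply: contra_neq ua => P0; have := PE a.2; rewrite P0 coef0.
  move/(congr1 (mcoeff (mf a.1))); rewrite mcoeff0 raddf_sum /= (bigD1 a.1) //=.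
  rewrite big1 => [|b /negPf ba]; last first.
    by rewrite mcoeffZ mcoeffX (inj_eq mf_inj) ba mulr0.
  by rewrite mcoeffZ mcoeffX eqxx mulr1 addr0 -surjective_pairing.
have szP : (size P <= k)%N by apply: size_poly.
rewrite (big_ord_widen k (fun j => (P`_j \mPo f) * g ^+ j)) //.
rewrite big_mkcond /=.
transitivity (\sum_(a : I) uf a *: h a).
  transitivity (\sum_a \sum_j uf (a, j) *: h (a, j)); last first.
    by rewrite pair_bigA; apply: eq_bigr => -[].
  rewrite exchange_big; apply: eq_bigr => j _ /=.
  transitivity ((P`_j \mPo f) * g ^+ j).
    case: ltnP => // le; rewrite nth_default // comp_mpoly0 mul0r //.
  rewrite PE raddf_sum /= mulr_suml; apply: eq_bigr => a _.
  rewrite comp_mpolyZ comp_mpolyX -scalerAl; congr (_ *: (_ * _)).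
  by apply: eq_bigr => i _; rewrite mnmE.
apply/mpolyP => m; rewrite mcoeff0.
have [lem|ltm] := leqP B (mdeg m).
  apply/memN_msupp_eq0/msize_mdeg_ge/(leq_trans _ lem)/(leq_trans (msize_sum _ _ _)).
  apply/bigmax_leqP => a _; apply: leq_trans (msizeZ_le _ _) _.
  rewrite /B mulSn addnC; apply: msize_mulS; last first.
    by apply: leq_trans (msize_expS a.2 gd) _; rewrite ltnS leq_mul2r ltnW ?orbT.
  rewrite -[X in (X * _)%N]card_ord -sum_nat_const.
  elim/big_rec2: _ => [|i x y _ IH]; first by rewrite msize1.
  by apply: msize_mulS IH; apply: leq_trans (msize_expS _ (fd i)) _; rewrite ltnS leq_mul2r ltnW ?orbT.
have mB i : (m i < B)%N by apply: leq_ltn_trans ltm; rewrite mdegE (bigD1 i) ?leq_addr.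
pose b : J := [ffun i => Ordinal (mB i)].
have <- : mnm b = m by apply/mnmP => i; rewrite mnmE ffunE.
move/rowP: uM => /(_ (enum_rank b)); rewrite !mxE => <-.
rewrite raddf_sum /= (reindex (@enum_val _ (mem I))) /=; last first.
  by apply: onW_bij; apply: enum_val_bij.
by apply: eq_bigr => a _; rewrite mxE enum_rankK mcoeffZ /uf enum_valK.
Qed.

End Mpoly.

(** * Finite fibres of polynomial maps *)

Section Finite.
Local Open Scope ring_scope.
Variable K : numFieldType.

Lemma poly_roots_finite (p : {poly K}) :
  p != 0 -> exists s : seq K, forall x, root p x -> x \in s.
Proof.
move=> p0; apply: NNPP => nos.
have H k : exists s : seq K, [/\ size s = k, uniq s & all (root p) s].
  elim: k => [|k [s [sk us rs]]]; first by exists [::].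
  apply: NNPP => nox; apply: nos; exists s => x rx.
  apply: contraT => xs; exfalso; apply: nox; exists (x :: s).
  by rewrite /= sk xs us rx rs.
have [s [sk us rs]] := H (size p).
by have := max_poly_roots p0 rs us; rewrite sk ltnn.
Qed.

Lemma mul_nonzero_eval0 n (g q : {mpoly K[n]}) :
  g != 0 -> (forall v, g.@[v] != 0 -> q.@[v] = 0) -> q = 0.
Proof.
move=> g0 gq; have : g * q = 0.
  apply: mpoly_eval_eq0 => v; rewrite mevalM.
  by have [->|/gq->] := eqVneq g.@[v] 0; rewrite ?mul0r ?mulr0.
by move/eqP; rewrite mulf_eq0 (negPf g0) => /eqP.
Qed.

(** Independence is tested in the [D] coordinates of the chart [c], since the full parameters are
    redundant and the differential is not injective in them. The conclusion has to cover every [q],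
    in the chart or not. *)
Lemma generic_finite_fibres N D (E : finType) (X : E -> {mpoly K[N]})
    (Om : {set E}) (c : N.-tuple {mpoly K[D]}) (G : {mpoly K[N]}) (q0 : 'I_D -> K) :
  G != 0 ->
  (forall p, G.@[p] != 0 -> exists q, forall e, (X e).@[p] = (X e \mPo c).@[q]) ->
  (forall u : 'I_D -> K,
     (forall e, e \in Om -> \sum_j u j * ((X e \mPo c)^`M(j)).@[q0] = 0) ->
     forall j, u j = 0) ->
  exists2 H : {mpoly K[N]}, H != 0 & forall p, H.@[p] != 0 ->
    exists L : E -> seq K, forall q,
      (forall e, e \in Om -> (X e).@[q] = (X e).@[p]) ->
      forall e, (X e).@[q] \in L e.
Proof.
move=> G0 chart inj.
pose Jm := \matrix_(e < #|Om|, j < D) ((X (enum_val e) \mPo c)^`M(j)).@[q0].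
have full : row_full Jm.
  rewrite /row_full -mxrank_tr -[_ == _]/(row_free Jm^T) -kermx_eq0.
  apply/rowV0P => u /sub_kermxP uJ; apply/rowP => j; rewrite mxE.
  apply: (inj (fun j => u 0 j)) => e eOm.
  move/rowP: uJ => /(_ (enum_rank_in eOm e)); rewrite !mxE => uJ0; rewrite -[RHS]uJ0.
  by apply: eq_bigr => l _; rewrite !mxE enum_rankK_in.
pose sg := fullrankfun full.
pose F := [tuple X (enum_val (sg i)) | i < D].
pose f := [tuple X (enum_val (sg i)) \mPo c | i < D].
have indep : forall b, b != 0 -> b \mPo f != 0.
  apply: (jac_alg_indep (q := q0)).
  have : rowsub sg Jm \in unitmx by rewrite -row_full_unit /sg fullrowsub_full.
  rewrite unitmxE unitfE; congr (\det _ != 0).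
  by apply/matrixP => i j; rewrite !mxE tnth_mktuple.
have FcE b : (b \mPo F) \mPo c = b \mPo f.
  apply/eqP; rewrite -subr_eq0; apply/eqP/mpoly_eval_eq0 => v.
  rewrite mevalB !comp_mpoly_meval; apply/eqP; rewrite subr_eq0; apply/eqP.
  by apply: meval_eq => i; rewrite !tnth_mktuple comp_mpoly_meval.
have FE b : b != 0 -> b \mPo F != 0.
  by move/indep; rewrite -FcE; apply: contra_neq => ->; rewrite comp_mpoly0.
(* The dependence found in chart coordinates holds at every parameter with the same image as a chart
   point, hence off the zeros of [G], hence identically. *)
have /fin_all_exists[P Pprop] e : exists P : {poly {mpoly K[D]}},
    P != 0 /\ \sum_(j < size P) (P`_j \mPo F) * X e ^+ j = 0.
  have [P P0 Pf] := alg_dep f (X e \mPo c); exists P; split=> //.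
  apply: (mul_nonzero_eval0 G0) => p /chart[q pq].
  have := congr1 (meval q) Pf; rewrite meval0 => <-.
  rewrite !raddf_sum /=; apply: eq_bigr => j _.
  rewrite !mevalM !rmorphXn /= !comp_mpoly_meval pq; congr (_ * _ ^+ _).
    by apply: meval_eq => i; rewrite !tnth_mktuple pq.
  by rewrite comp_mpoly_meval.
(* Independence makes these leading coefficients nonzero. Where they do not vanish, [R e] below is a
   nonzero polynomial, and its coefficients involve observed entries only, so it is the same for [q]
   and [p]. *)
exists (\prod_e (lead_coef (P e) \mPo F)).
  by apply/prodf_neq0 => e _; apply/FE; rewrite lead_coef_eq0; case: (Pprop e).
move=> p; rewrite rmorph_prod => /prodf_neq0 Hp.
pose R e := \poly_(j < size (P e)) ((P e)`_j \mPo F).@[p].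
have /fin_all_exists[L LP] e : exists s : seq K, forall x, root (R e) x -> x \in s.
  apply: poly_roots_finite; apply: contra_neq (Hp e isT).
  move/(congr1 (coefp (size (P e)).-1)); rewrite /= coef0 coef_poly prednK ?leqnn //.
  by rewrite size_poly_gt0; case: (Pprop e).
exists L => q qp e; apply: LP; rewrite rootE.
have [_ /(congr1 (meval q))] := Pprop e; rewrite meval0 => <-.
rewrite raddf_sum /= /R horner_poly; apply/eqP/eq_bigr => j _.
rewrite mevalM rmorphXn /= !comp_mpoly_meval; congr (_ * _).
by apply: meval_eq => i; rewrite !tnth_mktuple qp // enum_valP.
Qed.

End Finite.

(** * Small values of polynomials on grids *)

Section Grid.
Local Open Scope ring_scope.
Import mathcomp.algebra_tactics.ring mathcomp.algebra_tactics.lra.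
Variable K : archiRealFieldType.

Lemma card_ord_window k (t0 : 'I_k) (S : nat) :
  (#|[set t : 'I_k | (t0 <= t + S) && (t <= t0 + S)]| <= S.*2.+1)%N.
Proof.
rewrite cardE -(size_map val) -(size_iota (t0 - S) S.*2.+1).
apply: uniq_leq_size; first by rewrite map_inj_uniq ?enum_uniq //; apply: val_inj.
move=> _ /mapP[t + ->]; rewrite mem_enum inE mem_iota => /andP[lo hi].
by rewrite leq_subLR addnC lo /= addnS ltnS -addnn; lia.
Qed.

(** Induction on the degree. Given one grid point [x0] with a small value, the quotient of
    [p - p(x0)] by [X - x0] is at most [2 * delta / (S * h)] at the other such points at distance at
    least [S * h]; the nearer grid points number at most [2 S + 1]. The leading coefficient never
    changes, and in degree zero it excludes small values. *)
Lemma poly_sublevel_count d (p : {poly K}) (k S : nat) (a h eta delta : K) :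
  0 < h -> (0 < S)%N -> (size p <= d.+1)%N -> eta <= `|p`_d| ->
  (2 / (S%:R * h)) ^+ d * delta < eta ->
  (#|[set t : 'I_k | (`|p.[a + h * t%:R]| <= delta)%R]| <= d * S.*2.+1)%N.
Proof.
move=> h0 S0; have S0' : 0 < S%:R :> K by rewrite ltr0n.
elim: d p delta => [|d IHd] p delta sp lead small.
  rewrite mul0n leqn0 cards_eq0; apply/eqP/setP => t; rewrite !inE.
  rewrite (size1_polyC sp) hornerC; apply/negbTE; rewrite -ltNge.
  by apply: lt_le_trans lead; rewrite expr0 mul1r in small.
have [->|[t0]] := set_0Vmem [set t : 'I_k | `|p.[a + h * t%:R]| <= delta].
  by rewrite cards0.
rewrite inE; set x0 := a + h * _ => px0.
have [q pq] : exists q, p - (p.[x0])%:P = q * ('X - x0%:P).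
  by apply/factor_theorem; rewrite /root hornerD hornerN hornerC subrr.
have pE : p = q * ('X - x0%:P) + (p.[x0])%:P by rewrite -pq subrK.
have sq : (size q <= d.+1)%N.
  have [->|q0] := eqVneq q 0; first by rewrite size_poly0.
  have := size_Mmonic q0 (monicXsubC x0); rewrite size_XsubC addn2 /= => sE.
  rewrite -ltnS -sE -pq; apply: leq_trans (size_polyD _ _) _.
  by rewrite geq_max sp size_polyN (leq_trans (size_polyC_leq1 _)).
have leadq : q`_d = p`_d.+1.
  rewrite pE coefD coefC addr0 mulrBr coefB coefMX /= coefMC.
  by rewrite (nth_default _ sq) mul0r subr0.
pose delta' := 2 / (S%:R * h) * delta.
have := IHd q delta' sq; rewrite leadq => /(_ lead).
rewrite /delta' mulrA -exprSr => /(_ small) cq.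
apply: leq_trans (_ : #|[set t : 'I_k | (t0 <= t + S) && (t <= t0 + S)] :|:
   [set t : 'I_k | (`|q.[a + h * t%:R]| <= delta')%R]| <= _)%N.
  apply/subset_leq_card/subsetP => t; rewrite !inE => pt.
  have [//|far] := boolP ((t0 <= t + S) && (t <= t0 + S))%N.
  set x := a + _; have farx : S%:R * h <= `|x - x0|.
    have -> : x - x0 = (t%:R - t0%:R) * h by rewrite /x /x0; ring.
    rewrite normrM (gtr0_norm h0) ler_pM2r //.
    move: far; rewrite negb_and -!ltnNge => /orP[lt|lt].
      by rewrite ler_normr; apply/orP; right; rewrite opprB lerBrDl -natrD ler_nat ltnW.
    by rewrite ler_normr; apply/orP; left; rewrite lerBrDl -natrD ler_nat ltnW.
  have Sh0 : 0 < S%:R * h by rewrite mulr_gt0.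
  rewrite /delta' mulrAC ler_pdivlMr //.
  have qx : `|q.[x]| * `|x - x0| <= 2 * delta.
    have -> : `|q.[x]| * `|x - x0| = `|p.[x] - p.[x0]|.
      by rewrite [X in X.[x]]pE hornerD hornerC addrK hornerM hornerXsubC normrM.
    by apply: le_trans (ler_normB _ _) _; rewrite mulr_natl mulr2n lerD.
  by apply: le_trans qx; apply: ler_wpM2l.
apply: leq_trans (leq_card_setU _ _) _.
by rewrite mulSn leq_add // card_ord_window.
Qed.

Definition grid_pt n k (M : K) (v : {ffun 'I_n -> 'I_k}) (i : 'I_n) : K :=
  - M + 2 * M / k%:R * (v i)%:R.

(** A discrete Fubini argument: the leading coefficient in the last variable is small at few grid
    points by induction, and where it is not small the univariate count applies to the line. It
    matters that [delta] does not depend on [k], so that the mesh can be refined for a fixed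
    [delta]. *)
Lemma mpoly_sublevel_count n (f : {mpoly K[n]}) (M eps : K) :
  f != 0 -> 0 < M -> 0 < eps ->
  exists2 delta, 0 < delta & exists k0, forall k, (k0 <= k)%N ->
    #|[set v : {ffun 'I_n -> 'I_k} | `|f.@[grid_pt M v]| <= delta]|%:R
      <= eps * k%:R ^+ n.
Proof.
move=> + M0; elim: n f eps => [|n IHn] f eps f0 eps0.
  have [v0 fv0] := mpoly_nonzero_point f0.
  exists (`|f.@[v0]| / 2); first by rewrite divr_gt0 ?normr_gt0.
  exists 0%N => k _; rewrite expr0 mulr1.
  rewrite (_ : [set _ | _] = set0) ?cards0 ?ltW //.
  apply/setP => v; rewrite !inE; apply/negbTE; rewrite -ltNge.
  have -> : f.@[grid_pt M v] = f.@[v0] by apply: meval_eq => -[].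
  have := normr_gt0 f.@[v0]; rewrite fv0; set z := `|_|; lra.
have P0 := muni_neq0 f0; set P := muni f in P0.
have lP : lead_coef P != 0 by rewrite lead_coef_eq0.
have e2 : 0 < eps / 2 by rewrite divr_gt0.
have [da da0 [ka Ha]] := IHn _ _ lP e2.
pose d := (size P).-1.
(* With [S = k %/ m], the count [d * (2 S + 1)] is at most [2 d k / m + d]; [m] and [k1] make each
   of the two terms at most [eps * k / 4]. *)
have [m m1 mE] : exists2 m, (0 < m)%N & 8 * d%:R / eps <= m%:R.
  exists (Num.truncn (8 * d%:R / eps)).+1 => //.
  by apply/ltW/truncnS_gt.
have [k1 k1E] : exists k1, 4 * d%:R / eps <= k1%:R.
  by exists (Num.truncn (4 * d%:R / eps)).+1; apply/ltW/truncnS_gt.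
have mR : 0 < m%:R :> K by rewrite ltr0n.
(* Bounds the factor [(2 / (S * h)) ^+ d] of the univariate count, because [S * h >= M / m]. *)
pose c := (2 * m%:R / M) ^+ d.
have c0 : 0 < c by rewrite exprn_gt0 // divr_gt0 ?mulr_gt0.
exists (da / (2 * c)); first by rewrite divr_gt0 ?mulr_gt0.
exists (maxn ka (maxn k1 (2 * m))) => k; rewrite !geq_max => /and3P[kka kk1 k2m].
set delta := da / _.
pose h := 2 * M / k%:R; pose S := (k %/ m)%N.
have k0 : (0 < k)%N by apply: leq_trans k2m; rewrite muln_gt0.
have kR : 0 < k%:R :> K by rewrite ltr0n.
have h0 : 0 < h by rewrite divr_gt0 ?mulr_gt0.
have S0 : (0 < S)%N by rewrite divn_gt0 //; apply: leq_trans k2m; rewrite mul2n -addnn leq_addr.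
have SR : 0 < S%:R :> K by rewrite ltr0n.
have S2 : (k <= S * m * 2)%N.
  rewrite {1}(divn_eq k m) muln2 -addnn leq_add2l.
  by rewrite (leq_trans (ltnW (ltn_pmod _ m1))) // leq_pmull.
have S1 : (S * m <= k)%N by apply: leq_trunc_div.
have Sh : M / m%:R <= S%:R * h.
  rewrite /h ler_pdivrMr // mulrA mulrAC ler_pdivlMr // (mulrC _ (2 * M)) -mulrA -natrM.
  have : k%:R <= (S * m * 2)%:R :> K by rewrite ler_nat.
  by rewrite [(_ * 2)%:R]natrM => /(ler_wpM2l (ltW M0)) H; rewrite (le_trans H) //; lra.
have dS : (d * S.*2.+1)%:R <= eps / 2 * k%:R.
  have kk : 4 * d%:R <= eps * k%:R.
    by rewrite [leRHS]mulrC -ler_pdivrMr ?(le_trans k1E) ?ler_nat.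
  have mm : 8 * d%:R <= eps * m%:R by rewrite [leRHS]mulrC -ler_pdivrMr.
  have : 8 * (d%:R * S%:R) <= eps * k%:R.
    apply: le_trans (_ : eps * (S * m)%:R <= _); last by rewrite ler_wpM2l ?ler_nat ?ltW.
    by rewrite mulrA natrM (mulrC S%:R) mulrA ler_wpM2r // ltW.
  rewrite natrM -[(S.*2.+1)%:R]natr1 -muln2 natrM; set x := d%:R; set y := S%:R => H.
  by have : x * (y * 2 + 1) = 2 * (x * y) + x by [ring]; lra.
have cnt (w : {ffun 'I_n -> 'I_k}) : da < `|(lead_coef P).@[grid_pt M w]| ->
   (#|[set t : 'I_k | (`|(map_poly (meval (grid_pt M w)) P).[- M + h * t%:R]| <= delta)%R]|
     <= d * S.*2.+1)%N.
  move=> Hw; apply: (@poly_sublevel_count d _ k S (- M) h da) => //.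
  - rewrite prednK ?size_poly_gt0 //; exact: size_poly.
  - by rewrite coef_map ltW.
  have c'c : (2 / (S%:R * h)) ^+ d <= c.
    have Sh0 : 0 < S%:R * h by rewrite mulr_gt0.
    apply: lerXn2r; rewrite ?nnegrE.
    - by rewrite divr_ge0 ?ler0n // ltW.
    - by rewrite divr_ge0 ?mulr_ge0 ?ler0n // ltW.
    rewrite ler_pdivrMr // mulrAC ler_pdivlMr // -!mulrA ler_wpM2l //.
    by move: Sh; rewrite ler_pdivrMr // mulrC.
  apply: le_lt_trans (ler_wpM2r _ c'c) _; first by rewrite ltW ?divr_gt0 ?mulr_gt0.
  have -> : c * delta = da / 2 by rewrite /delta; field; rewrite gt_eqF.
  by rewrite ltr_pdivrMr // mulr_natr mulr2n ltrDl.
pose spl (v : {ffun 'I_n.+1 -> 'I_k}) :=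
  ([ffun i => v (widen_ord (leqnSn n) i)] : {ffun 'I_n -> 'I_k}, v ord_max).
have spl_inj : injective spl.
  move=> v1 v2 [/ffunP w12 m12]; apply/ffunP => i.
  have [/= lt|] := ltnP i n.
    have := w12 (Ordinal lt); rewrite !ffunE.
    by have -> : widen_ord (leqnSn n) (Ordinal lt) = i by apply/val_inj.
  move=> ge; have -> // : i = ord_max; apply/val_inj/eqP.
  by rewrite eqn_leq ge -ltnS ltn_ord.
rewrite -(card_imset _ spl_inj).
pose Pr (u : {ffun 'I_n -> 'I_k} * 'I_k) :=
  `|(map_poly (meval (grid_pt M u.1)) P).[- M + h * u.2%:R]| <= delta.
apply: le_trans (_ : (#|[set u | Pr u]|)%:R <= _).
  rewrite ler_nat; apply/subset_leq_card/subsetP => _ /imsetP[v + ->].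
  rewrite !inE /Pr /= meval_muni; congr (`|_.[_]| <= _).
  by apply: eq_map_poly => b; apply: meval_eq => i; rewrite /grid_pt ffunE.
have -> : #|[set u | Pr u]| = (\sum_w #|[set t | Pr (w, t)]|)%N.
  rewrite -sum1_card (eq_bigl Pr) => [|u]; last by rewrite inE.
  rewrite big_mkcond (eq_bigr (fun u => (Pr (u.1, u.2) : nat))) => [|[w t] _]; last first.
    by case: (Pr _).
  rewrite -(pair_bigA _ (fun w t => (Pr (w, t) : nat))); apply: eq_bigr => w _ /=.
  by rewrite -sum1dep_card [RHS]big_mkcond; apply: eq_bigr => t _; case: (Pr _).
rewrite (bigID (fun w => `|(lead_coef P).@[grid_pt M w]| <= da)) /= natrD.
apply: le_trans (_ : eps / 2 * k%:R ^+ n.+1 + eps / 2 * k%:R ^+ n.+1 <= _); last by lra.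
apply: lerD.
  apply: le_trans (_ : (\sum_(w | `|(lead_coef P).@[grid_pt M w]| <= da) k)%:R <= _).
    rewrite ler_nat; apply: leq_sum => w _; rewrite -[leqRHS]card_ord; exact: max_card.
  rewrite sum_nat_const natrM exprSr mulrA ler_wpM2r ?ler0n //.
  by have := Ha k kka; rewrite cardsE.
apply: le_trans (_ : (\sum_(w : {ffun 'I_n -> 'I_k}) d * S.*2.+1)%:R <= _).
  rewrite ler_nat big_mkcond; apply: leq_sum => w _; case: ifP => //.
  by rewrite -ltNge => /cnt; apply: leq_trans; rewrite /Pr.
rewrite sum_nat_const card_ffun !card_ord natrM natrX exprS mulrA [leLHS]mulrC.
by rewrite ler_wpM2r // exprn_ge0.
Qed.

(** The bound and the Lipschitz constant come from one induction, since the Lipschitz constant of a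
    product uses the bounds of its factors. *)
Lemma mpoly_lipschitz n (f : {mpoly K[n]}) (M : K) : 0 < M ->
  exists B L, [/\ 0 <= B, 0 <= L,
    forall x, (forall i, `|x i| <= M) -> `|f.@[x]| <= B &
    forall x y e, (forall i, `|x i| <= M) -> (forall i, `|y i| <= M) -> 0 <= e ->
      (forall i, `|x i - y i| <= e) -> `|f.@[x] - f.@[y]| <= L * e].
Proof.
move=> M0; elim/mpoly_ring_ind: f =>
  [c|i|p q [B1 [L1 [b1 l1 H1 G1]]] [B2 [L2 [b2 l2 H2 G2]]]
   |p q [B1 [L1 [b1 l1 H1 G1]]] [B2 [L2 [b2 l2 H2 G2]]]].
- exists `|c|, 0; split=> // [x _|x y e _ _ _ _]; first by rewrite mevalC.
  by rewrite !mevalC subrr normr0 mul0r.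
- exists M, 1; split=> // [|x xM|x y e _ _ _ xy]; rewrite ?mevalXU ?mul1r //; exact: ltW.
- exists (B1 + B2), (L1 + L2); split; rewrite ?addr_ge0 //.
    by move=> x xM; rewrite mevalD (le_trans (ler_normD _ _)) // lerD ?H1 ?H2.
  move=> x y e xM yM e0 xy; rewrite !mevalD opprD addrACA mulrDl.
  by rewrite (le_trans (ler_normD _ _)) // lerD ?G1 ?G2.
- exists (B1 * B2), (B1 * L2 + L1 * B2); split; rewrite ?addr_ge0 ?mulr_ge0 //.
    by move=> x xM; rewrite mevalM normrM ler_pM ?H1 ?H2.
  move=> x y e xM yM e0 xy; rewrite !mevalM.
  set a := p.@[x]; set b := q.@[x]; set a' := p.@[y]; set b' := q.@[y].
  have -> : a * b - a' * b' = a * (b - b') + (a - a') * b' by ring.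
  rewrite (le_trans (ler_normD _ _)) // [leRHS]mulrDl !normrM lerD //.
    by rewrite -mulrA ler_pM ?H1 ?G2.
  by rewrite mulrAC ler_pM ?G1 ?H2.
Qed.

Lemma grid_cell k (h y : K) : 0 <= y -> y <= h * k.+1%:R ->
  exists t : 'I_k.+1, h * t%:R <= y <= h * t%:R + h.
Proof.
elim: k => [|k IHk] y0 yh.
  by exists ord0; rewrite mulr0 add0r y0 -[h]mulr1.
have [le|/ltW ge] := lerP y (h * k.+1%:R).
  have [t ht] := IHk y0 le.
  by exists (widen_ord (leqnSn _) t).
by exists ord_max; rewrite ge -[X in _ + X]mulr1 -mulrDr natr1.
Qed.

(** At the lower corner of a cell containing a zero, [f] is at most [L] times the mesh, hence at
    most [d] on a fine grid. So the cells whose corner lies in the sublevel set cover all zeros. *)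
Lemma zero_set_cover n (f : {mpoly K[n]}) (M e : K) : f != 0 -> 0 < M -> 0 < e ->
  exists k (A : {set {ffun 'I_n -> 'I_k}}),
    [/\ (0 < k)%N, #|A|%:R * (2 * M / k%:R) ^+ n <= e &
     forall x, (forall i, `|x i| <= M) -> f.@[x] = 0 ->
     exists2 v, v \in A &
       forall i, grid_pt M v i <= x i <= grid_pt M v i + 2 * M / k%:R].
Proof.
move=> f0 M0 e0; have [_ [L [_ L0 _ lip]]] := mpoly_lipschitz f M0.
have MM0 : 0 < 2 * M by rewrite mulr_gt0.
have e'0 : 0 < e / (2 * M) ^+ n by rewrite divr_gt0 ?exprn_gt0.
have [d d0 [k0 Hk]] := mpoly_sublevel_count f0 M0 e'0.
have [k1 k1E] : exists k1, 2 * M * L / d <= k1%:R.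
  by exists (Num.truncn (2 * M * L / d)).+1; apply/ltW/truncnS_gt.
pose k := (maxn k0 k1).+1.
have kk0 : (k0 <= k)%N by rewrite leqW // leq_maxl.
have kk1 : (k1 <= k)%N by rewrite leqW // leq_maxr.
have kR : 0 < k%:R :> K by rewrite ltr0n.
have h0 : 0 <= 2 * M / k%:R by rewrite divr_ge0 ?ltW.
exists k, [set v | `|f.@[grid_pt M v]| <= d]; split=> //.
  have := Hk k kk0; rewrite mulrAC ler_pdivlMr ?exprn_gt0 // => H.
  by rewrite expr_div_n mulrA ler_pdivrMr ?exprn_gt0.
move=> x xM fx.
have /fin_all_exists[t tP] i : exists t : 'I_k,
    2 * M / k%:R * t%:R <= x i + M <= 2 * M / k%:R * t%:R + 2 * M / k%:R.
  have := xM i; rewrite ler_norml => /andP[lo hi]; apply: grid_cell.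
    by rewrite -lerBlDr sub0r.
  rewrite divfK ?gt_eqF // mulr_natl mulr2n lerD2r //.
pose v := [ffun i => t i].
have vx i : grid_pt M v i <= x i <= grid_pt M v i + 2 * M / k%:R.
  rewrite /grid_pt ffunE; have := tP i; set a := _ * (_ %:R); set h := _ / _.
  by move=> /andP[lo hi]; apply/andP; split; lra.
exists v => //; rewrite inE -[f.@[_]]subr0 -fx.
have vM i : `|grid_pt M v i| <= M.
  have := vx i; have := xM i; rewrite !ler_norml => /andP[lo hi] /andP[lo' hi'].
  apply/andP; split; last exact: le_trans hi.
  by rewrite /grid_pt lerDl mulr_ge0 // ler0n.
apply: le_trans (lip _ _ (2 * M / k%:R) vM xM h0 _) _ => [i|].
  by rewrite distrC ger0_norm ?lerBlDl ?subr_ge0; case/andP: (vx i).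
move: k1E; rewrite ler_pdivrMr // => k1E.
rewrite mulrA ler_pdivrMr // [leLHS]mulrC; apply: le_trans k1E _.
by rewrite [leLHS]mulrC ler_wpM2l ?ler_nat // ltW.
Qed.

End Grid.

(** * Zero sets of polynomials are null *)

Section NullSets.
Local Open Scope ring_scope.

Lemma box_vol_cube (T : finType) (b : box T) (h : R) :
  0 <= h -> (forall t, b.2 t = b.1 t + h) -> box_vol b = h ^+ #|T|.
Proof.
move=> h0 bh; rewrite /box_vol cardE; elim: (enum T) => [|t s IHs] //=.
rewrite exprS IHs bh; congr (_ * _).
have -> : Rminus (b.1 t + h) (b.1 t) = h by rewrite RminusE addrC addKr.
by apply: Rmax_right; apply/RleP.
Qed.

Definition total_vol (T : finType) (l : seq (box T)) : R := \sum_(b <- l) box_vol b.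

Lemma zero_set_finite_cover (T : finType) (F : {mpoly R[#|T|]}) (M e : R) :
  F != 0 -> 0 < M -> 0 < e -> exists2 l : seq (box T), total_vol l <= e &
    forall x : T -> R, (forall t, `|x t| <= M) -> F.@[fun i => x (enum_val i)] = 0 ->
      exists2 b, List.In b l & in_box b x.
Proof.
move=> F0 M0 e0; have [k [A [k0 volA covA]]] := zero_set_cover F0 M0 e0.
have h0 : 0 <= 2 * M / k%:R :> R by rewrite divr_ge0 ?ler0n // mulr_ge0 ?ler0n // ltW.
pose cell (v : {ffun 'I_#|T| -> 'I_k}) : box T :=
  (fun t => grid_pt M v (enum_rank t), fun t => grid_pt M v (enum_rank t) + 2 * M / k%:R).
exists [seq cell v | v <- enum A].
  rewrite /total_vol big_map (eq_bigr (fun=> (2 * M / k%:R) ^+ #|T|)) => [|v _].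
    by rewrite big_enum /= sumr_const -[leLHS]mulr_natl.
  by apply: (box_vol_cube (h := 2 * M / k%:R)) => //.
move=> x xM Fx; have [i|v vA vx] := covA _ _ Fx; first exact: xM.
exists (cell v).
  have : v \in enum A by rewrite mem_enum.
  elim: (enum A) => //= w s IHs; rewrite inE => /predU1P[->|/IHs]; [by left | by right].
move=> t; have := vx (enum_rank t); rewrite enum_rankK => /andP[/RleP lo /RleP hi].
by split.
Qed.

Lemma box_vol_ge0 (T : finType) (b : box T) : 0 <= box_vol b.
Proof.
rewrite /box_vol; elim: (enum T) => [|t s IHs] /=; first exact: ler01.
by apply: mulr_ge0 => //; apply/RleP/Rmax_l.
Qed.

(** The points bounded by [j] are covered with total volume [d / 2 ^ j.+1], and the finite lists are
    concatenated into one sequence. *)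
Lemma lebesgue_null_bounded (T : finType) (Z : (T -> R) -> Prop) : (0 < #|T|)%N ->
  (forall (j : nat) (e : R), 0 < e -> exists2 l : seq (box T), total_vol l <= e &
     forall x, Z x -> (forall t, `|x t| <= j%:R) -> exists2 b, List.In b l & in_box b x) ->
  lebesgue_null Z.
Proof.
move=> T0 cov d /RltP d0.
have e0 j : 0 < d / 2 ^+ j.+1 by rewrite divr_gt0 // exprn_gt0.
have /functional_choice[l lP] j : exists l : seq (box T), total_vol l <= d / 2 ^+ j.+1 /\
     forall x, Z x -> (forall t, `|x t| <= j%:R) -> exists2 b, List.In b l & in_box b x.
  by have [l ? ?] := cov j _ (e0 j); exists l.
(* A degenerate box in front of each list guarantees that [flat k.+1] has an entry at index [k],
   even if all lists are empty. Its volume is 0 because [T] is inhabited; an empty product would be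
   1. *)
pose b0 : box T := (fun=> 0, fun=> 0).
have vol_b0 : box_vol b0 = 0.
  rewrite (@box_vol_cube _ _ 0) //; first by rewrite expr0n; case: #|T| T0.
  by move=> t; rewrite addr0.
pose flat N := flatten [seq b0 :: l j | j <- iota 0 N].
have flatS N : flat N.+1 = flat N ++ (b0 :: l N).
  by rewrite /flat -[N.+1]addn1 iotaD map_cat flatten_cat /= cats0.
have size_flat N : (N <= size (flat N))%N.
  by elim: N => // N IHN; rewrite flatS size_cat /= addnS ltnS (leq_trans IHN) ?leq_addr.
have nth_flat N1 N2 k : (N1 <= N2)%N -> (k < size (flat N1))%N ->
    nth b0 (flat N2) k = nth b0 (flat N1) k.
  move=> le12 kN; rewrite -(subnK le12); elim: (N2 - N1)%N => // m <-.
  rewrite addSn flatS nth_cat; case: ifP => // /negP[]; apply: leq_trans kN _.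
  by elim: m => // m IHm; rewrite addSn flatS size_cat (leq_trans IHm) ?leq_addr //.
exists (fun k => nth b0 (flat k.+1) k); split.
  move=> x Zx; have [j xj] : exists j : nat, forall t, `|x t| <= j%:R.
    exists (\max_t Num.truncn `|x t|).+1%N => t.
    apply/ltW/(lt_le_trans (truncnS_gt _)); rewrite ler_nat ltnS.
    exact: (leq_bigmax t).
  have [b bl xb] := (lP j).2 x Zx xj.
  have [k kj bE] : exists2 k, (k < size (flat j.+1))%N & nth b0 (flat j.+1) k = b.
    have : List.In b (flat j.+1) by rewrite flatS; apply/List.in_or_app; right; right.
    elim: (flat _) => //= c s IHs [<-|/IHs[k]]; first by exists 0%N.
    by exists k.+1.
  exists k; suff -> : nth b0 (flat k.+1) k = b by [].
  rewrite -bE; have [le|/ltnW le] := leqP k.+1 j.+1; last exact: nth_flat.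
  by rewrite (nth_flat _ _ _ le) ?size_flat.
move=> N; apply/RleP.
have -> : sum_f_R0 (fun k => box_vol (nth b0 (flat k.+1) k)) N =
          \sum_(0 <= k < N.+1) box_vol (nth b0 (flat N.+1) k).
  elim: N => [|N IHN]; first by rewrite big_nat1.
  rewrite /= big_nat_recr //= RplusE IHN; congr (_ + _).
  by apply: eq_big_nat => k /andP[_ kN]; rewrite (nth_flat N.+1 N.+2) // (leq_trans kN).
apply: le_trans (_ : total_vol (flat N.+1) <= _).
  rewrite /total_vol (big_nth b0) [leRHS](big_cat_nat (n := N.+1)) ?size_flat //.
  by rewrite lerDl sumr_ge0 // => k _; apply: box_vol_ge0.
suff H m : total_vol (flat m) <= d - d / 2 ^+ m.
  by apply: le_trans (H _) _; rewrite gerBl ltW // e0.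
elim: m => [|m IHm]; first by rewrite /total_vol big_nil expr0 divr1 subrr.
rewrite flatS /total_vol big_cat big_cons /= vol_b0 add0r.
apply: le_trans (lerD IHm (lP m).1) _.
have -> : d / 2 ^+ m = d / 2 ^+ m.+1 *+ 2; last by rewrite mulr2n opprD addrA subrK.
by rewrite -mulrnAr -[X in _ = d * X]mulr_natr exprS invfM mulrAC mulVf ?mul1r ?pnatr_eq0.
Qed.

Lemma mpoly_zero_set_null (T : finType) (F : {mpoly R[#|T|]}) : (0 < #|T|)%N -> F != 0 ->
  lebesgue_null (fun x : T -> R => F.@[fun i => x (enum_val i)] = 0).
Proof.
move=> T0 F0; apply: lebesgue_null_bounded => // j e e0.
have [l vl cl] := zero_set_finite_cover F0 (ltr0Sn _ j) e0.
exists l => // x Zx xj; apply: cl => // t; apply: le_trans (xj t) _.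
by rewrite ler_nat.
Qed.

End NullSets.

(** * Spread patterns *)

Section Hall.
Variables I T : finType.

(** Rado's argument. If [A i0] has two elements [x] and [y], one of them can be removed: sets [J1],
    [J2] violating the condition after either removal contain [i0], and Hall's condition for their
    union, and for their intersection without [i0], contradicts inclusion-exclusion for the two
    unions of sets. Once no set has two elements, they are pairwise distinct singletons. *)
Lemma hall_marriage (A : I -> {set T}) :
  (forall J : {set I}, #|J| <= #|\bigcup_(j in J) A j|) ->
  exists2 f : I -> T, injective f & forall i, f i \in A i.
Proof.
have [k] := ubnP (\sum_i #|A i|); elim: k A => // k IHk A; rewrite ltnS => leAk hallA.
have A_gt0 i : 0 < #|A i| by have := hallA [set i]; rewrite cards1 big_set1.
have [/existsP[i0 /card_gt1P[x [y [xA yA xy]]]]|] := boolP [exists i, 1 < #|A i|]; last first.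
  rewrite negb_exists => /forallP A_le1.
  have /fin_all_exists[f fA] i : exists x, A i = [set x].
    by apply/cards1P; rewrite eqn_leq A_gt0 leqNgt A_le1.
  exists f => [i j fij|i]; last by rewrite fA inE.
  apply/eqP; apply: contraT => ij; have := hallA [set i; j].
  by rewrite cards2 ij bigcup_setU !big_set1 !fA fij setUid cards1.
pose A' z i := if i == i0 then A i :\ z else A i.
have A'out z (J : {set I}) : i0 \notin J -> \bigcup_(j in J) A' z j = \bigcup_(j in J) A j.
  move=> i0J; apply: eq_bigr => j jJ; rewrite /A' ifN //.
  by apply: contraNneq i0J => <-.
have A'in z (J : {set I}) : i0 \in J ->
    \bigcup_(j in J) A' z j = \bigcup_(j in J :\ i0) A j :|: (A i0 :\ z).
  move=> i0J; rewrite -{1}(setD1K i0J) bigcup_setU big_set1 {1}/A' eqxx setUC.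
  by rewrite A'out // !inE eqxx.
have step z : z \in A i0 -> (forall J : {set I}, #|J| <= #|\bigcup_(j in J) A' z j|) ->
    exists2 f : I -> T, injective f & forall i, f i \in A i.
  move=> zA /IHk[|f f_inj fA].
    apply: leq_trans leAk; rewrite (bigD1 i0) //= [leqRHS](bigD1 i0) //=.
    rewrite /A' eqxx (cardsD1 z (A i0)) zA add1n ltnS leq_add2l.
    by apply: leq_sum => j /negPf->.
  by exists f => // i; have := fA i; rewrite /A'; case: eqP => // _ /setD1P[].
have [/forallP Hx|] := boolP [forall J : {set I}, #|J| <= #|\bigcup_(j in J) A' x j|].
  exact: step Hx.
rewrite negb_forall => /existsP[J1]; rewrite -ltnNge => lt1.
have [/forallP Hy|] := boolP [forall J : {set I}, #|J| <= #|\bigcup_(j in J) A' y j|].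
  exact: step Hy.
rewrite negb_forall => /existsP[J2]; rewrite -ltnNge => lt2; exfalso.
have i1 : i0 \in J1 by apply: contraLR lt1 => i1; rewrite -leqNgt A'out.
have i2 : i0 \in J2 by apply: contraLR lt2 => i2; rewrite -leqNgt A'out.
move: lt1 lt2; rewrite !A'in // (cardsD1 i0 J1) i1 (cardsD1 i0 J2) i2 !add1n !ltnS.
set K1 := J1 :\ i0; set K2 := J2 :\ i0.
set B1 := _ :|: _ => le1; set B2 := _ :|: _ => le2.
have leU : #|K1 :|: K2|.+1 <= #|B1 :|: B2|.
  have := hallA (i0 |: (K1 :|: K2)); rewrite cardsU1 !inE eqxx /= add1n => /leq_trans; apply.
  apply/subset_leq_card/subsetP => t /bigcupP[j + tj]; rewrite !inE => /or3P[/eqP ji|jK|jK].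
  - rewrite ji in tj; have [tx|tx] := eqVneq t x; last by rewrite tj orbT.
    by rewrite tj tx xy !orbT.
  - by apply/orP; left; apply/orP; left; apply/bigcupP; exists j; rewrite // !inE.
  - by apply/orP; right; apply/orP; left; apply/bigcupP; exists j; rewrite // !inE.
have leI : #|K1 :&: K2| <= #|B1 :&: B2|.
  apply: leq_trans (hallA _) _; apply/subset_leq_card/subsetP => t /bigcupP[j + tj].
  by rewrite inE => /andP[j1 j2]; rewrite !inE; apply/andP; split; apply/orP; left;
     apply/bigcupP; exists j.
have := leq_add leU leI; rewrite cardsUI addSn cardsUI ltnNge.
by rewrite leq_add.
Qed.

End Hall.

(** A uniform [k]-subset of [n] points lies in a given [w]-subset with probability at most
    [(w / n) ^ k], as every factor [(w - i) / (n - i)] is at most [w / n]. *)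
Lemma bin_ratio n w k : w <= n -> 'C(w, k) * n ^ k <= 'C(n, k) * w ^ k.
Proof.
move=> wn; rewrite -(@leq_pmul2r k`!) ?fact_gt0 // mulnAC bin_ffact mulnAC bin_ffact.
elim: k => // k IHk; rewrite !ffactnSr !expnSr.
have [kw|wk] := leqP k w; last by rewrite ffact_small // !mul0n.
have -> : w ^_ k * (w - k) * (n ^ k * n) = (w ^_ k * n ^ k) * ((w - k) * n) by nia.
have -> : n ^_ k * (n - k) * (w ^ k * w) = (n ^_ k * w ^ k) * ((n - k) * w) by nia.
apply: leq_mul IHk _; nia.
Qed.

Lemma set_extend (T : finType) (A : {set T}) m : #|A| <= m <= #|T| ->
  exists2 B : {set T}, A \subset B & #|B| = m.
Proof.
move=> /andP[Am mT]; elim: m Am mT => [|m IHm].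
  by rewrite leqn0 => /eqP A0 _; exists A.
rewrite leq_eqVlt => /predU1P[<- _|]; first by exists A.
rewrite ltnS => Am mT; have [B AB Bm] := IHm Am (ltnW mT).
have [x xB] : exists x, x \notin B.
  apply/existsP; rewrite -negb_forall; apply: contraTN mT => /forallP allB.
  by rewrite -Bm -leqNgt subset_leq_card //; apply/subsetP.
by exists (x |: B); rewrite ?cardsU1 ?xB ?Bm // (subset_trans AB) ?subsetUr.
Qed.

(** * Patterns confined to a set of rows *)

Section Patterns.
Variables (n M : nat) (k : 'I_M -> nat).
Implicit Types (Om : {ffun 'I_M -> {set 'I_n}}) (J B : {set 'I_M}) (W : {set 'I_n}).

Definition patterns_in J W : {set {ffun 'I_M -> {set 'I_n}}} :=
  [set Om : {ffun 'I_M -> {set 'I_n}} | [forall j, #|Om j| == k j] & [forall j in J, Om j \subset W]].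

Lemma card_patterns_in J W :
  #|patterns_in J W| = \prod_j 'C(if j \in J then #|W| else n, k j).
Proof.
pose D j := [set A : {set 'I_n} | A \subset (if j \in J then W else setT) & #|A| == k j].
transitivity #|family (fun j => mem (D j))|.
  apply: eq_card => Om; rewrite inE; apply/andP/familyP => [[/forallP c /forallP s] j|H].
    by rewrite !inE c andbT; have := s j; case: (j \in J) => //= _; apply: subsetT.
  split; apply/forallP => j; have := H j; rewrite !inE; first by case/andP.
  by case: (j \in J) => // /andP[-> _].
rewrite card_family foldrE big_map big_enum; apply: eq_bigr => j _ /=.
transitivity #|D j|; first exact: eq_card.
by rewrite cards_draws; case: (j \in J); rewrite // cardsT card_ord.
Qed.

Definition spread rho Om B := [forall J : {set 'I_M},
  (J != set0) && (J \subset B) ==>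
    (minn n (#|J|.*2 + rho).+1 <= #|\bigcup_(j in J) Om j|)].

(** The union is enlarged to a set [W] whose size depends on [#|J|] only, so that the union bound
    can count the candidates for [W]. The [n.-1] is possible because a violating union misses a
    row. *)
Lemma not_spread rho Om B : 0 < n -> ~~ spread rho Om B ->
  exists J : {set 'I_M}, exists2 W : {set 'I_n},
    [&& J != set0, J \subset B & #|W| == minn n.-1 (#|J|.*2 + rho)] &
    forall j, j \in J -> Om j \subset W.
Proof.
move=> n0; rewrite negb_forall => /existsP[J]; rewrite negb_imply -ltnNge => /andP[/andP[J0 JB]].
rewrite leq_min => /andP[lt1 lt2].
set U := \bigcup_(j in J) Om j in lt1 lt2 *.
have cU : #|U| <= minn n.-1 (#|J|.*2 + rho) <= #|'I_n|.
  by rewrite leq_min -(ltnS _ n.-1) prednK // lt1 -ltnS lt2 card_ord geq_min leq_pred.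
have [W UW cW] := set_extend cU.
exists J, W; first by rewrite J0 JB cW eqxx.
by move=> j jJ; apply: subset_trans UW; apply: bigcup_sup jJ.
Qed.

End Patterns.

(** * Numerical estimates *)

Section Estimates.
Local Open Scope R_scope.

Lemma INR_mulnE a b : INR (a * b)%N = INR a * INR b.
Proof. by rewrite -multE mult_INR. Qed.
Lemma INR_addnE a b : INR (a + b)%N = INR a + INR b.
Proof. by rewrite -plusE plus_INR. Qed.
Lemma INR_leq a b : (a <= b)%N -> INR a <= INR b.
Proof. by move/ssrnat.leP; apply: le_INR. Qed.
Lemma INR_gt0 a : (0 < a)%N -> 0 < INR a.
Proof. by move/ssrnat.ltP; apply: lt_0_INR. Qed.

Lemma exp_le_mono x y : x <= y -> exp x <= exp y.
Proof. by move=> [/exp_increasing|->]; lra. Qed.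

Lemma exp_pow_INR x k : exp x ^ k = exp (INR k * x).
Proof.
elim: k => [|k IHk]; first by rewrite Rmult_0_l exp_0.
by rewrite -tech_pow_Rmult IHk -exp_plus S_INR; congr exp; ring.
Qed.

Lemma ln_le_sub1 x : 0 < x -> ln x <= x - 1.
Proof. by move=> x0; have := exp_ineq1_le (ln x); rewrite exp_ln //; lra. Qed.

Lemma ln_le_mono x y : 0 < x -> x <= y -> ln x <= ln y.
Proof. by move=> x0 [lt|->]; [left; apply: ln_increasing | right]. Qed.

Lemma ln_ge_0 x : 1 <= x -> 0 <= ln x.
Proof. by rewrite -ln_1; apply: ln_le_mono; lra. Qed.

Lemma bin_pow_le N k x : 0 <= x -> INR 'C(N, k) * x ^ k <= (1 + x) ^ N.
Proof.
move=> x0; have xk j : 0 <= x ^ j by apply: pow_le.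
elim: N k => [|N IHN] [|k]; rewrite ?bin0 ?bin0n; try (rewrite /=; lra).
  by rewrite Rmult_1_l; apply: pow_R1_Rle; lra.
rewrite binS INR_addnE -2!tech_pow_Rmult.
by have := IHN k.+1; have := IHN k; rewrite -tech_pow_Rmult; nra.
Qed.

(** The bound [(e N / k) ^ k], obtained from the [k]-th term of the expansion of [(1 + k / N) ^ N],
    which is at most [exp k]. *)
Lemma bin_le_exp N k : (0 < k <= N)%N ->
  INR 'C(N, k) <= exp (INR k * (1 + ln (INR N / INR k))).
Proof.
move=> /andP[k0 kN]; have kR := INR_gt0 k0; have NR := INR_gt0 (leq_trans k0 kN).
have x0 : 0 < INR k / INR N by apply: Rdiv_lt_0_compat.
have y0 : 0 < INR N / INR k by apply: Rdiv_lt_0_compat.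
have := @bin_pow_le N k _ (Rlt_le _ _ x0).
have : (1 + INR k / INR N) ^ N <= exp (INR k).
  have -> : exp (INR k) = exp (INR k / INR N) ^ N.
    by rewrite exp_pow_INR; congr exp; field; lra.
  by apply: pow_incr; split; [lra | apply: exp_ineq1_le].
set c := INR 'C(_, _) => H1 H2.
have -> : INR k * (1 + ln (INR N / INR k)) = INR k + INR k * ln (INR N / INR k) by ring.
rewrite exp_plus -exp_pow_INR exp_ln //.
have -> : c = c * (INR k / INR N) ^ k * (INR N / INR k) ^ k.
  rewrite Rmult_assoc -Rpow_mult_distr (_ : _ / _ * _ = 1) ?pow1; last by field; lra.
  by ring.
by apply: Rmult_le_compat_r; [apply/pow_le/Rlt_le | lra].
Qed.

Lemma bin_le_expn N k : ('C(N, k) <= N ^ k)%N.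
Proof.
apply: leq_trans (_ : 'C(N, k) * k`! <= _)%N; first by rewrite leq_pmulr ?fact_gt0.
rewrite bin_ffact; elim: k => // k IHk.
by rewrite ffactnSr expnSr leq_mul // leq_subr.
Qed.

Lemma INR_expn_exp N k : (0 < N)%N -> INR (N ^ k) = exp (INR k * ln (INR N)).
Proof.
move=> N0; rewrite -exp_pow_INR exp_ln; last exact: INR_gt0.
by elim: k => [|k IHk]; rewrite ?expn0 // expnS INR_mulnE IHk.
Qed.

Lemma ln2_le1 : ln 2 <= 1.
Proof. by have := @ln_le_sub1 2; lra. Qed.

Lemma ln3_ge1 : 1 <= ln 3.
Proof. by rewrite -{1}(ln_exp 1); apply: ln_le_mono (exp_pos _) exp_le_3. Qed.

(** * One term of the union bound *)

Section Bound.
Variables (n rho h s w l : nat) (eps : R).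
Hypotheses (eps01 : 0 < eps < 1) (n_gt0 : (0 < n)%N) (rho6 : (6 * rho <= n)%N)
  (rho0 : (0 < rho)%N) (rhol : (2 * rho < l)%N) (l_le_n : (l <= n)%N)
  (hE : h = (n - rho)./2) (s0 : (0 < s)%N) (sh : (s <= h)%N)
  (wE : w = minn n.-1 (s.*2 + rho)) (lw : (l <= w)%N).
Let lam := ln (INR n / eps).
Hypothesis llam : INR l > 9 * lam + 9.

Let nR : 0 < INR n. Proof. exact: INR_gt0. Qed.

Lemma ln_n_le_lam : ln (INR n) <= lam.
Proof.
apply: ln_le_mono => //; apply: Rmult_le_reg_r (proj1 eps01) _.
by rewrite /Rdiv Rmult_assoc Rinv_l; nra.
Qed.

Lemma exp_neg_lam : exp (- lam) = eps / INR n.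
Proof.
rewrite /lam exp_Ropp exp_ln; last by apply: Rdiv_lt_0_compat; lra.
by field; lra.
Qed.

(* Bootstrapping: n >= l > 9 ln n + 9 forces n to be large, which in turn improves
   the lower bound on ln n. *)
Lemma lam_ge3 : 3 <= lam.
Proof.
have lnR := INR_leq l_le_n; have lnlam := ln_n_le_lam.
have l2 := ln_lt_2; have l3 := ln3_ge1.
have ln6 : ln 6 = ln 2 + ln 3 by rewrite -ln_mult; [congr ln|..]; lra.
have ln18 : ln 18 = ln 6 + ln 3 by rewrite -ln_mult; [congr ln|..]; lra.
have ln27 : ln 27 = ln 3 + ln 3 + ln 3 by rewrite -!ln_mult; [congr ln|..]; lra.
have n6 : 6 <= INR n.
  have -> : 6 = INR 6 by rewrite /=; lra.
  by apply: INR_leq; lia.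
have := @ln_le_mono 6 (INR n); have := @ln_le_mono 18 (INR n).
by have := @ln_le_mono 27 (INR n); lra.
Qed.

Lemma ln_ratio : ln (INR w / INR n) <= - (INR (n - w) / INR n).
Proof.
have wn : (w <= n)%N by lia.
have w0 : (0 < w)%N by lia.
have := @ln_le_sub1 (INR w / INR n) (Rdiv_lt_0_compat _ _ (INR_gt0 w0) nR).
have -> : INR (n - w) = INR n - INR w by rewrite -{2}(subnK wn) INR_addnE; ring.
have -> : - ((INR n - INR w) / INR n) = INR w / INR n - 1 by field; lra.
by [].
Qed.

Let ratioE : (INR w / INR n) ^ (l * s) = exp (INR l * INR s * ln (INR w / INR n)).
Proof.
rewrite -INR_mulnE -exp_pow_INR exp_ln //.
by apply: Rdiv_lt_0_compat => //; apply: INR_gt0; lia.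
Qed.

(* The contribution of the sets of s columns and w rows to the union bound. *)
Let term := INR 'C(h, s) * INR 'C(n, w) * (INR w / INR n) ^ (l * s).

(** Here both binomials are bounded through complements, by [h ^ (h - s)] and [n ^ (n - w)]. Since
    [2 (h - s) <= n - w], they add at most [3 / 2 * (n - w) * lam] to the exponent, while the power
    removes at least [(n - w) * l * s / n] with [s / n >= 7 / 24]; and [7 / 24 * 9 > 5 / 2]. *)
Lemma term_large : (3 * n <= 4 * w)%N -> term <= exp (- (INR (n - w) * lam)).
Proof.
move=> w34; have lam3 := lam_ge3; have lnn := ln_n_le_lam.
have h0 : (0 < h)%N by lia.
have hn : (h <= n)%N by lia.
have mhs : (2 * (h - s) <= n - w)%N by lia.
have C1 : INR 'C(h, s) <= exp (INR (h - s) * ln (INR h)).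
  by rewrite -INR_expn_exp // -bin_sub //; apply/INR_leq/bin_le_expn.
have C2 : INR 'C(n, w) <= exp (INR (n - w) * ln (INR n)).
  by rewrite -INR_expn_exp // -bin_sub; [apply/INR_leq/bin_le_expn | lia].
have lnh : 0 <= ln (INR h) <= ln (INR n).
  split; first by apply: ln_ge_0; apply: (@INR_leq 1).
  by apply: ln_le_mono; [apply: INR_gt0 | apply: INR_leq].
(* From [2 s >= w - rho], [w >= 3 n / 4] and [rho <= n / 6]. *)
have sR : 7 * INR n <= 24 * INR s.
  have : (7 * n <= 24 * s)%N by lia.
  by move/INR_leq; rewrite !INR_mulnE /=; lra.
have mR : 2 * INR (h - s) <= INR (n - w).
  by move/INR_leq: mhs; rewrite INR_mulnE /=; lra.
have hs0 := pos_INR (h - s); have m0 := pos_INR (n - w).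
have l0 := pos_INR l; have sR0 := pos_INR s.
rewrite /term ratioE.
apply: Rle_trans (_ : exp (INR (h - s) * ln (INR h)) * exp (INR (n - w) * ln (INR n)) *
   exp (INR l * INR s * ln (INR w / INR n)) <= _).
  apply: Rmult_le_compat_r; first exact/Rlt_le/exp_pos.
  by apply: Rmult_le_compat => //; apply: pos_INR.
rewrite -!exp_plus; apply: exp_le_mono.
have e1 : INR (h - s) * ln (INR h) <= INR (n - w) / 2 * lam by nra.
have e2 : INR (n - w) * ln (INR n) <= INR (n - w) * lam by nra.
have e3 : INR l * INR s * ln (INR w / INR n) <= - (INR (n - w) * (7 / 24 * INR l)).
  have := ln_ratio; have : 7 / 24 <= INR s / INR n.
    by apply: Rmult_le_reg_r nR _; rewrite /Rdiv !Rmult_assoc Rinv_l; lra.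
  move=> sn lr; apply: Rle_trans (_ : INR l * INR s * - (INR (n - w) / INR n) <= _).
    by apply: Rmult_le_compat_l lr; apply: Rmult_le_pos.
  have -> : INR l * INR s * - (INR (n - w) / INR n) =
     - (INR (n - w) * ((INR s / INR n) * INR l)) by field; lra.
  by apply: Ropp_le_contravar; apply: Rmult_le_compat_l => //; apply: Rmult_le_compat_r.
by nra.
Qed.

(** Here everything is compared with an [s]-th power. With [y = ln (n / w) >= 1 / 4], the binomials
    add at most [s * (6 + 5 y)] to the exponent and the power removes [s * l * y]. The remaining
    [s * (5 - 9 / 4 * lam)] is negative enough because [s >= 9] and [lam >= 3]. *)
Lemma term_small : (4 * w < 3 * n)%N -> term <= exp (- (2 * lam)).
Proof.
move=> w34; have lam3 := lam_ge3; have lnn := ln_n_le_lam.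
have w0 : (0 < w)%N by lia.
have wn : (w <= n)%N by lia.
(* As [2 * rho < l <= w], the summand [rho] of [s.*2 + rho] is less than half of [w]. *)
have w4s : (w <= 4 * s)%N by lia.
have wR := INR_gt0 w0; have sR := INR_gt0 s0; have hR : 0 < INR h by apply: INR_gt0; lia.
have C1 := @bin_le_exp h s; have C2 := @bin_le_exp n w.
rewrite s0 sh in C1; rewrite w0 wn in C2; move: (C1 isT) (C2 isT) => {}C1 {}C2.
set y := ln (INR n / INR w) in C2.
have nw0 : 0 < INR n / INR w by apply: Rdiv_lt_0_compat.
have yE : ln (INR w / INR n) = - y.
  by rewrite /y -ln_Rinv //; congr ln; field; lra.
have y14 : / 4 <= y.
  have := ln_ratio; rewrite yE => H; suff : / 4 <= INR (n - w) / INR n by lra.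
  have : (n <= 4 * (n - w))%N by lia.
  move/INR_leq; rewrite INR_mulnE /= => H4.
  by apply: Rmult_le_reg_r nR _; rewrite /Rdiv Rmult_assoc Rinv_l; lra.
have w4R : INR w <= 4 * INR s by move/INR_leq: w4s; rewrite INR_mulnE /=; lra.
have lnhs : ln (INR h / INR s) <= 1 + y.
  apply: Rle_trans (_ : ln (2 * (INR n / INR w)) <= _); last first.
    by rewrite ln_mult //; [have := ln2_le1; rewrite -/y|..]; lra.
  apply: ln_le_mono; first exact: Rdiv_lt_0_compat.
  have h2 : 2 * INR h <= INR n.
    by have /INR_leq : (2 * h <= n)%N by [lia]; rewrite INR_mulnE /=; lra.
  apply: (Rmult_le_reg_r _ _ _ sR); apply: (Rmult_le_reg_r _ _ _ wR).
  have -> : INR h / INR s * INR s * INR w = INR h * INR w by field; lra.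
  have -> : 2 * (INR n / INR w) * INR s * INR w = 2 * INR n * INR s by field; lra.
  by nra.
have s9 : 9 <= INR s.
  by move/INR_leq: lw; lra.
have l0 := pos_INR l.
rewrite /term ratioE yE.
apply: Rle_trans (_ : exp (INR s * (1 + ln (INR h / INR s))) * exp (INR w * (1 + y)) *
   exp (INR l * INR s * - y) <= _).
  apply: Rmult_le_compat_r; first exact/Rlt_le/exp_pos.
  by apply: Rmult_le_compat => //; apply: pos_INR.
rewrite -!exp_plus; apply: exp_le_mono.
have e1 : INR s * (1 + ln (INR h / INR s)) <= INR s * (2 + y) by nra.
have e2 : INR w * (1 + y) <= INR s * (4 + 4 * y) by nra.
have e3 : 6 + 5 * y - INR l * y <= 5 - 9 / 4 * lam.
  have : (INR l - 5) * / 4 <= (INR l - 5) * y by apply: Rmult_le_compat_l; lra.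
  by lra.
have e4 : INR s * (6 + 5 * y - INR l * y) <= - (2 * lam) by nra.
by lra.
Qed.

(** Only for the full block can [n - w] be 1; for [s < h] one has [s.*2 + rho <= n - 2]. The
    resulting square of [eps / n] compensates for the number of smaller values of [s]. *)
Lemma term_bound : term <= exp (- ((if s == h then 1 else 2) * lam)).
Proof.
have lam3 := lam_ge3.
have [w34|w34] := leqP (3 * n) (4 * w).
  apply: Rle_trans (term_large w34) _; apply/exp_le_mono/Ropp_le_contravar.
  apply: Rmult_le_compat_r; first lra.
  case: eqP => sh'; first by apply: (@INR_leq 1); lia.
  by have -> : 2 = INR 2; [rewrite /=; lra | apply: INR_leq; lia].
apply: Rle_trans (term_small w34) _; apply/exp_le_mono/Ropp_le_contravar.
by case: eqP => _; lra.
Qed.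

End Bound.

End Estimates.

(** * Counting patterns that are not spread *)

Section PatternCounts.
Local Open Scope ring_scope.

Lemma leq_card_bigcup (I T : finType) (P : pred I) (F : I -> {set T}) :
  (#|\bigcup_(i | P i) F i| <= \sum_(i | P i) #|F i|)%N.
Proof.
elim/big_rec2: _ => [|i m A _ Am]; first by rewrite cards0.
by apply: leq_trans (leq_card_setU _ _) _; rewrite leq_add2l.
Qed.

Section Count.
Variables (n M : nat) (k : 'I_M -> nat).

Lemma valid_patternsE : valid_patterns n k = patterns_in k set0 setT.
Proof.
apply/setP => Om; rewrite !inE; apply: (sameP idP); apply: (iffP andP) => [[]//|->].
by split=> //; apply/forallP => j; rewrite in_set0.
Qed.

Lemma patterns_in_le (J : {set 'I_M}) (W : {set 'I_n}) :
  (#|patterns_in k J W| * n ^ (\sum_(j in J) k j) <=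
   #|valid_patterns n k| * #|W| ^ (\sum_(j in J) k j))%N.
Proof.
rewrite valid_patternsE !card_patterns_in !expn_sum.
rewrite [X in (_ * X <= _)%N]big_mkcond [X in (_ <= _ * X)%N]big_mkcond -!big_split.
apply: leq_prod => j _ /=; rewrite in_set0; case: (j \in J) => //.
by apply: bin_ratio; rewrite -[leqRHS]card_ord max_card.
Qed.

(** As [#|W| / n <= 1], observing more than [l] entries in a column only lowers the probability. *)
Lemma patterns_in_leR l (J : {set 'I_M}) (W : {set 'I_n}) :
  (0 < n)%N -> (forall j, l <= k j)%N ->
  #|patterns_in k J W|%:R <= #|valid_patterns n k|%:R * (#|W|%:R / n%:R) ^+ (l * #|J|) :> R.
Proof.
move=> n0 lk; have nR : 0 < n%:R :> R by rewrite ltr0n.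
have Wn : (#|W| <= n)%N by rewrite -[leqRHS]card_ord max_card.
have leJ : (l * #|J| <= \sum_(j in J) k j)%N.
  by rewrite mulnC -sum_nat_const leq_sum.
apply: le_trans (_ : #|valid_patterns n k|%:R *
    (#|W|%:R / n%:R) ^+ (\sum_(j in J) k j) <= _); last first.
  rewrite ler_wpM2l ?ler0n // ler_wiXn2l ?divr_ge0 ?ler0n //.
  by rewrite ler_pdivrMr // mul1r ler_nat.
rewrite expr_div_n mulrA ler_pdivlMr ?exprn_gt0 // -!natrX -!natrM ler_nat.
exact: patterns_in_le.
Qed.

Lemma sum_subsets_by_card (B : {set 'I_M}) (g : nat -> R) :
  \sum_(J : {set 'I_M} | (J != set0) && (J \subset B)) g #|J| =
  \sum_(1 <= s < #|B|.+1) 'C(#|B|, s)%:R * g s.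
Proof.
rewrite (partition_big (fun J : {set 'I_M} => inord #|J| : 'I_#|B|.+1) predT) //=.
pose G s := \sum_(J : {set 'I_M} | [&& J != set0, J \subset B & #|J| == s]) g #|J|.
transitivity (\sum_(s < #|B|.+1) G s).
  apply: eq_bigr => s _; apply: eq_bigl => J; rewrite -andbA; congr (_ && _).
  case JB: (J \subset B) => //=; rewrite -val_eqE /= inordK // ltnS.
  exact: subset_leq_card.
rewrite -(big_mkord predT G) [LHS]big_ltn //= {1}/G [X in X + _]big_pred0 ?add0r => [|J].
  apply: eq_big_nat => s /andP[s0 sB].
  rewrite /G (eq_bigr (fun=> g s)) => [|J /and3P[_ _ /eqP->]] //.
  rewrite sumr_const -[LHS]mulr_natl; congr (_%:R * _).
  rewrite -(cards_draws B s) cardsE; apply: eq_card => J; rewrite !unfold_in /=.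
  by case: eqP => [->|_] /=; rewrite ?sub0set ?cards0 ?(ltn_eqF s0) ?andbF ?(andbC (_ \subset _)).
by case: (eqVneq J set0) => //= J0; rewrite cards_eq0 (negPf J0) andbF.
Qed.

Lemma not_spread_count (rho l : nat) (eps : R) (B : {set 'I_M}) :
  Rlt 0 eps /\ Rlt eps 1 -> (0 < n)%N -> (6 * rho <= n)%N -> (0 < rho)%N ->
  (2 * rho < l)%N -> (forall j, l <= k j <= n)%N -> (l <= n)%N ->
  #|B| = ((n - rho)./2)%N -> Rlt (Rplus (Rmult 9 (ln (Rdiv (INR n) eps))) 9) (INR l) ->
  #|[set Om in valid_patterns n k | ~~ spread rho Om B]|%:R
     <= 3 / 2 * (eps / n%:R) * #|valid_patterns n k|%:R :> R.
Proof.
move=> eps01 n0 rho6 rho0 rhol lk l_le_n cB llam.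
pose w s := minn n.-1 (s.*2 + rho).
set V := #|valid_patterns n k|.
pose PJ (J : {set 'I_M}) := (J != set0) && (J \subset B).
pose PW (J : {set 'I_M}) (W : {set 'I_n}) := #|W| == w #|J|.
(* A set of fewer than [l] rows contains the observations of no column, so its term is 0; the
   estimate [term_bound] is for [l <= w s]. *)
pose g s : R := if (l <= w s)%N then 'C(n, w s)%:R * ((w s)%:R / n%:R) ^+ (l * s) else 0.
have union : (#|[set Om in valid_patterns n k | ~~ spread rho Om B]| <=
    \sum_(J | PJ J) \sum_(W | PW J W) #|patterns_in k J W|)%N.
  apply: leq_trans (_ : #|\bigcup_(J | PJ J) \bigcup_(W | PW J W) patterns_in k J W| <= _)%N.
    apply/subset_leq_card/subsetP => Om; rewrite inE => /andP[vOm].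
    move=> /(not_spread n0)[J [W /and3P[J0 JB cW] JW]].
    apply/bigcupP; exists J; first exact/andP.
    apply/bigcupP; exists W => //; move: vOm; rewrite !inE => ->.
    by apply/forall_inP.
  apply: leq_trans (leq_card_bigcup _ _) _.
  by apply: leq_sum => J _; apply: leq_card_bigcup.
have {union} : #|[set Om in valid_patterns n k | ~~ spread rho Om B]|%:R <=
    \sum_(J | PJ J) V%:R * g #|J|.
  apply: le_trans (_ : (\sum_(J | PJ J) \sum_(W | PW J W) #|patterns_in k J W|)%:R <= _).
    by rewrite ler_nat.
  rewrite natr_sum; apply: ler_sum => J /andP[J0 JB]; rewrite natr_sum /g.
  have [lw|wl] := leqP l (w #|J|).
    apply: le_trans (_ : \sum_(W | PW J W) V%:R * ((w #|J|)%:R / n%:R) ^+ (l * #|J|) <= _).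
      apply: ler_sum => W /eqP <-; apply: patterns_in_leR => // j.
      by case/andP: (lk j).
    rewrite sumr_const -[leLHS]mulr_natl mulrCA ler_wpM2l ?ler0n // ler_wpM2r //.
      by rewrite exprn_ge0 // divr_ge0 ?ler0n.
    by rewrite ler_nat -[n in 'C(n, _)]card_ord -card_draws cardsE.
  rewrite mulr0 big1 // => W /eqP cW; rewrite card_patterns_in.
  have [j jJ] := set0Pn _ J0.
  rewrite (bigD1 j) //= jJ bin_small ?mul0n // cW (leq_trans wl) //.
  by case/andP: (lk j).
move=> /le_trans; apply; rewrite -mulr_sumr mulrC ler_wpM2r ?ler0n //.
rewrite sum_subsets_by_card; set h := #|B| in cB *.
have h1 : (0 < h)%N by rewrite cB; lia.
have nR : 0 < n%:R :> R by rewrite ltr0n.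
pose E : R := eps / n%:R.
have eps0 : 0 < eps by apply/RltP; case: eps01.
have eps1 : eps <= 1 by apply/ltW/RltP; case: eps01.
have E0 : 0 < E by rewrite divr_gt0.
have EE : exp (Ropp (ln (Rdiv (INR n) eps))) = E.
  by rewrite exp_neg_lam // RdivE INRE.
have term_le s : (0 < s)%N -> (s <= h)%N -> 'C(h, s)%:R * g s <= if s == h then E else E * E.
  move=> s0 sh; rewrite /g; have [lw|_] := leqP l (w s); last first.
    by rewrite mulr0; case: ifP => _; [exact: ltW | rewrite mulr_ge0 ?ltW].
  have T := @term_bound n rho h s (w s) l eps eps01 n0 rho6 rho0 rhol l_le_n cB s0 sh erefl lw llam.
  have -> : 'C(h, s)%:R * ('C(n, w s)%:R * ((w s)%:R / n%:R) ^+ (l * s)) =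
    Rmult (Rmult (INR 'C(h, s)) (INR 'C(n, w s))) (pow (Rdiv (INR (w s)) (INR n)) (l * s)).
    by rewrite !INRE RpowE RdivE mulrA.
  move/RleP in T; apply: (le_trans T); case: eqP => _; first by rewrite Rmult_1_l EE.
  rewrite -EE -[X in _ <= X]exp_plus; apply/RleP/exp_le_mono; lra.
apply: le_trans (_ : \sum_(1 <= s < h.+1) (if s == h then E else E * E) <= _).
  rewrite big_seq [leRHS]big_seq; apply: ler_sum => s.
  by rewrite mem_index_iota ltnS => /andP[s0 sh]; apply: term_le.
rewrite big_nat_recr //= eqxx (eq_big_nat _ _ (F2 := fun=> E * E)) => [|s /andP[_ sh]]; last first.
  by rewrite ltn_eqF.
rewrite sumr_const_nat -[(_ * _) *+ _]mulr_natl mulrA -[X in _ + X]mul1r -mulrDl.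
apply: ler_wpM2r; first exact: ltW.
(* The terms for [s < h] add up to at most [E / 2], whence the factor [3 / 2]; this uses
   [2 (h - 1) <= n] and [eps <= 1]. *)
have : (h - 1)%:R * E <= 1 / 2.
  rewrite /E mulrA ler_pdivrMr //.
  have : (2 * (h - 1))%:R <= n%:R :> R by rewrite ler_nat; lia.
  rewrite natrM => h2; have := ler_wpM2l (ler0n R (h - 1)) eps1; rewrite mulr1.
  move: h2 => h2 H; apply: le_trans H _.
  by rewrite mul1r mulrC ler_pdivlMr // mulrC.
move=> H; have -> : 3 = 1 + 2 :> R by rewrite -natr1 addrC.
by rewrite mulrDl divff ?pnatr_eq0 // lerD2r.
Qed.

End Count.

End PatternCounts.

(** * Generic properties *)

Section Generic.
Local Open Scope ring_scope.
Variable K : numFieldType.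
Implicit Types V W U E : finType.

Definition polyfun V (f : (V -> K) -> K) :=
  exists F : {mpoly K[#|V|]}, forall x, f x = F.@[fun i => x (enum_val i)].

Lemma polyfun_const V c : polyfun (fun _ : V -> K => c).
Proof. by exists c%:MP => x; rewrite mevalC. Qed.

Lemma polyfun_var V (v : V) : polyfun (fun x => x v).
Proof. by exists 'X_(enum_rank v) => x; rewrite mevalXU enum_rankK. Qed.

Lemma polyfunD V (f g : (V -> K) -> K) :
  polyfun f -> polyfun g -> polyfun (fun x => f x + g x).
Proof. by move=> [F fE] [G gE]; exists (F + G) => x; rewrite mevalD fE gE. Qed.

Lemma polyfunN V (f : (V -> K) -> K) : polyfun f -> polyfun (fun x => - f x).
Proof. by move=> [F fE]; exists (- F) => x; rewrite mevalN fE. Qed.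

Lemma polyfunM V (f g : (V -> K) -> K) :
  polyfun f -> polyfun g -> polyfun (fun x => f x * g x).
Proof. by move=> [F fE] [G gE]; exists (F * G) => x; rewrite mevalM fE gE. Qed.

Lemma polyfun_sum V (I : finType) (P : pred I) (f : I -> (V -> K) -> K) :
  (forall i, polyfun (f i)) -> polyfun (fun x => \sum_(i | P i) f i x).
Proof.
move=> /fin_all_exists[F fE]; exists (\sum_(i | P i) F i) => x.
by rewrite raddf_sum; apply: eq_bigr => i _; apply: fE.
Qed.

Lemma polyfun_prod V (I : finType) (P : pred I) (f : I -> (V -> K) -> K) :
  (forall i, polyfun (f i)) -> polyfun (fun x => \prod_(i | P i) f i x).
Proof.
move=> /fin_all_exists[F fE]; exists (\prod_(i | P i) F i) => x.
by rewrite rmorph_prod; apply: eq_bigr => i _; apply: fE.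
Qed.

Lemma polyfun_comp V W (f : (W -> K) -> K) (phi : (V -> K) -> W -> K) :
  polyfun f -> (forall w, polyfun (fun x => phi x w)) -> polyfun (fun x => f (phi x)).
Proof.
move=> [F fE] /fin_all_exists[P PE].
exists (F \mPo [tuple P (enum_val i) | i < #|W|]) => x.
rewrite comp_mpoly_meval fE; apply: meval_eq => i.
by rewrite tnth_mktuple PE.
Qed.

(** Validity on a nonempty principal Zariski-open set. *)
Definition generic V (Pr : (V -> K) -> Prop) :=
  exists f, [/\ polyfun f, exists x, f x != 0 & forall x, f x != 0 -> Pr x].

Lemma generic_mono V (P Q : (V -> K) -> Prop) :
  (forall x, P x -> Q x) -> generic P -> generic Q.
Proof. by move=> PQ [f [pf nz fP]]; exists f; split=> // x /fP/PQ. Qed.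

Lemma generic_point V (P : (V -> K) -> Prop) : generic P -> exists x, P x.
Proof. by move=> [f [_ [x fx] fP]]; exists x; apply: fP. Qed.

Lemma generic_true V (P : (V -> K) -> Prop) : (forall x, P x) -> generic P.
Proof.
move=> HP; exists (fun=> 1); split=> //; first exact: polyfun_const.
by exists (fun=> 0); apply: oner_neq0.
Qed.

Lemma polyfun_prod_neq0 V (I : finType) (f : I -> (V -> K) -> K) :
  (forall i, polyfun (f i)) -> (forall i, exists x, f i x != 0) ->
  exists x, \prod_i f i x != 0.
Proof.
move=> /fin_all_exists[F fE] nz.
have [|v Fv] := @mpoly_nonzero_point _ _ (\prod_i F i).
  apply/prodf_neq0 => i _; have [x] := nz i; rewrite fE.
  by apply: contra_neq => ->; rewrite meval0.
exists (fun w => v (enum_rank w)).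
apply: contra_neq Fv => <-; rewrite rmorph_prod /=; apply: eq_bigr => i _.
by rewrite fE; apply: meval_eq => j; rewrite enum_valK.
Qed.

Lemma generic_forall V (I : finType) (P : I -> (V -> K) -> Prop) :
  (forall i, generic (P i)) -> generic (fun x => forall i, P i x).
Proof.
move=> /fin_all_exists[f fP]; exists (fun x => \prod_i f i x); split.
- by apply: polyfun_prod => i; case: (fP i).
- by apply: polyfun_prod_neq0 => i; case: (fP i).
- by move=> x /prodf_neq0 nz i; case: (fP i) => _ _; apply; apply: nz.
Qed.

Lemma generic_and V (P Q : (V -> K) -> Prop) :
  generic P -> generic Q -> generic (fun x => P x /\ Q x).
Proof.
move=> gP gQ; have /generic_forall : forall i : bool, generic (if i then P else Q) by case.
by apply: generic_mono => x H; split; [apply: (H true) | apply: (H false)].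
Qed.

Lemma generic_comp V W (P : (W -> K) -> Prop) (phi : (V -> K) -> W -> K) :
  (forall w, polyfun (fun x => phi x w)) -> (forall y, exists x, phi x =1 y) ->
  generic P -> generic (fun x => P (phi x)).
Proof.
move=> pphi surj [f [pf [y fy] fP]]; exists (fun x => f (phi x)); split.
- exact: polyfun_comp.
- have [x xy] := surj y; exists x; case: pf fy => F fE; rewrite !fE.
  have -> // : F.@[fun i => phi x (enum_val i)] = F.@[fun i => y (enum_val i)].
  by apply: meval_eq => i; apply: xy.
- by move=> x; apply: fP.
Qed.

Definition injective_at V U E (L : (V -> K) -> {ffun U -> K} -> E -> K) x :=
  forall z, (forall e, L x z e = 0) -> forall u, z u = 0.

Lemma generic_injective V U E (L : (V -> K) -> {ffun U -> K} -> E -> K) x0 :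
  (forall x e (a : K) (z z' : {ffun U -> K}),
     L x [ffun u => a * z u + z' u] e = a * L x z e + L x z' e) ->
  (forall z e, polyfun (fun x => L x z e)) ->
  injective_at L x0 -> generic (injective_at L).
Proof.
move=> linL polyL inj0.
pose dl u : {ffun U -> K} := [ffun w => (w == u)%:R].
have LE x z e : L x z e = \sum_u z u * L x (dl u) e.
  have L0 : L x [ffun=> 0] e = 0.
    have := linL x e 1 [ffun=> 0] [ffun=> 0]; rewrite mul1r.
    have -> : [ffun u => 1 * ([ffun=> 0] : {ffun U -> K}) u + ([ffun=> 0] : {ffun U -> K}) u]
       = [ffun=> 0] by apply/ffunP => u; rewrite !ffunE mulr0 addr0.
    by move/eqP; rewrite -subr_eq subrr eq_sym => /eqP.
  have {1}-> : z = [ffun w => \sum_u z u * dl u w].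
    apply/ffunP => w; rewrite ffunE (bigD1 w) //= ffunE eqxx mulr1.
    by rewrite big1 ?addr0 // => u uw; rewrite !ffunE eq_sym (negPf uw) mulr0.
  elim: (index_enum U) => [|u s IHs].
    by rewrite big_nil -[RHS]L0; congr (L x _ e); apply/ffunP => w; rewrite !ffunE big_nil.
  rewrite big_cons -IHs -linL; congr (L x _ e); apply/ffunP => w.
  by rewrite !ffunE big_cons !ffunE.
pose Q x := \matrix_(u < #|U|, e < #|E|) L x (dl (enum_val u)) (enum_val e).
have QP x : row_free (Q x) <-> injective_at L x.
  rewrite -kermx_eq0; split=> [/rowV0P ker z Lz|inj].
    have /rowP z0 : \row_u z (enum_val u) = 0 :> 'rV_#|U|.
      apply/ker/sub_kermxP/rowP => e; rewrite !mxE -[RHS](Lz (enum_val e)) LE.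
      rewrite [RHS](reindex (@enum_val _ (mem U))); last exact/onW_bij/enum_val_bij.
      by apply: eq_big => [u|u _]; rewrite ?enum_valP ?mxE.
    by move=> u; have := z0 (enum_rank u); rewrite !mxE enum_rankK.
  apply/rowV0P => v /sub_kermxP vQ.
  have z0 : forall u, [ffun u => v 0 (enum_rank u)] u = 0 :> K.
    apply: inj => e; rewrite LE.
    move/rowP: vQ => /(_ (enum_rank e)); rewrite !mxE => vQ0; rewrite -[RHS]vQ0.
    rewrite (reindex (@enum_val _ (mem U))); last exact/onW_bij/enum_val_bij.
    apply: eq_big => [u|u _] //.
    by rewrite !mxE ffunE enum_valK enum_rankK.
  by apply/rowP => u; have := z0 (enum_val u); rewrite !ffunE enum_valK mxE.
have full : row_full (Q x0)^T by rewrite /row_full mxrank_tr; apply/QP.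
pose sg := fullrankfun full.
exists (fun x => \det (rowsub sg (Q x)^T)); split.
- rewrite /determinant; apply: polyfun_sum => s; apply: polyfunM; first exact: polyfun_const.
  apply: polyfun_prod => i; have [F FE] := polyL (dl (enum_val (s i))) (enum_val (sg i)).
  by exists F => x; rewrite !mxE FE.
- by exists x0; rewrite -unitfE -unitmxE fullrowsub_unit.
- move=> x; rewrite -unitfE -unitmxE => uQ; apply/QP.
  rewrite -kermx_eq0; apply/rowV0P => v /sub_kermxP vQ.
  have : v *m (rowsub sg (Q x)^T)^T = 0.
    apply/rowP => i; move/rowP: vQ => /(_ (sg i)); rewrite !mxE => vQ0; rewrite -[RHS]vQ0.
    by apply: eq_bigr => u _; rewrite !mxE.
  by move/(congr1 (mulmx^~ (invmx (rowsub sg (Q x)^T)^T))); rewrite mulmxK ?unitmx_tr // mul0mx.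
Qed.

End Generic.

(** * Blocks of columns *)

Lemma row_base_dim (K : fieldType) m n k (N : 'M[K]_(m, n)) : \rank N = k ->
  exists2 P : 'M_(k, n), row_free P & (P :=: N)%MS.
Proof. by move=> <-; exists (row_base N); [apply: row_base_free | apply: eq_row_base]. Qed.

Section Selection.
Local Open Scope ring_scope.
Variables (J : finType) (n rho : nat) (O : J -> {set 'I_n}) (B : {set J}).

Definition spread_fam := forall S : {set J}, S != set0 -> S \subset B ->
  (minn n (#|S|.*2 + rho).+1 <= #|\bigcup_(j in S) O j|)%N.

Hypothesis spr : spread_fam.

Lemma spread_fam_card j : j \in B -> (rho <= n)%N -> (rho <= #|O j|)%N.
Proof using spr.
move=> jB rn; have j0 : [set j] != set0 by apply/set0Pn; exists j; rewrite inE.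
have := spr j0; rewrite sub1set jB big_set1 => /(_ isT).
by apply: leq_trans; rewrite leq_min rn cards1; lia.
Qed.

Hypotheses (cB : #|B| = ((n - rho)./2)%N) (B0 : (0 < #|B|)%N).

(* Every column of the block is used twice, and one of them a third time when n - rho
   is odd. *)
Lemma spread_fam_selection : exists2 f : 'I_(n - rho) -> J, (forall c, f c \in B) &
  forall C : {set 'I_(n - rho)}, C != set0 -> (#|C| + rho <= #|\bigcup_(c in C) O (f c)|)%N.
Proof.
have [j0 j0B] := set0Pn _ (eq_ind _ is_true B0 _ (card_gt0 B)).
pose f (c : 'I_(n - rho)) := nth j0 (enum B) (minn c./2 #|B|.-1).
have fB c : f c \in B.
  by rewrite -mem_enum mem_nth // -cardE gtn_min orbC prednK ?leqnn.
exists f => // C C0; pose S := f @: C.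
have S0 : S != set0.
  by have [c cC] := set0Pn _ C0; apply/set0Pn; exists (f c); apply: imset_f.
have SB : S \subset B by apply/subsetP => _ /imsetP[c _ ->].
have -> : \bigcup_(c in C) O (f c) = \bigcup_(j in S) O j.
  apply/setP => i; apply/bigcupP/bigcupP => [[c cC ic]|[_ /imsetP[c cC ->] ic]].
    by exists (f c); rewrite ?imset_f.
  by exists c.
apply: leq_trans (spr S0 SB); rewrite leq_min.
have Cn : (#|C| <= n - rho)%N by rewrite -[leqRHS]card_ord max_card.
have [c0 cC] := set0Pn _ C0; have c0n := ltn_ord c0.
rewrite -[n in (_ <= n)%N](@subnK rho) ?leq_add2r ?Cn; last lia.
rewrite -addSn leq_add2r //=.
(* At most one index, the last when [n - rho] is odd, lies outside [L]. Inside [L] an index is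
   recovered from its column and its parity, so [#|C| <= 2 #|S| + 1]. *)
pose L : {set 'I_(n - rho)} := [set c : 'I_(n - rho) | (c < #|B|.*2)%N].
have last1 : (#|C :\: L| <= 1)%N.
  apply/card_le1_eqP => c d; rewrite !inE -!leqNgt => /andP[hc _] /andP[hd _].
  by apply/val_inj; have := ltn_ord c; have := ltn_ord d; rewrite /=; lia.
suff even : (#|C :&: L| <= #|S|.*2)%N by rewrite -(cardsID L C) -addn1 leq_add.
have -> : #|S|.*2 = #|setX S [set: bool]| by rewrite cardsX cardsT card_bool muln2.
rewrite -(@card_in_imset _ _ (fun c => (f c, odd c))).
  by apply/subset_leq_card/subsetP => _ /imsetP[c /setIP[inC _] ->];
     rewrite in_setX in_setT andbT imset_f.
move=> c d; rewrite !inE => /andP[_ hc] /andP[_ hd] [fcd ocd].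
have : minn c./2 #|B|.-1 = minn d./2 #|B|.-1.
  apply/eqP; rewrite -(nth_uniq j0 _ _ (enum_uniq (mem B))) -?cardE; last 2 first.
  - by rewrite gtn_min orbC prednK ?leqnn.
  - by rewrite gtn_min orbC prednK ?leqnn.
  exact/eqP.
rewrite !(minn_idPl _); [|lia..] => h2; apply/val_inj.
by rewrite -[val c]odd_double_half -[val d]odd_double_half /= ocd h2.
Qed.

End Selection.

(** * General position and effective blocks *)

Section Blocks.
Local Open Scope ring_scope.
Variable K : numFieldType.

Definition mxv n m (x : 'I_n * 'I_m -> K) : 'M_(n, m) := \matrix_(i, j) x (i, j).

(** General position: every minor of order [rho] is nonzero. *)
Definition gpos n rho (M : 'M[K]_(n, rho)) := forall O : {set 'I_n}, (rho <= #|O|)%N ->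
  forall s : 'cV_rho, (forall i, i \in O -> (M *m s) i 0 = 0) -> s = 0.

(** Here [v] stands for the variation of a basis column, up to sign: this is what a block of columns
    sharing one basis vector has to say about it to first order. *)
Definition block_good n rho (J : finType) (O : J -> {set 'I_n}) (B : {set J})
    (M : 'M[K]_(n, rho)) :=
  forall v : 'cV_n, (forall j, j \in B ->
      exists s : 'cV_rho, forall i, i \in O j -> v i 0 = (M *m s) i 0) ->
  exists s, v = M *m s.

Lemma generic_gpos n rho : generic (fun x : 'I_n * 'I_rho -> K => gpos (mxv x)).
Proof.
apply: generic_forall => O.
have [leO|] := leqP rho #|O|; last first.
  by move=> lt; apply: generic_true.
pose L (x : 'I_n * 'I_rho -> K) (z : {ffun 'I_rho -> K}) (i : 'I_n) : K :=
  if i \in O then \sum_t x (i, t) * z t else 0.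
pose et (t : 'I_rho) : 'I_n := enum_val (widen_ord leO t).
pose x0 (u : 'I_n * 'I_rho) : K := (u.1 == et u.2)%:R.
apply: generic_mono (generic_injective (L := L) (x0 := x0) _ _ _).
- move=> x inj _ s Ms; apply/colP => t; rewrite mxE.
  have := inj [ffun t => s t 0] _ t; rewrite ffunE; apply=> i; rewrite /L.
  case: ifP => // /Ms; rewrite mxE => Ms0; rewrite -[RHS]Ms0; apply: eq_bigr => u _.
  by rewrite !mxE ffunE.
- move=> x i a z z'; rewrite /L; case: ifP => _; last by rewrite mulr0 addr0.
  rewrite mulr_sumr -big_split; apply: eq_bigr => t _.
  by rewrite ffunE mulrDr mulrCA.
- move=> z i; rewrite /L; case: (i \in O); last exact: polyfun_const.
  by apply: polyfun_sum => t; apply: polyfunM; [apply: polyfun_var | apply: polyfun_const].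
- move=> z Lz t; have := Lz (et t); rewrite /L enum_valP (bigD1 t) //= /x0 eqxx mul1r.
  rewrite big1 ?addr0 // => u ut; case: eqP => /=; last by rewrite mul0r.
  move/enum_val_inj/(congr1 val) => /= /val_inj tu.
  by rewrite tu eqxx in ut.
Qed.

Lemma gpos_top_unit n rho (M : 'M[K]_(n, rho)) (le : (rho <= n)%N) : gpos M ->
  rowsub (widen_ord le) M \in unitmx.
Proof.
move=> gM; rewrite -unitmx_tr -row_free_unit -kermx_eq0.
apply/rowV0P => u /sub_kermxP uM.
apply/trmx_inj; rewrite trmx0; apply: (gM (widen_ord le @: setT)) => [|_ /imsetP[t _ ->]].
  rewrite card_imset ?cardsT ?card_ord // => i j /(congr1 val) /= /val_inj //.
move/rowP: uM => /(_ t); rewrite !mxE => uM; rewrite -[RHS]uM.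
by apply: eq_bigr => i _; rewrite !mxE mulrC.
Qed.

End Blocks.

Section Blocks.
Local Open Scope ring_scope.
Variable K : numFieldType.

(** For fixed [R], discarding [R] removes at most [rho] rows from each union, so Hall's condition
    survives and matches the indices [c] bijectively with the complement of [R]. The incidence
    matrix of this matching is an example for [R]; a generic matrix then serves all [R] at once. *)
Lemma supported_matrix n rho (O : 'I_(n - rho) -> {set 'I_n}) : (rho <= n)%N ->
  (forall C : {set 'I_(n - rho)}, C != set0 ->
     (#|C| + rho <= #|\bigcup_(c in C) O c|)%N) ->
  exists2 a : 'M[K]_(n - rho, n), (forall c i, i \notin O c -> a c i = 0) &
    forall R : {set 'I_n}, #|R| = rho -> forall v : 'cV_n,
      a *m v = 0 -> (forall i, i \in R -> v i 0 = 0) -> v = 0.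
Proof.
move=> rn hall; set c0 := (n - rho)%N in O hall *.
pose L (R : {set 'I_n}) (x : 'I_c0 * 'I_n -> K) (z : {ffun 'I_n -> K}) (e : 'I_c0 + 'I_n) : K :=
  match e with
  | inl c => \sum_(i in O c) x (c, i) * z i
  | inr i => if i \in R then z i else 0
  end.
have /generic_point[x xP] : generic (fun x : 'I_c0 * 'I_n -> K =>
    forall R : {set 'I_n}, #|R| = rho -> injective_at (L R) x).
  apply: generic_forall => R; have [cR|] := eqVneq #|R| rho; last first.
    by move=> /eqP cR; apply: generic_true => x /cR.
  have [C|f f_inj fO] := @hall_marriage _ _ (fun c => O c :\: R).
    have [->|C0] := eqVneq C set0; first by rewrite cards0.
    rewrite -(leq_add2r rho) (leq_trans (hall C C0)) // -{1}cR.
    rewrite -[X in (X <= _)%N](cardsID R) addnC leq_add ?subset_leq_card ?subsetIr //.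
    apply/subsetP => i; rewrite inE => /andP[iR /bigcupP[c cC ic]].
    by apply/bigcupP; exists c => //; rewrite inE iR.
  pose x0 (u : 'I_c0 * 'I_n) : K := (u.2 == f u.1)%:R.
  apply: generic_mono (generic_injective (L := L R) (x0 := x0) _ _ _) => //.
  - move=> x [c|i] a z z' /=; last first.
      by case: ifP => _; rewrite ?ffunE // mulr0 addr0.
    rewrite mulr_sumr -big_split; apply: eq_bigr => i _ /=.
    by rewrite ffunE mulrDr mulrCA.
  - move=> z [c|i] /=; last by case: (i \in R); apply: polyfun_const.
    by apply: polyfun_sum => i; apply: polyfunM; [apply: polyfun_var | apply: polyfun_const].
  - move=> z Lz i; have [iR|iR] := boolP (i \in R).
      by have := Lz (inr i); rewrite /= iR.
    have : i \in f @: setT.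
      suff <- : ~: R = f @: setT by rewrite inE.
      apply/esym/eqP; rewrite eqEcard; apply/andP; split.
        by apply/subsetP => _ /imsetP[c _ ->]; have := fO c; rewrite !inE => /andP[].
      by rewrite card_imset // cardsT card_ord cardsCs setCK card_ord cR.
    case/imsetP => c _ ->; have := Lz (inl c); rewrite /= (bigD1 (f c)) /=; last first.
      by have := fO c; rewrite inE => /andP[].
    rewrite /x0 eqxx mul1r big1 ?addr0 // => j /andP[_ /negPf jf].
    by rewrite /= jf mul0r.
exists (\matrix_(c, i) if i \in O c then x (c, i) else 0).
  by move=> c i /negPf ic; rewrite mxE ic.
move=> R cR v av vR; apply/colP => i; rewrite mxE.
have := xP R cR [ffun i => v i 0] _ i; rewrite ffunE; apply=> -[c|j] /=.
  move/colP: av => /(_ c); rewrite !mxE => av; rewrite -[RHS]av big_mkcond.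
  by apply: eq_bigr => j _; rewrite !mxE ffunE; case: ifP; rewrite ?mul0r.
by case: ifP => // jR; rewrite ffunE vR.
Qed.

Lemma kernel_basis n rho (a : 'M[K]_(n - rho, n)) : (rho <= n)%N ->
  (forall R : {set 'I_n}, #|R| = rho -> forall v : 'cV_n,
      a *m v = 0 -> (forall i, i \in R -> v i 0 = 0) -> v = 0) ->
  exists M : 'M[K]_(n, rho), a *m M = 0 /\ forall s : 'cV_rho, M *m s = 0 -> s = 0.
Proof.
move=> rn aP; pose e : 'I_rho -> 'I_n := widen_ord rn.
pose Ee : 'M[K]_(n, rho) := \matrix_(i, t) (i == e t)%:R.
have free : row_free (row_mx a^T Ee).
  rewrite -kermx_eq0; apply/rowV0P => u /sub_kermxP.
  rewrite mul_mx_row => /eqP; rewrite row_mx_eq0 => /andP[/eqP ua /eqP uE].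
  apply/trmx_inj; rewrite trmx0; apply: (aP (e @: setT)).
  - by rewrite card_imset ?cardsT ?card_ord // => i j /(congr1 val) /= /val_inj.
  - by apply: trmx_inj; rewrite trmx_mul trmxK ua trmx0.
  - move=> _ /imsetP[t _ ->]; move/rowP: uE => /(_ t); rewrite !mxE => uE; rewrite -[RHS]uE.
    rewrite (bigD1 (e t)) //= mxE eqxx mulr1 big1 ?addr0 // => i /negPf it.
    by rewrite mxE it mulr0.
have rk : (n <= \rank a^T + rho)%N.
  move: free; rewrite /row_free -mxrank_tr tr_row_mx trmxK => /eqP {1}<-.
  by rewrite -addsmxE (leq_trans (mxrank_adds_leqif _ _)) // leq_add ?mxrank_tr // rank_leq_col.
have rka : \rank a^T = (n - rho)%N.
  by apply/eqP; rewrite eqn_leq rank_leq_col leq_subLR addnC.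
have [|P Pfree PE] := @row_base_dim _ _ _ rho (kermx a^T).
  by rewrite mxrank_ker rka subKn.
exists P^T; split.
  apply: trmx_inj; rewrite trmx_mul trmxK trmx0; apply/sub_kermxP.
  by rewrite PE.
move=> s Ps; apply: trmx_inj; rewrite trmx0; apply: (row_free_inj Pfree).
by apply: trmx_inj; rewrite trmx_mul trmxK Ps mul0mx trmx0.
Qed.

Lemma exists_subset (T : finType) (X : {set T}) k : (k <= #|X|)%N ->
  exists2 Y : {set T}, Y \subset X & #|Y| = k.
Proof.
move=> kX; have : (0 < #|[set A : {set T} | A \subset X & #|A| == k]|)%N.
  by rewrite cards_draws bin_gt0.
by case/card_gt0P => Y; rewrite inE => /andP[YX /eqP kY]; exists Y.
Qed.

(** The example is a basis [M] of the kernel of the matrix [a] of [supported_matrix]. Each row of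
    [a] sees [v] only where [v] agrees with some [M *m s], so [a] kills [v], and then [v = 0] if [v]
    vanishes on the top [rho] rows. The latter is arranged by subtracting an element of the column
    space. *)
Lemma generic_block_good n rho (J : finType) (O : J -> {set 'I_n}) (B : {set J}) :
  (rho <= n)%N -> spread_fam rho O B -> #|B| = ((n - rho)./2)%N -> (0 < #|B|)%N ->
  generic (fun x : 'I_n * 'I_rho -> K => block_good O B (mxv x)).
Proof.
move=> rn spr cB B0; pose R : {set 'I_n} := widen_ord rn @: setT.
have cR : #|R| = rho.
  by rewrite card_imset ?cardsT ?card_ord // => i j /(congr1 val) /= /val_inj.
(* The unknowns are [v] and one coefficient vector per column. The last two kinds of equations fix
   what would remain free: the coefficients outside [B], and [v] modulo the column space. *)
pose L (x : 'I_n * 'I_rho -> K) (z : {ffun 'I_n + J * 'I_rho -> K})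
    (e : (J * 'I_n) + (J * 'I_rho) + 'I_n) : K :=
  match e with
  | inl (inl (j, i)) => if (j \in B) && (i \in O j)
                        then z (inl i) - \sum_t x (i, t) * z (inr (j, t)) else 0
  | inl (inr (j, t)) => if j \in B then 0 else z (inr (j, t))
  | inr i => if i \in R then z (inl i) else 0
  end.
suff : generic (injective_at L).
  move/(generic_and (generic_gpos K n rho)); apply: generic_mono => x [gx Lx] v vB.
  set M := mxv x in gx *.
  have /fin_all_exists[s sP] j : exists s : 'cV_rho,
      j \in B -> forall i, i \in O j -> v i 0 = (M *m s) i 0.
    by case: (boolP (j \in B)) => [/vB[s sP]|_]; [exists s | exists 0].
  pose s0 := invmx (rowsub (widen_ord rn) M) *m rowsub (widen_ord rn) v.
  have top t : (M *m s0) (widen_ord rn t) 0 = v (widen_ord rn t) 0.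
    have : rowsub (widen_ord rn) (M *m s0) = rowsub (widen_ord rn) v.
      by rewrite -mul_rowsub_mx mulKVmx // gpos_top_unit.
    by move/colP/(_ t); rewrite !mxE.
  exists s0; apply/colP => i; apply/eqP; rewrite -subr_eq0; apply/eqP.
  pose z : {ffun 'I_n + J * 'I_rho -> K} := [ffun u => match u with
    | inl i => v i 0 - (M *m s0) i 0
    | inr (j, t) => if j \in B then s j t 0 - s0 t 0 else 0 end].
  have := Lx z _ (inl i); rewrite ffunE; apply=> -[[[j i']|[j t]]|i'] /=.
  - case: ifP => // /andP[jB ij]; rewrite ffunE (sP j jB i' ij) !mxE -!sumrB big1 // => t _.
    by rewrite !ffunE jB !mxE mulrBr subrr.
  - by rewrite ffunE; case: (j \in B).
  - case: ifP => // /imsetP[t _ ->]; by rewrite ffunE top subrr.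
have [f fB fO] := spread_fam_selection spr cB B0.
have [a aO aR] := supported_matrix rn fO.
have [M [aM Minj]] := kernel_basis rn aR.
apply: (generic_injective (x0 := fun u => M u.1 u.2)).
- move=> x [[[j i]|[j t]]|i] b z z' /=; last 2 first.
  + by case: ifP => _; rewrite ?ffunE // mulr0 addr0.
  + by case: ifP => _; rewrite ?ffunE // mulr0 addr0.
  case: ifP => _; last by rewrite mulr0 addr0.
  rewrite ffunE mulrBr addrACA -opprD; congr (_ - _).
  rewrite mulr_sumr -big_split; apply: eq_bigr => t _ /=.
  by rewrite ffunE mulrDr mulrCA.
- move=> z [[[j i]|[j t]]|i] /=; last 2 first.
  + by case: (j \in B); apply: polyfun_const.
  + by case: (i \in R); apply: polyfun_const.
  case: (_ && _); last exact: polyfun_const.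
  apply: polyfunD; first exact: polyfun_const.
  apply/polyfunN/polyfun_sum => t.
  by apply: polyfunM; [apply: polyfun_var | apply: polyfun_const].
move=> z Lz.
pose s j : 'cV_rho := \col_t z (inr (j, t)); pose v : 'cV_n := \col_i z (inl i).
set x0 := fun u => M u.1 u.2 in Lz.
have vE j i : j \in B -> i \in O j -> v i 0 = (M *m s j) i 0.
  move=> jB ij; have := Lz (inl (inl (j, i))); rewrite /= jB ij => /eqP.
  rewrite subr_eq0 !mxE => /eqP->; apply: eq_bigr => t _.
  by rewrite mxE.
have a0 (w : 'cV_n) c : (forall i, i \in O (f c) -> w i 0 = (M *m s (f c)) i 0) ->
    (a *m w) c 0 = 0.
  move=> wE; transitivity ((a *m (M *m s (f c))) c 0); last by rewrite mulmxA aM mul0mx mxE.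
  rewrite !mxE; apply: eq_bigr => i _.
  by have [/wE->|/(aO c)->] := boolP (i \in O (f c)); rewrite ?mul0r // !mxE.
have v0 : v = 0.
  apply: (aR R cR) => [|i iR].
    by apply/colP => c; rewrite [RHS]mxE a0 // => i; apply: vE.
  by have := Lz (inr i); rewrite /= iR mxE.
have s0 j : j \in B -> s j = 0.
  move=> jB; apply: Minj.
  have [R' R'O cR'] := exists_subset (spread_fam_card spr jB rn).
  apply: (aR R' cR') => [|i /(subsetP R'O) ij]; first by rewrite mulmxA aM mul0mx.
  by rewrite -vE // v0 mxE.
case=> [i|[j t]]; first by move/colP: v0 => /(_ i); rewrite !mxE.
have [jB|jB] := boolP (j \in B); first by move/colP: (s0 j jB) => /(_ t); rewrite !mxE.
by have := Lz (inl (inr (j, t))); rewrite /= (negPf jB).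
Qed.

End Blocks.

(** * Tangent vectors and normal forms *)

Section TangentSpace.
Local Open Scope ring_scope.

Lemma col_mulmx (R : pzSemiRingType) m n p (M : 'M[R]_(m, n)) (N : 'M_(n, p)) k :
  col k (M *m N) = M *m col k N.
Proof. by apply/colP => i; rewrite !mxE; apply: eq_bigr => j _; rewrite mxE. Qed.

(** * The kernel of the differential on the observed entries *)

Section Tangent.
Variable K : numFieldType.
Variables (n a b c : nat) (J : finType) (O : J -> {set 'I_n}).
Implicit Types (A dA : 'M[K]_(n, a)) (B dB : 'M[K]_(n, b)) (C dC : 'M[K]_(n, c)).

Definition unit_coef p q (asg : J -> option ('I_p + 'I_q)) j : 'cV[K]_(p + q) :=
  \col_i (asg j == Some (split i))%:R.

Lemma mul_unit_coef p q (asg : J -> option ('I_p + 'I_q)) j k (M : 'M[K]_(n, p + q)) :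
  asg j = Some (split k) -> M *m unit_coef asg j = col k M.
Proof.
move=> asgj; apply/colP => i; rewrite !mxE (bigD1 k) //= mxE asgj eqxx mulr1.
rewrite big1 ?addr0 // => l lk; rewrite mxE asgj.
case: eqP => [[/(can_inj splitK) kl]|]; last by rewrite mulr0.
by rewrite kl eqxx in lk.
Qed.

Lemma columns_in_span p q (X : 'M[K]_(n, p)) (Y : 'M[K]_(n, q)) :
  (forall k, exists s, col k X = Y *m s) -> exists S, X = Y *m S.
Proof.
move=> /fin_all_exists[s sP]; exists (\matrix_(i, k) s k i 0).
apply/matrixP => i k; have /colP/(_ i) := sP k; rewrite !mxE => ->.
by apply: eq_bigr => l _; rewrite mxE.
Qed.

(* The blocks of asg2 determine all columns of [A C], those of asg1 the columns of B, and one
   more column of view 1 determines each column of A modulo the span of A. *)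
Lemma tangent_kernel A B C dA dB dC (V1 V2 : {set J})
    (asg1 : J -> option ('I_a + 'I_b)) (asg2 : J -> option ('I_a + 'I_c))
    (d1 : J -> 'cV_(a + b)) (d2 : J -> 'cV_(a + c)) :
  (forall j, asg1 j -> j \in V1) -> (forall j, asg2 j -> j \in V2) ->
  (forall q, block_good O [set j | asg2 j == Some q] (row_mx A C)) ->
  (forall s, block_good O [set j | asg1 j == Some (inr s)] (row_mx A B)) ->
  (forall t, exists j, asg1 j = Some (inl t)) ->
  gpos (row_mx (row_mx A B) C) -> (forall j, (a + b + c <= #|O j|)%N) ->
  (forall j i, j \in V1 -> i \in O j ->
     (row_mx dA dB *m unit_coef asg1 j + row_mx A B *m d1 j) i 0 = 0) ->
  (forall j i, j \in V2 -> i \in O j ->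
     (row_mx dA dC *m unit_coef asg2 j + row_mx A C *m d2 j) i 0 = 0) ->
  [/\ exists X, dA = A *m X, exists X, dB = row_mx A B *m X & exists X, dC = row_mx A C *m X].
Proof.
move=> V1P V2P good2 good1 extra gM bigO eq1 eq2.
have agree (v w : 'cV[K]_n) i : (v + w) i 0 = 0 -> v i 0 = (- w) i 0.
  by rewrite mxE => /eqP; rewrite addr_eq0 => /eqP ->; rewrite mxE.
have [S2 S2E] : exists S, row_mx dA dC = row_mx A C *m S.
  apply: columns_in_span => k; apply: (good2 (split k)) => j; rewrite inE => /eqP asgj.
  exists (- d2 j) => i ij; rewrite mulmxN; apply: agree.
  by rewrite -(mul_unit_coef _ asgj); apply: eq2 ij; rewrite V2P ?asgj.
have dCE : dC = row_mx A C *m rsubmx S2.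
  by rewrite -[dC in LHS](row_mxKr dA dC) S2E -{1}[S2]hsubmxK mul_mx_row row_mxKr.
have dAE : dA = row_mx A C *m lsubmx S2.
  by rewrite -[dA in LHS](row_mxKl dA dC) S2E -{1}[S2]hsubmxK mul_mx_row row_mxKl.
split; [| |by exists (rsubmx S2)].
- apply: columns_in_span => t; have [j asgj] := extra t.
  pose M := row_mx (row_mx A B) C.
  pose x := usubmx (col t (lsubmx S2)); pose z := dsubmx (col t (lsubmx S2)).
  have xzE : col t dA = A *m x + C *m z.
    by rewrite {1}dAE col_mulmx -mul_row_col vsubmxK.
  have asgj' : asg1 j = Some (split (lshift b t)).
    by rewrite (unsplitK (inl t)).
  (* On the observed rows of [j], the vector [A x + C z] cancels an element of the span of [[A B]].
     With at least [a + b + c] such rows, general position gives [z = 0]. *)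
  pose w : 'cV_(a + b + c) := col_mx (col_mx x 0 + d1 j) z.
  have /(gM (O j) (bigO j))/eqP : forall i, i \in O j -> (M *m w) i 0 = 0.
    move=> i ij; rewrite /M /w mul_row_col mulmxDr mul_row_col mulmx0 addr0 addrAC -xzE.
    have := eq1 j i _ ij; rewrite (mul_unit_coef _ asgj') colKl; apply.
    by rewrite V1P ?asgj.
  rewrite col_mx_eq0 => /andP[_ /eqP z0].
  by exists x; rewrite xzE z0 mulmx0 addr0.
- apply: columns_in_span => s; apply: (good1 s) => j; rewrite inE => /eqP asgj.
  exists (- d1 j) => i ij; rewrite mulmxN; apply: agree.
  have asgj' : asg1 j = Some (split (rshift a s)) by rewrite (unsplitK (inr s)).
  have := eq1 j i _ ij; rewrite (mul_unit_coef _ asgj') colKr; apply.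
  by rewrite V1P ?asgj.
Qed.

End Tangent.

(** * Normalizing the top rows of the bases *)

Section NormalForm.
Variable K : numFieldType.
Variable n : nat.

Lemma gpos_kernel rho (M : 'M[K]_(n, rho)) : (rho <= n)%N -> gpos M ->
  forall s : 'cV_rho, M *m s = 0 -> s = 0.
Proof.
move=> rn gM s Ms; apply: (gM setT); first by rewrite cardsT card_ord.
by move=> i _; rewrite Ms mxE.
Qed.

(** Meant for tangent vectors: a variation inside the span of [M] that leaves the normalized top
    rows fixed is zero. This is how freezing [a], [a + b] and [a + c] rows answers the three
    conclusions of [tangent_kernel]. *)
Lemma gpos_vanish p q (M : 'M[K]_(n, p)) (D : 'M[K]_(n, q)) X : (p <= n)%N -> gpos M ->
  D = M *m X -> (forall (i : 'I_n) k, (i < p)%N -> D i k = 0) -> D = 0.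
Proof.
move=> pn gM DE D0; suff X0 : X = 0 by rewrite DE X0 mulmx0.
apply/matrixP => t k; rewrite mxE.
have /colP/(_ t) : col k X = 0.
  apply: (gM (widen_ord pn @: setT)) => [|_ /imsetP[u _ ->]].
    by rewrite card_imset ?cardsT ?card_ord // => i j /(congr1 val) /= /val_inj.
  by rewrite -col_mulmx -DE mxE D0 //=.
by rewrite !mxE.
Qed.

Definition top p (q : nat) (M : 'M[K]_(n, q)) (pn : (p <= n)%N) : 'M_(p, q) :=
  rowsub (widen_ord pn) M.

Lemma mul_top p q s (M : 'M[K]_(n, q)) (N : 'M_(q, s)) (pn : (p <= n)%N) :
  top (M *m N) pn = top M pn *m N.
Proof. by rewrite /top mul_rowsub_mx. Qed.

Lemma top_row_mx p q s (X : 'M[K]_(n, q)) (Y : 'M_(n, s)) (pn : (p <= n)%N) :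
  top (row_mx X Y) pn = row_mx (top X pn) (top Y pn).
Proof. by apply/matrixP => i k; rewrite !mxE; case: (split k) => l; rewrite !mxE. Qed.

(* Column operations make the top rows of [A' B'] equal to [1 0; * 1]. *)
Lemma normal_form a b (A : 'M[K]_(n, a)) (B : 'M[K]_(n, b)) (an : (a <= n)%N)
    (abn : (a + b <= n)%N) :
  top A an \in unitmx -> top (row_mx A B) abn \in unitmx ->
  let A' := A *m invmx (top A an) in
  exists B' (h : 'M_(a + b)), [/\ row_mx A' B' = row_mx A B *m h,
    h \in unitmx, top A' an = 1%:M & top B' abn = col_mx 0 1%:M].
Proof.
move=> uA uAB; set g := invmx (top A an); cbv zeta.
pose hB : 'M[K]_(a + b, b) := invmx (top (row_mx A B) abn) *m col_mx 0 1%:M.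
pose h := row_mx (col_mx g 0) hB.
exists (row_mx A B *m hB), h.
have AE : row_mx (A *m g) (row_mx A B *m hB) = row_mx A B *m h.
  by rewrite mul_mx_row mul_row_col mulmx0 addr0.
have tA : top (A *m g) an = 1%:M by rewrite mul_top mulmxV.
have tB : top (row_mx A B *m hB) abn = col_mx 0 1%:M by rewrite mul_top mulKVmx.
split=> //.
suff : top (row_mx A B) abn *m h \in unitmx by rewrite unitmx_mul => /andP[].
rewrite -mul_top -AE unitmxE.
have -> : top (row_mx (A *m g) (row_mx A B *m hB)) abn =
    block_mx 1%:M 0 (dsubmx (top (A *m g) abn)) 1%:M.
  rewrite block_mxEh -tB -tA -[top (A *m g) an](_ : usubmx (top (A *m g) abn) = _).
    by rewrite vsubmxK top_row_mx.
  by apply/matrixP => i k; rewrite !mxE; apply: eq_bigr => l _; congr (A _ _ * _); apply/val_inj.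
by rewrite det_lblock !det1 mulr1 unitr1.
Qed.

Definition same_span p (M M' : 'M[K]_(n, p)) :=
  (exists X, M' = M *m X) /\ (exists Z, M = M' *m Z).

Lemma same_span_unit p (M : 'M[K]_(n, p)) h : h \in unitmx -> same_span M (M *m h).
Proof. by move=> uh; split; [exists h | exists (invmx h); rewrite mulmxK]. Qed.

Lemma gpos_same_span p (M M' : 'M[K]_(n, p)) : (p <= n)%N -> same_span M M' ->
  gpos M -> gpos M'.
Proof.
move=> pn [[X M'E] [Z ME]] gM R pR s sR.
have XZ : X *m Z = 1%:M.
  apply/matrixP => i k; have : (M *m (col k (X *m Z - 1%:M))) = 0.
    by rewrite -col_mulmx mulmxBr mulmxA -M'E -ME mulmx1 subrr; apply/colP => l; rewrite !mxE.
  move/(gpos_kernel pn gM)/colP/(_ i); rewrite !mxE => /eqP; rewrite subr_eq0 => /eqP.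
  by [].
have Xs : X *m s = 0 by apply: (gM R) => // i iR; rewrite mulmxA -M'E sR.
by rewrite -[s]mul1mx -(mulmx1C XZ) -mulmxA Xs mulmx0.
Qed.

Lemma block_good_same_span p (J : finType) (O : J -> {set 'I_n}) (B : {set J})
    (M M' : 'M[K]_(n, p)) : same_span M M' -> block_good O B M -> block_good O B M'.
Proof.
move=> [[X M'E] [Z ME]] gM v vB.
have [|s vE] := gM v; last by exists (Z *m s); rewrite mulmxA -ME.
by move=> j /vB[s sP]; exists (X *m s) => i /sP->; rewrite mulmxA -M'E.
Qed.

Lemma span_join a b c (A A' : 'M[K]_(n, a)) (B B' : 'M[K]_(n, b)) (C C' : 'M[K]_(n, c)) h h2 :
  row_mx A' B' = row_mx A B *m h -> row_mx A' C' = row_mx A C *m h2 ->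
  exists X, row_mx (row_mx A' B') C' = row_mx (row_mx A B) C *m X.
Proof.
move=> hE h2E; set M := row_mx (row_mx A B) C.
have ABE : row_mx A B = M *m col_mx 1%:M 0 by rewrite mul_row_col mulmx1 mulmx0 addr0.
have AE : A = row_mx A B *m col_mx 1%:M 0 by rewrite mul_row_col mulmx1 mulmx0 addr0.
have CE : C = M *m col_mx 0 1%:M by rewrite mul_row_col mulmx1 mulmx0 add0r.
have ACE : exists P, row_mx A C = M *m P.
  exists (row_mx (col_mx 1%:M 0 *m col_mx 1%:M 0) (col_mx 0 1%:M)).
  by rewrite mul_mx_row mulmxA -ABE -AE -CE.
have [P PE] := ACE.
exists (row_mx (col_mx 1%:M 0 *m h) (P *m rsubmx h2)).
rewrite mul_mx_row !mulmxA -ABE -PE -hE; congr (row_mx _ _).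
by rewrite -[C'](row_mxKr A' C') h2E -{1}[h2]hsubmxK mul_mx_row row_mxKr.
Qed.

Lemma same_span_join a b c (A A' : 'M[K]_(n, a)) (B B' : 'M[K]_(n, b)) (C C' : 'M[K]_(n, c)) h h2 :
  h \in unitmx -> h2 \in unitmx ->
  row_mx A' B' = row_mx A B *m h -> row_mx A' C' = row_mx A C *m h2 ->
  same_span (row_mx (row_mx A B) C) (row_mx (row_mx A' B') C').
Proof.
move=> uh uh2 hE h2E; split; first exact: span_join hE h2E.
by apply: (span_join (h := invmx h) (h2 := invmx h2)); rewrite ?hE ?h2E mulmxK.
Qed.

End NormalForm.

End TangentSpace.

(** * The two-view parametrization *)

Section TwoView.
Local Open Scope ring_scope.
Variables n m1 m2 a b c : nat.

(** The layout of [param_index] with [a = r'], [b = r_1'], [c = r_2'], so that the two types are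
    convertible. *)
Definition pidx : finType :=
  ('I_n * 'I_a + ('I_n * 'I_b + ('I_n * 'I_c + ('I_a * 'I_m1 + ('I_b * 'I_m1
   + ('I_c * 'I_m2 + 'I_a * 'I_m2))))))%type.

Section Model.
Variable R : pzRingType.
Implicit Type p : pidx -> R.

Definition pA p : 'M[R]_(n, a) := \matrix_(i, k) p (inl (i, k)).
Definition pB p : 'M[R]_(n, b) := \matrix_(i, k) p (inr (inl (i, k))).
Definition pC p : 'M[R]_(n, c) := \matrix_(i, k) p (inr (inr (inl (i, k)))).
Definition pT1 p : 'M[R]_(a + b, m1) :=
  col_mx (\matrix_(k, j) p (inr (inr (inr (inl (k, j))))))
         (\matrix_(k, j) p (inr (inr (inr (inr (inl (k, j))))))).
Definition pT2 p : 'M[R]_(a + c, m2) :=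
  col_mx (\matrix_(k, j) p (inr (inr (inr (inr (inr (inr (k, j))))))))
         (\matrix_(k, j) p (inr (inr (inr (inr (inr (inl (k, j)))))))).

(** Over an arbitrary ring: with [p] listing variables, the entries are the polynomials to which the
    finiteness criterion applies. *)
Definition genm p : 'M[R]_(n, m1 + m2) :=
  row_mx (row_mx (pA p) (pB p) *m pT1 p) (row_mx (pA p) (pC p) *m pT2 p).

Definition mkp (A : 'M[R]_(n, a)) (B : 'M[R]_(n, b)) (C : 'M[R]_(n, c))
    (T1 : 'M[R]_(a + b, m1)) (T2 : 'M[R]_(a + c, m2)) (w : pidx) : R :=
  match w with
  | inl (i, k) => A i k
  | inr (inl (i, k)) => B i k
  | inr (inr (inl (i, k))) => C i k
  | inr (inr (inr (inl (k, j)))) => T1 (lshift b k) j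
  | inr (inr (inr (inr (inl (k, j))))) => T1 (rshift a k) j
  | inr (inr (inr (inr (inr (inl (k, j)))))) => T2 (rshift a k) j
  | inr (inr (inr (inr (inr (inr (k, j)))))) => T2 (lshift c k) j
  end.

Lemma mkpK A B C T1 T2 : let p := mkp A B C T1 T2 in
  [/\ pA p = A, pB p = B, pC p = C, pT1 p = T1 & pT2 p = T2].
Proof.
split; try by apply/matrixP => i k; rewrite mxE.
  by rewrite -[T1 in RHS]vsubmxK; congr col_mx; apply/matrixP => i k; rewrite !mxE.
by rewrite -[T2 in RHS]vsubmxK; congr col_mx; apply/matrixP => i k; rewrite !mxE.
Qed.

Lemma genm_mkp A B C T1 T2 :
  genm (mkp A B C T1 T2) = row_mx (row_mx A B *m T1) (row_mx A C *m T2).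
Proof. by rewrite /genm; have [-> -> -> -> ->] := mkpK A B C T1 T2. Qed.

End Model.

Lemma map_pA (R S : pzRingType) (f : R -> S) p : map_mx f (pA p) = pA (f \o p).
Proof. by apply/matrixP => i k; rewrite !mxE. Qed.
Lemma map_pB (R S : pzRingType) (f : R -> S) p : map_mx f (pB p) = pB (f \o p).
Proof. by apply/matrixP => i k; rewrite !mxE. Qed.
Lemma map_pC (R S : pzRingType) (f : R -> S) p : map_mx f (pC p) = pC (f \o p).
Proof. by apply/matrixP => i k; rewrite !mxE. Qed.
Lemma map_pT1 (R S : pzRingType) (f : R -> S) p : map_mx f (pT1 p) = pT1 (f \o p).
Proof. by rewrite map_col_mx; congr col_mx; apply/matrixP => i k; rewrite !mxE. Qed.
Lemma map_pT2 (R S : pzRingType) (f : R -> S) p : map_mx f (pT2 p) = pT2 (f \o p).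
Proof. by rewrite map_col_mx; congr col_mx; apply/matrixP => i k; rewrite !mxE. Qed.

Lemma map_genm (R S : pzRingType) (f : {rmorphism R -> S}) p :
  map_mx f (genm p) = genm (f \o p).
Proof. by rewrite map_row_mx !map_mxM !map_row_mx map_pA map_pB map_pC map_pT1 map_pT2. Qed.

Lemma map_mx_derivation (R S : pzRingType) (ev : {rmorphism R -> S}) (D : {additive R -> S}) :
  (forall x y, D (x * y) = D x * ev y + ev x * D y) ->
  forall m q s (M : 'M[R]_(m, q)) (N : 'M_(q, s)),
  map_mx D (M *m N) = map_mx D M *m map_mx ev N + map_mx ev M *m map_mx D N.
Proof.
move=> DM m q s M N; apply/matrixP => i k; rewrite !mxE raddf_sum -big_split.
by apply: eq_bigr => j _; rewrite !mxE DM.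
Qed.

(** The product rule for a derivation along [ev]; it is used with evaluation at a point and the
    directional derivative there. *)
Lemma derive_genm (R S : pzRingType) (ev : {rmorphism R -> S}) (D : {additive R -> S}) p :
  (forall x y, D (x * y) = D x * ev y + ev x * D y) ->
  let q := ev \o p in let u := D \o p in
  map_mx D (genm p) =
    row_mx (row_mx (pA u) (pB u) *m pT1 q + row_mx (pA q) (pB q) *m pT1 u)
           (row_mx (pA u) (pC u) *m pT2 q + row_mx (pA q) (pC q) *m pT2 u).
Proof.
move=> DM q u; rewrite map_row_mx !(map_mx_derivation DM) !map_row_mx.
by rewrite !map_pA !map_pB !map_pC !map_pT1 !map_pT2.
Qed.

End TwoView.

(** * Directional derivatives at a point *)

Section Direction.
Local Open Scope ring_scope.
Variables (K : numFieldType) (D : nat) (q0 u : 'I_D -> K).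

Definition dir_deriv (f : {mpoly K[D]}) : K := \sum_j u j * (f^`M(j)).@[q0].

Lemma dir_deriv_is_additive : zmod_morphism dir_deriv.
Proof.
move=> f g; rewrite /dir_deriv -sumrB; apply: eq_bigr => j _.
by rewrite mderivB mevalB mulrBr.
Qed.
HB.instance Definition _ := GRing.isZmodMorphism.Build {mpoly K[D]} K dir_deriv dir_deriv_is_additive.

Lemma dir_derivM f g :
  dir_deriv (f * g) = dir_deriv f * g.@[q0] + f.@[q0] * dir_deriv g.
Proof.
rewrite /dir_deriv mulr_suml mulr_sumr -big_split; apply: eq_bigr => j _ /=.
by rewrite mderivM mevalD !mevalM mulrDr mulrA mulrCA.
Qed.

Lemma dir_derivC k : dir_deriv k%:MP = 0.
Proof. by rewrite /dir_deriv big1 // => j _; rewrite mderivC meval0 mulr0. Qed.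

Lemma dir_derivX i : dir_deriv 'X_i = u i.
Proof.
rewrite /dir_deriv (bigD1 i) //= big1 => [|j ji]; last first.
  by rewrite mderivX mnm1E eq_sym (negPf ji) scale0r meval0 mulr0.
have -> : ('X_i)^`M(i) = 1 :> {mpoly K[D]}.
  have UU0 : (U_(i) - U_(i) = 0)%MM by apply/mnmP => l; rewrite mnmBE subnn mnm0E.
  by rewrite mderivX mnm1E eqxx scale1r UU0 mpolyX0.
by rewrite meval1 mulr1 addr0.
Qed.

End Direction.

(** * The normal form as a coordinate chart *)

Section Chart.
Local Open Scope ring_scope.
Variables (K : numFieldType) (n m1 m2 a b c : nat).
Local Notation V := (pidx n m1 m2 a b c).
Implicit Type p : V -> K.

Definition pAB (R : pzRingType) (p : V -> R) := row_mx (pA p) (pB p).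
Definition pAC (R : pzRingType) (p : V -> R) := row_mx (pA p) (pC p).
Definition pABC (R : pzRingType) (p : V -> R) := row_mx (pAB p) (pC p).

Lemma generic_factor q (f : (V -> K) -> 'M[K]_(n, q)) (P : 'M[K]_(n, q) -> Prop) :
  (forall i k, exists w, forall p, f p i k = p w) -> (forall M, exists p, f p = M) ->
  generic (fun x : 'I_n * 'I_q -> K => P (mxv x)) -> generic (fun p => P (f p)).
Proof.
move=> fw surj gP; pose phi (p : V -> K) (u : 'I_n * 'I_q) := f p u.1 u.2.
apply: generic_mono (generic_comp (phi := phi) _ _ gP).
- by move=> p; congr P; apply/matrixP => i k; rewrite mxE.
- move=> [i k]; have [w fE] := fw i k; have [F FE] := polyfun_var K w.
  by exists F => p; rewrite -FE -fE.
- move=> y; have [p pE] := surj (mxv y); exists p => -[i k].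
  by rewrite /phi pE mxE.
Qed.

Lemma generic_pA (P : 'M[K]_(n, a) -> Prop) :
  generic (fun x => P (mxv x)) -> generic (fun p => P (pA p)).
Proof.
apply: generic_factor => [i k|M]; first by exists (inl (i, k)) => p; rewrite mxE.
by exists (mkp M 0 0 0 0);
  have [] := mkpK M (0 : 'M_(n, b)) (0 : 'M_(n, c)) (0 : 'M_(_, m1)) (0 : 'M_(_, m2)).
Qed.

Lemma generic_pAB (P : 'M[K]_(n, a + b) -> Prop) :
  generic (fun x => P (mxv x)) -> generic (fun p => P (pAB p)).
Proof.
apply: generic_factor => [i k|M].
  rewrite -[k]splitK; case: (split k) => k' /=.
    by exists (inl (i, k')) => p; rewrite row_mxEl mxE.
  by exists (inr (inl (i, k'))) => p; rewrite row_mxEr mxE.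
exists (mkp (lsubmx M) (rsubmx M) 0 0 0); rewrite /pAB.
have [-> -> _ _ _] := mkpK (lsubmx M) (rsubmx M) (0 : 'M_(n, c)) (0 : 'M_(_, m1)) (0 : 'M_(_, m2)).
exact: hsubmxK.
Qed.

Lemma generic_pAC (P : 'M[K]_(n, a + c) -> Prop) :
  generic (fun x => P (mxv x)) -> generic (fun p => P (pAC p)).
Proof.
apply: generic_factor => [i k|M].
  rewrite -[k]splitK; case: (split k) => k' /=.
    by exists (inl (i, k')) => p; rewrite row_mxEl mxE.
  by exists (inr (inr (inl (i, k')))) => p; rewrite row_mxEr mxE.
exists (mkp (lsubmx M) 0 (rsubmx M) 0 0); rewrite /pAC.
have [-> _ -> _ _] := mkpK (lsubmx M) (0 : 'M_(n, b)) (rsubmx M) (0 : 'M_(_, m1)) (0 : 'M_(_, m2)).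
exact: hsubmxK.
Qed.

Lemma generic_pABC (P : 'M[K]_(n, a + b + c) -> Prop) :
  generic (fun x => P (mxv x)) -> generic (fun p => P (pABC p)).
Proof.
apply: generic_factor => [i k|M].
  rewrite -[k]splitK; case: (split k) => k' /=; last first.
    by exists (inr (inr (inl (i, k')))) => p; rewrite row_mxEr mxE.
  rewrite -[k']splitK; case: (split k') => k'' /=.
    by exists (inl (i, k'')) => p; rewrite !row_mxEl mxE.
  by exists (inr (inl (i, k''))) => p; rewrite row_mxEl row_mxEr mxE.
exists (mkp (lsubmx (lsubmx M)) (rsubmx (lsubmx M)) (rsubmx M) 0 0); rewrite /pABC /pAB.
have [-> -> -> _ _] := mkpK (lsubmx (lsubmx M)) (rsubmx (lsubmx M)) (rsubmx M)
  (0 : 'M_(_, m1)) (0 : 'M_(_, m2)).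
by rewrite !hsubmxK.
Qed.

Lemma generic_gpos_pA : generic (fun p => gpos (pA p)).
Proof. exact: (@generic_pA (@gpos K n a) (generic_gpos K n a)). Qed.

Lemma generic_gpos_pAB : generic (fun p => gpos (pAB p)).
Proof. exact: (@generic_pAB (@gpos K n (a + b)) (generic_gpos K n (a + b))). Qed.

Lemma generic_gpos_pAC : generic (fun p => gpos (pAC p)).
Proof. exact: (@generic_pAC (@gpos K n (a + c)) (generic_gpos K n (a + c))). Qed.

Lemma generic_gpos_pABC : generic (fun p => gpos (pABC p)).
Proof. exact: (@generic_pABC (@gpos K n (a + b + c)) (generic_gpos K n (a + b + c))). Qed.

(* The frozen coordinates are the entries of A, B and C prescribed by [normal_form]. *)
Definition is_free (w : V) : bool :=
  match w with
  | inl (i, _) => (a <= i)%N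
  | inr (inl (i, _)) => (a + b <= i)%N
  | inr (inr (inl (i, _))) => (a + c <= i)%N
  | _ => true
  end.

Definition frozen_value (w : V) : K :=
  match w with
  | inl (i, k) => (i == k :> nat)%:R
  | inr (inl (i, k)) => (i == a + k :> nat)%N%:R
  | inr (inr (inl (i, k))) => (i == a + k :> nat)%N%:R
  | _ => 0
  end.

Definition in_chart p := forall w, ~~ is_free w -> p w = frozen_value w.

Lemma frozen_normal_form p (an : (a <= n)%N) (abn : (a + b <= n)%N) (acn : (a + c <= n)%N) :
  top (pA p) an = 1%:M -> top (pB p) abn = col_mx 0 1%:M -> top (pC p) acn = col_mx 0 1%:M ->
  in_chart p.
Proof.
move=> /matrixP tA /matrixP tB /matrixP tC.
have colE q (i : 'I_(a + q)) k :
    (col_mx 0 1%:M : 'M[K]_(a + q, q)) i k = (i == a + k :> nat)%N%:R.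
  rewrite -[i]splitK; case: (split i) => i' /=.
    by rewrite col_mxEu mxE ltn_eqF // (leq_trans (ltn_ord _)) // leq_addr.
  by rewrite col_mxEd mxE /= eqn_add2l.
case=> [[i k]|[[i k]|[[i k]|[[k j]|[[k j]|[[k j]|[k j]]]]]]] //=; rewrite -ltnNge => lt.
- have := tA (Ordinal lt) k; rewrite !mxE /= => <-; congr (p (inl (_, _))); exact: val_inj.
- have := tB (Ordinal lt) k; rewrite colE !mxE /= => <-; congr (p (inr (inl (_, _)))); exact: val_inj.
- have := tC (Ordinal lt) k; rewrite colE !mxE /= => <-;
  by congr (p (inr (inr (inl (_, _))))); exact: val_inj.
Qed.

(** The coefficient matrices absorb the inverse changes of basis, so the matrix stays the same. The
    spans are recorded because general position and the block conditions depend on them only. *)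
Lemma normalize p : (a + b + c <= n)%N ->
  gpos (pA p) -> gpos (pAB p) -> gpos (pAC p) ->
  exists p', [/\ in_chart p', genm p' = genm p, same_span (pA p) (pA p'),
    same_span (pAB p) (pAB p') & same_span (pAC p) (pAC p') /\ same_span (pABC p) (pABC p')].
Proof.
move=> rn gA gAB gAC.
have abn : (a + b <= n)%N by lia.
have acn : (a + c <= n)%N by lia.
have an : (a <= n)%N by lia.
have uA := gpos_top_unit an gA; have uAB := gpos_top_unit abn gAB.
have uAC := gpos_top_unit acn gAC.
have [B' [h [ABE uh tA tB]]] := normal_form uA uAB.
have [C' [h2 [ACE uh2 _ tC]]] := normal_form uA uAC.
set A' := pA p *m _ in ABE ACE tA.
exists (mkp A' B' C' (invmx h *m pT1 p) (invmx h2 *m pT2 p)); rewrite /pABC /pAB /pAC.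
have [pAE pBE pCE _ _] := mkpK A' B' C' (invmx h *m pT1 p) (invmx h2 *m pT2 p).
rewrite pAE pBE pCE; split.
- by apply: frozen_normal_form; rewrite ?pAE ?pBE ?pCE; eassumption.
- by rewrite genm_mkp ABE ACE /genm -!mulmxA !mulKVmx.
- by apply: same_span_unit; rewrite unitmx_inv.
- by rewrite ABE; apply: same_span_unit.
- by split; [rewrite ACE; apply: same_span_unit | apply: same_span_join uh uh2 ABE ACE].
Qed.

End Chart.

(** * Finite fibres for a fixed pattern *)

Section Deterministic.
Local Open Scope ring_scope.
Variables (K : numFieldType) (n m1 m2 a b c : nat).
Local Notation V := (pidx n m1 m2 a b c).
Variables (Om : 'I_(m1 + m2) -> {set 'I_n}).
Variables (asg1 : 'I_(m1 + m2) -> option ('I_a + 'I_b)).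
Variables (asg2 : 'I_(m1 + m2) -> option ('I_a + 'I_c)).
Hypotheses (rn : (a + b + c <= n)%N) (bigO : forall j, (a + b + c <= #|Om j|)%N).
Let V1 : {set 'I_(m1 + m2)} := [set lshift m2 j | j in 'I_m1].
Let V2 : {set 'I_(m1 + m2)} := [set rshift m1 j | j in 'I_m2].
Hypotheses (asg1V : forall j, asg1 j -> j \in V1) (asg2V : forall j, asg2 j -> j \in V2).
Hypothesis extra : forall t, exists j, asg1 j = Some (inl t).

Let C1 s := [set j | asg1 j == Some (inr s)].
Let C2 q := [set j | asg2 j == Some q].

Lemma eq_genm (R : pzRingType) (p q : V -> R) : p =1 q -> genm p = genm q.
Proof.
move=> pq; have eA : pA p = pA q by apply/matrixP => i k; rewrite !mxE.
have eB : pB p = pB q by apply/matrixP => i k; rewrite !mxE.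
have eC : pC p = pC q by apply/matrixP => i k; rewrite !mxE.
have e1 : pT1 p = pT1 q by congr col_mx; apply/matrixP => i k; rewrite !mxE.
have e2 : pT2 p = pT2 q by congr col_mx; apply/matrixP => i k; rewrite !mxE.
by rewrite /genm eA eB eC e1 e2.
Qed.

Let Fr : finType := {w : V | is_free w}.
Let D := #|Fr|.

Definition extend (R : Type) (f : Fr -> R) (g : V -> R) (w : V) : R :=
  if insub w is Some v then f v else g w.

Let cvar : V -> {mpoly K[D]} := extend (fun v => 'X_(enum_rank v)) (fun w => (frozen_value K w)%:MP).
Let ctup := [tuple cvar (enum_val i) | i < #|V|].
Let X (e : 'I_n * 'I_(m1 + m2)) : {mpoly K[#|V|]} :=
  genm (fun w : V => 'X_(enum_rank w)) e.1 e.2.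

Lemma X_eval e v : (X e).@[v] = genm (fun w : V => v (enum_rank w)) e.1 e.2.
Proof.
transitivity (map_mx (meval v) (genm (fun w : V => 'X_(enum_rank w) : {mpoly K[#|V|]})) e.1 e.2).
  by rewrite mxE.
by rewrite map_genm; congr (fun_of_matrix _ e.1 e.2); apply: eq_genm => w /=; rewrite mevalXU.
Qed.

Lemma X_comp e : X e \mPo ctup = genm cvar e.1 e.2.
Proof.
transitivity (map_mx (comp_mpoly ctup) (genm (fun w : V => 'X_(enum_rank w) : {mpoly K[#|V|]})) e.1 e.2).
  by rewrite mxE.
rewrite map_genm; congr (fun_of_matrix _ e.1 e.2); apply: eq_genm => w /=.
by rewrite comp_mpolyXU -tnth_nth tnth_mktuple enum_rankK.
Qed.

Definition restrict (R : Type) (p : V -> R) (j : 'I_D) : R := p (val (enum_val j : Fr)).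

Lemma cvar_eval (p : V -> K) w : in_chart p -> (cvar w).@[restrict p] = p w.
Proof.
move=> chp; rewrite /cvar /extend; case: insubP => [v _ vw|/chp->]; last by rewrite mevalC.
by rewrite mevalXU /restrict enum_rankK vw.
Qed.

Lemma X_comp_eval (p : V -> K) e : in_chart p -> (X e \mPo ctup).@[restrict p] = genm p e.1 e.2.
Proof.
move=> chp; rewrite X_comp.
transitivity (map_mx (meval (restrict p)) (genm cvar) e.1 e.2); first by rewrite [RHS]mxE.
rewrite map_genm; congr (fun_of_matrix _ e.1 e.2); apply: eq_genm => w /=.
exact: cvar_eval.
Qed.

(* The differential of the chart, restricted to the observed entries, is injective. *)
Lemma chart_injective (p : V -> K) : in_chart p ->
  gpos (pA p) -> gpos (pAB p) -> gpos (pAC p) -> gpos (pABC p) ->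
  (forall q, block_good Om (C2 q) (pAC p)) -> (forall s, block_good Om (C1 s) (pAB p)) ->
  (forall j1, col j1 (pT1 p) = unit_coef K asg1 (lshift m2 j1)) ->
  (forall j2, col j2 (pT2 p) = unit_coef K asg2 (rshift m1 j2)) ->
  forall u : 'I_D -> K,
  (forall e, e.1 \in Om e.2 -> \sum_j u j * ((X e \mPo ctup)^`M(j)).@[restrict p] = 0) ->
  forall j, u j = 0.
Proof.
move=> chp gA gAB gAC gABC good2 good1 T1E T2E u Xu.
pose du : V -> K := extend (fun v => u (enum_rank v)) (fun=> 0).
have duE w : dir_deriv (restrict p) u (cvar w) = du w.
  rewrite /cvar /du /extend; case: insub => [v|]; last exact: dir_derivC.
  exact: dir_derivX.
have gE (q : V -> K) (r : V -> {mpoly K[D]}) : (forall w, (r w).@[restrict p] = q w) ->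
    [/\ pA (meval (restrict p) \o r) = pA q, pB (meval (restrict p) \o r) = pB q,
     pC (meval (restrict p) \o r) = pC q, pT1 (meval (restrict p) \o r) = pT1 q &
     pT2 (meval (restrict p) \o r) = pT2 q].
  move=> rq; split; try (by apply/matrixP => i k; rewrite !mxE /= rq).
  - by congr col_mx; apply/matrixP => i k; rewrite !mxE /= rq.
  - by congr col_mx; apply/matrixP => i k; rewrite !mxE /= rq.
have [eA eB eC e1 e2] := gE p cvar (fun w => cvar_eval w chp).
have {gE} [dA dB dC d1 d2] : [/\ pA (dir_deriv (restrict p) u \o cvar) = pA du,
     pB (dir_deriv (restrict p) u \o cvar) = pB du,
     pC (dir_deriv (restrict p) u \o cvar) = pC du,
     pT1 (dir_deriv (restrict p) u \o cvar) = pT1 du &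
     pT2 (dir_deriv (restrict p) u \o cvar) = pT2 du].
  split; try (by apply/matrixP => i k; rewrite !mxE /= duE).
  - by congr col_mx; apply/matrixP => i k; rewrite !mxE /= duE.
  - by congr col_mx; apply/matrixP => i k; rewrite !mxE /= duE.
have dE : map_mx (dir_deriv (restrict p) u) (genm cvar) =
    row_mx (row_mx (pA du) (pB du) *m pT1 p + pAB p *m pT1 du)
           (row_mx (pA du) (pC du) *m pT2 p + pAC p *m pT2 du).
  rewrite (derive_genm (ev := meval (restrict p))); last exact: dir_derivM.
  by rewrite dA dB dC d1 d2 eA eB eC e1 e2.
have zero i j : i \in Om j -> map_mx (dir_deriv (restrict p) u) (genm cvar) i j = 0.
  move=> ij; rewrite [LHS]mxE -[RHS](Xu (i, j) ij); congr (dir_deriv _ _ _).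
  by rewrite X_comp.
pose e1' (j : 'I_(m1 + m2)) : 'cV[K]_(a + b) := if split j is inl j1 then col j1 (pT1 du) else 0.
pose e2' (j : 'I_(m1 + m2)) : 'cV[K]_(a + c) := if split j is inr j2 then col j2 (pT2 du) else 0.
have abn : (a + b <= n)%N by lia.
have acn : (a + c <= n)%N by lia.
have an : (a <= n)%N by lia.
have eq1 j1 i : i \in Om (lshift m2 j1) ->
    (row_mx (pA du) (pB du) *m unit_coef K asg1 (lshift m2 j1) + pAB p *m col j1 (pT1 du)) i 0 = 0.
  by move/zero; rewrite dE row_mxEl -T1E -!col_mulmx => zz; rewrite -[RHS]zz !mxE.
have eq2 j2 i : i \in Om (rshift m1 j2) ->
    (row_mx (pA du) (pC du) *m unit_coef K asg2 (rshift m1 j2) + pAC p *m col j2 (pT2 du)) i 0 = 0.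
  by move/zero; rewrite dE row_mxEr -T2E -!col_mulmx => zz; rewrite -[RHS]zz !mxE.
have [j i|j i|[XA AE] [XB BE] [XC CE]] := @tangent_kernel K n a b c _ Om (pA p) (pB p) (pC p)
    (pA du) (pB du) (pC du) V1 V2 asg1 asg2 e1' e2' asg1V asg2V good2 good1 extra gABC bigO.
- by case/imsetP => j1 _ -> ij; rewrite /e1' (unsplitK (inl j1)); apply: eq1.
- by case/imsetP => j2 _ -> ij; rewrite /e2' (unsplitK (inr j2)); apply: eq2.
have du0 w : ~~ is_free w -> du w = 0.
  by move=> /negbTE w0; rewrite /du /extend insubF.
have A0 : pA du = 0.
  by apply: gpos_vanish an gA AE _ => i k lt; rewrite mxE du0 //= -ltnNge.
have B0 : pB du = 0.
  by apply: gpos_vanish abn gAB BE _ => i k lt; rewrite mxE du0 //= -ltnNge.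
have C0 : pC du = 0.
  by apply: gpos_vanish acn gAC CE _ => i k lt; rewrite mxE du0 //= -ltnNge.
have T10 : pT1 du = 0.
  apply/matrixP => k j1; rewrite [RHS]mxE.
  have /colP/(_ k) : col j1 (pT1 du) = 0; last by rewrite [LHS]mxE [RHS]mxE.
  apply: (gAB (Om (lshift m2 j1))) => [|i ij]; first by apply: leq_trans (bigO _); lia.
  by have := eq1 j1 i ij; rewrite A0 B0 row_mx0 mul0mx add0r.
have T20 : pT2 du = 0.
  apply/matrixP => k j2; rewrite [RHS]mxE.
  have /colP/(_ k) : col j2 (pT2 du) = 0; last by rewrite [LHS]mxE [RHS]mxE.
  apply: (gAC (Om (rshift m1 j2))) => [|i ij]; first by apply: leq_trans (bigO _); lia.
  by have := eq2 j2 i ij; rewrite A0 C0 row_mx0 mul0mx add0r.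
have du_all w : du w = 0.
  case: w => [[i k]|[[i k]|[[i k]|[[k j]|[[k j]|[[k j]|[k j]]]]]]].
  - by move/matrixP: A0 => /(_ i k); rewrite !mxE.
  - by move/matrixP: B0 => /(_ i k); rewrite !mxE.
  - by move/matrixP: C0 => /(_ i k); rewrite !mxE.
  - by move/matrixP: T10 => /(_ (lshift b k) j); rewrite col_mxEu !mxE.
  - by move/matrixP: T10 => /(_ (rshift a k) j); rewrite col_mxEd !mxE.
  - by move/matrixP: T20 => /(_ (rshift a k) j); rewrite col_mxEd !mxE.
  - by move/matrixP: T20 => /(_ (lshift c k) j); rewrite col_mxEu !mxE.
move=> j; have := du_all (val (enum_val j : Fr)).
by rewrite /du /extend valK enum_valK.
Qed.

Hypotheses (spr1 : forall s, spread_fam (a + b) Om (C1 s))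
  (card1 : forall s, #|C1 s| = ((n - (a + b))./2)%N) (pos1 : forall s, (0 < #|C1 s|)%N)
  (spr2 : forall q, spread_fam (a + c) Om (C2 q))
  (card2 : forall q, #|C2 q| = ((n - (a + c))./2)%N) (pos2 : forall q, (0 < #|C2 q|)%N).

(** Genericity gives a point of the full parameter space, whereas the differential is studied on the
    affine slice [in_chart]. So the point is moved there by [normalize], which keeps the spans; its
    coefficients are then replaced by basis vectors, which is possible because no entry of [T1] or
    [T2] is frozen. *)
Lemma chart_point : exists p : V -> K, in_chart p /\
  (forall u : 'I_D -> K,
    (forall e, e.1 \in Om e.2 -> \sum_j u j * ((X e \mPo ctup)^`M(j)).@[restrict p] = 0) ->
    forall j, u j = 0).
Proof.
have abn : (a + b <= n)%N by lia.
have acn : (a + c <= n)%N by lia.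
have an : (a <= n)%N by lia.
have /generic_point[p0 [[g1 g2] [[g3 g4] [g5 g6]]]] : generic (fun p : V -> K =>
    (gpos (pA p) /\ gpos (pAB p)) /\ (gpos (pAC p) /\ gpos (pABC p)) /\
    ((forall s, block_good Om (C1 s) (pAB p)) /\ (forall q, block_good Om (C2 q) (pAC p)))).
  apply: generic_and; first by apply: generic_and; [apply: generic_gpos_pA | apply: generic_gpos_pAB].
  apply: generic_and; first by apply: generic_and; [apply: generic_gpos_pAC | apply: generic_gpos_pABC].
  apply: generic_and; apply: generic_forall => s.
    apply: (@generic_pAB K n m1 m2 a b c (@block_good K n (a + b) _ Om (C1 s))).
    by apply: generic_block_good; [| apply: spr1 | apply: card1 | apply: pos1].
  apply: (@generic_pAC K n m1 m2 a b c (@block_good K n (a + c) _ Om (C2 s))).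
  by apply: generic_block_good; [| apply: spr2 | apply: card2 | apply: pos2].
have [p1 [ch1 _ sA sAB [sAC sABC]]] := normalize rn g1 g2 g3.
pose t1 := \matrix_(k, j) unit_coef K asg1 (lshift m2 j) k 0.
pose t2 := \matrix_(k, j) unit_coef K asg2 (rshift m1 j) k 0.
pose p := mkp (pA p1) (pB p1) (pC p1) t1 t2.
have [pAE pBE pCE pT1E pT2E] := mkpK (pA p1) (pB p1) (pC p1) t1 t2.
have ABE : pAB p = pAB p1 by rewrite /pAB pAE pBE.
have ACE : pAC p = pAC p1 by rewrite /pAC pAE pCE.
have ABCE : pABC p = pABC p1 by rewrite /pABC ABE pCE.
have chp : in_chart p.
  move=> w nf; rewrite -ch1 //.
  by case: w nf => [[i k]|[[i k]|[[i k]|[[k j]|[[k j]|[[k j]|[k j]]]]]]] //= _; rewrite mxE.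
exists p; split=> //; apply: chart_injective; rewrite ?pAE ?ABE ?ACE ?ABCE //.
- exact: gpos_same_span sA g1.
- exact: gpos_same_span sAB g2.
- exact: gpos_same_span sAC g3.
- exact: gpos_same_span sABC g4.
- by move=> q; apply: block_good_same_span sAC (g6 q).
- by move=> s; apply: block_good_same_span sAB (g5 s).
- by move=> j1; rewrite pT1E; apply/colP => k; rewrite !mxE.
- by move=> j2; rewrite pT2E; apply/colP => k; rewrite !mxE.
Qed.

Lemma generic_finite_genm : generic (fun p : V -> K =>
  exists L : 'I_n * 'I_(m1 + m2) -> seq K, forall q : V -> K,
    (forall i j, i \in Om j -> genm q i j = genm p i j) ->
    forall e, genm q e.1 e.2 \in L e).
Proof.
have abn : (a + b <= n)%N by lia.
have acn : (a + c <= n)%N by lia.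
have [G [[GF GE] [xG G0] GP]] : generic (fun p : V -> K =>
    gpos (pA p) /\ gpos (pAB p) /\ gpos (pAC p)).
  apply: generic_and; first exact: generic_gpos_pA.
  by apply: generic_and; [apply: generic_gpos_pAB | apply: generic_gpos_pAC].
have [p0 [ch0 inj0]] := chart_point.
have gen_evalK (p : V -> K) e : (X e).@[fun i => p (enum_val i)] = genm p e.1 e.2.
  by rewrite X_eval; congr (fun_of_matrix _ e.1 e.2); apply: eq_genm => w /=; rewrite enum_rankK.
have [|v Gv|u Xu|H H0 HP] := @generic_finite_fibres K #|V| D _ X
    [set e : 'I_n * 'I_(m1 + m2) | e.1 \in Om e.2] ctup GF (restrict p0).
- by apply: contra_neq G0; rewrite GE => ->; rewrite meval0.
- pose p w := v (enum_rank w).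
  have [gA [gAB gAC]] : gpos (pA p) /\ gpos (pAB p) /\ gpos (pAC p).
    apply: GP; rewrite GE; apply: contra_neq Gv => <-.
    by apply: meval_eq => i; rewrite /p enum_valK.
  have [p' [chp' gE _ _ _]] := normalize rn gA gAB gAC.
  exists (restrict p') => e; rewrite X_comp_eval // gE X_eval.
  by congr (fun_of_matrix _ e.1 e.2); apply: eq_genm.
- by apply: inj0 => e eOm; apply: Xu; rewrite inE.
exists (fun p => H.@[fun i => p (enum_val i)]); split; first by exists H.
  have [x Hx] := mpoly_nonzero_point H0; exists (fun w => x (enum_rank w)).
  by apply: contra_neq Hx => <-; apply: meval_eq => i; rewrite enum_valK.
move=> p /HP[L LP]; exists L => q qp e.
rewrite -gen_evalK; apply: LP => -[i j]; rewrite inE => ij.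
by rewrite !gen_evalK qp.
Qed.

End Deterministic.

(** * Choice of blocks *)

Lemma card_divn_block m h q : (0 < h)%N -> (q.+1 * h <= m)%N ->
  #|[set j : 'I_m | (j %/ h)%N == q]| = h.
Proof.
move=> h0 qm.
have lt (t : 'I_h) : (q * h + t < m)%N.
  by apply: leq_trans qm; rewrite mulSn addnC ltn_add2r.
rewrite -[RHS]card_ord -(card_imset (f := fun t : 'I_h => Ordinal (lt t)) 'I_h).
  apply: eq_card => j; rewrite inE; apply/eqP/imsetP => [jq|[t _ ->]].
    exists (Ordinal (ltn_pmod j h0)) => //; apply/val_inj => /=.
    by rewrite -jq -divn_eq.
  by rewrite /= divnMDl // divn_small ?addn0.
by move=> s t [/addnI st]; apply: val_inj.
Qed.

Section Plan.
Variable K : numFieldType.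

Definition finite_fibre n m1 m2 a b c (Om : 'I_(m1 + m2) -> {set 'I_n})
    (p : pidx n m1 m2 a b c -> K) :=
  exists L : 'I_n * 'I_(m1 + m2) -> seq K, forall q : pidx n m1 m2 a b c -> K,
    (forall i j, i \in Om j -> genm q i j = genm p i j) ->
    forall e, genm q e.1 e.2 \in L e.

(** The blocks precede the pattern, so that their being spread is an event for the random pattern.
    Which view is determined by blocks alone is hidden from the later counting. *)
Definition sufficient_plan n m1 m2 a b c (I : finType) (rho : I -> nat)
    (B : I -> {set 'I_(m1 + m2)}) :=
  [/\ (#|I| <= a + b + c)%N, forall i, rho i = (a + b)%N \/ rho i = (a + c)%N,
    forall i, #|B i| = ((n - rho i)./2)%N &
    forall Om : {ffun 'I_(m1 + m2) -> {set 'I_n}},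
      (forall j, (a + b + c <= #|Om j|)%N) -> (forall i, spread (rho i) Om (B i)) ->
      generic (@finite_fibre n m1 m2 a b c Om)].

Lemma spread_spread_fam n m rho (Om : {ffun 'I_m -> {set 'I_n}}) (B : {set 'I_m}) :
  spread rho Om B -> spread_fam rho Om B.
Proof. by move=> /forallP spr S S0 SB; have := spr S; rewrite S0 SB. Qed.

Lemma plan_left n m1 m2 a b c : (0 < a + b)%N -> (0 < a + c)%N ->
  (6 * (a + b) <= n)%N -> (6 * (a + c) <= n)%N ->
  (b * (n - (a + b))./2 + a <= m1)%N -> ((a + c) * (n - (a + c))./2 <= m2)%N ->
  exists (I : finType) (rho : I -> nat) (B : I -> {set 'I_(m1 + m2)}),
    @sufficient_plan n m1 m2 a b c I rho B.
Proof.
move=> ab0 ac0 ab6 ac6 le1 le2.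
set h1 := (n - (a + b))./2 in le1; set h2 := (n - (a + c))./2 in le2.
have h1_gt0 : (0 < h1)%N by rewrite /h1; lia.
have h2_gt0 : (0 < h2)%N by rewrite /h2; lia.
(* View 1 starts with [b] consecutive blocks of [h1] columns, followed by [a] single columns;
   further columns are left unassigned by [insub] and get zero coefficients. *)
pose asg1 (j : 'I_(m1 + m2)) : option ('I_a + 'I_b) :=
  if split j is inl j1 then
    if (j1 < b * h1)%N then omap inr (insub (j1 %/ h1)%N : option 'I_b)
    else omap inl (insub (j1 - b * h1)%N : option 'I_a)
  else None.
pose asg2 (j : 'I_(m1 + m2)) : option ('I_a + 'I_c) :=
  if split j is inr j2 then omap (@split a c) (insub (j2 %/ h2)%N : option 'I_(a + c)) else None.
pose C1 s := [set j | asg1 j == Some (inr s)].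
pose C2 q := [set j | asg2 j == Some q].
have card1 s : #|C1 s| = h1.
  have sb : (s.+1 * h1 <= m1)%N.
    by apply: leq_trans le1; rewrite -[leqLHS]addn0 leq_add // leq_mul2r ltn_ord orbT.
  rewrite -[RHS](card_divn_block h1_gt0 sb) -(card_imset _ (@lshift_inj m1 m2)).
  apply: eq_card => j; rewrite inE; apply/eqP/imsetP.
    rewrite /asg1; case: splitP => // j1 jE; case: ifP => _; last by case: insubP.
    case: insubP => //= t _ tE [ts]; exists j1; first by rewrite inE -ts tE.
    exact: val_inj.
  case=> j1; rewrite inE => /eqP j1s ->; rewrite /asg1 (unsplitK (inl j1)).
  have lt : (j1 < b * h1)%N by rewrite -ltn_divLR // j1s.
  by rewrite lt j1s valK.
have card2 q : #|C2 q| = h2.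
  have sb : ((unsplit q).+1 * h2 <= m2)%N.
    by apply: leq_trans le2; rewrite leq_mul2r ltn_ord orbT.
  rewrite -[RHS](card_divn_block h2_gt0 sb) -(card_imset _ (@rshift_inj m1 m2)).
  apply: eq_card => j; rewrite inE; apply/eqP/imsetP.
    rewrite /asg2; case: splitP => // j2 jE.
    case: insubP => //= t _ tE [ts]; exists j2; first by rewrite inE -ts splitK tE.
    exact: val_inj.
  case=> j2; rewrite inE => /eqP j2s ->; rewrite /asg2 (unsplitK (inr j2)).
  by rewrite j2s valK /= unsplitK.
pose I : finType := ('I_b + ('I_a + 'I_c))%type.
exists I, (fun i => if i is inl _ then (a + b)%N else (a + c)%N),
  (fun i => match i with inl s => C1 s | inr q => C2 q end).
split.
- by rewrite !card_sum !card_ord addnCA addnA.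
- by case=> _; [left | right].
- by case=> i; [apply: card1 | apply: card2].
move=> Om bigO spr; apply: (@generic_finite_genm K n m1 m2 a b c Om asg1 asg2) => //.
- by lia.
- move=> j; rewrite /asg1; case: splitP => // j1 jE _; apply/imsetP; exists j1 => //.
  exact: val_inj.
- move=> j; rewrite /asg2; case: splitP => // j2 jE _; apply/imsetP; exists j2 => //.
  exact: val_inj.
- move=> t; have lt : (b * h1 + t < m1)%N.
    by apply: leq_trans le1; rewrite -addnS leq_add2l.
  exists (lshift m2 (Ordinal lt)); rewrite /asg1 (unsplitK (inl _)) /=.
  by rewrite ltnNge leq_addr /= addKn valK.
- by move=> s; apply: spread_spread_fam (spr (inl s)).
- by move=> s; rewrite card1.
- by move=> q; apply: spread_spread_fam (spr (inr q)).
- by move=> q; rewrite card2.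
Qed.

Definition swap_ord m1 m2 (j : 'I_(m2 + m1)) : 'I_(m1 + m2) :=
  match split j with inl j2 => rshift m1 j2 | inr j1 => lshift m2 j1 end.

Lemma swap_ordK m1 m2 : cancel (@swap_ord m1 m2) (@swap_ord m2 m1).
Proof.
move=> j; rewrite -[j]splitK; case: (split j) => j' /=.
  by rewrite /swap_ord (unsplitK (inl j')) (unsplitK (inr j')).
by rewrite /swap_ord (unsplitK (inr j')) (unsplitK (inl j')).
Qed.

Definition swap_pidx n m1 m2 a b c (R : pzRingType) (p : pidx n m1 m2 a b c -> R) :
  pidx n m2 m1 a c b -> R := mkp (pA p) (pC p) (pB p) (pT2 p) (pT1 p).

Lemma genm_swap n m1 m2 a b c (R : pzRingType) (p : pidx n m1 m2 a b c -> R) i j :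
  genm (swap_pidx p) i j = genm p i (swap_ord j).
Proof.
rewrite genm_mkp /swap_ord -[j in LHS]splitK; case: (split j) => j' /=.
  by rewrite row_mxEl row_mxEr.
by rewrite row_mxEr row_mxEl.
Qed.

Lemma swap_pidx_surj n m1 m2 a b c (R : pzRingType) (y : pidx n m2 m1 a c b -> R) :
  exists p : pidx n m1 m2 a b c -> R, swap_pidx p =1 y.
Proof.
exists (swap_pidx y) => w; rewrite /swap_pidx.
have [-> -> -> -> ->] := mkpK (pA y) (pC y) (pB y) (pT2 y) (pT1 y).
by case: w => [[i k]|[[i k]|[[i k]|[[k j]|[[k j]|[[k j]|[k j]]]]]]] /=;
  rewrite ?col_mxEu ?col_mxEd !mxE.
Qed.

Lemma polyfun_swap n m1 m2 a b c w :
  polyfun (fun p : pidx n m1 m2 a b c -> K => swap_pidx p w).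
Proof.
suff [w' E] : exists w', forall p : pidx n m1 m2 a b c -> K, swap_pidx p w = p w'.
  by have [F FE] := polyfun_var K w'; exists F => p; rewrite E FE.
case: w => [[i k]|[[i k]|[[i k]|[[k j]|[[k j]|[[k j]|[k j]]]]]]].
- by exists (inl (i, k)) => p; rewrite /= mxE.
- by exists (inr (inr (inl (i, k)))) => p; rewrite /= mxE.
- by exists (inr (inl (i, k))) => p; rewrite /= mxE.
- by exists (inr (inr (inr (inr (inr (inr (k, j))))))) => p; rewrite /= col_mxEu mxE.
- by exists (inr (inr (inr (inr (inr (inl (k, j))))))) => p; rewrite /= col_mxEd mxE.
- by exists (inr (inr (inr (inr (inl (k, j)))))) => p; rewrite /= col_mxEd mxE.
- by exists (inr (inr (inr (inl (k, j))))) => p; rewrite /= col_mxEu mxE.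
Qed.

Lemma spread_swap n m1 m2 rho (Om : {ffun 'I_(m1 + m2) -> {set 'I_n}}) (B : {set 'I_(m2 + m1)}) :
  spread rho Om (@swap_ord m1 m2 @: B) -> spread rho [ffun j => Om (swap_ord j)] B.
Proof.
have inj := can_inj (@swap_ordK m1 m2).
move=> /forallP spr; apply/forallP => S; apply/implyP => /andP[S0 SB].
have := spr (@swap_ord m1 m2 @: S); rewrite imset_eq0 S0 imsetS //= card_imset // => /leq_trans; apply.
apply/eq_leq/eq_card => i; apply/bigcupP/bigcupP => [[_ /imsetP[j jS ->] ij]|[j jS]].
  by exists j; rewrite ?ffunE.
by rewrite ffunE => ij; exists (swap_ord j); rewrite ?imset_f.
Qed.

(** Exchanging the views exchanges [B] and [C]; spread blocks and generic sets are transported along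
    the permutations of columns and of parameters. *)
Lemma plan_right n m1 m2 a b c I rho B : @sufficient_plan n m2 m1 a c b I rho B ->
  @sufficient_plan n m1 m2 a b c I rho (fun i => @swap_ord m1 m2 @: B i).
Proof.
move=> [cI rhoE cB fin]; split.
- by rewrite addnAC.
- by move=> i; case: (rhoE i) => ->; [right | left].
- by move=> i; rewrite card_imset //; apply: can_inj (@swap_ordK m1 m2).
move=> Om bigO spr; have := fin [ffun j => Om (swap_ord j)].
case=> [j|i|f [fp nz fP]]; first by rewrite ffunE addnAC.
  exact: spread_swap.
have := generic_comp (fun w => polyfun_swap w) (@swap_pidx_surj n m1 m2 a b c K)
  (ex_intro _ f (And3 fp nz fP)).
apply: generic_mono => p [L LP].
exists (fun e => L (e.1, swap_ord e.2)) => q qp e.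
have := LP (swap_pidx q) _ (e.1, swap_ord e.2); rewrite /= genm_swap swap_ordK; apply.
by move=> i j; rewrite ffunE !genm_swap; apply: qp.
Qed.

(** If neither view had room for a block per basis column, then
    [m1 + m2 < (a + b) * h1 + (a + c) * h2]. Since blocks are halved, [h1 + h2 <= n - a], and the
    shared part costs at most [a * (n - a)], against the bound on [m1 + m2]. *)
Lemma plan_exists n m1 m2 a b c : (0 < a + b)%N -> (0 < a + c)%N ->
  (6 * (a + b) <= n)%N -> (6 * (a + c) <= n)%N -> (a + b <= m1)%N -> (a + c <= m2)%N ->
  (b * (n - (a + b)) <= m1)%N -> (c * (n - (a + c)) <= m2)%N ->
  (b * (n - (a + b)) + c * (n - (a + c)) + a * (n - a) <= m1 + m2)%N ->
  exists (I : finType) (rho : I -> nat) (B : I -> {set 'I_(m1 + m2)}),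
    @sufficient_plan n m1 m2 a b c I rho B.
Proof.
move=> ab0 ac0 ab6 ac6 m1a m2a m1b m2c mm.
set h1 := (n - (a + b))./2; set h2 := (n - (a + c))./2.
have h1E : (2 * h1 <= n - (a + b))%N by rewrite /h1; lia.
have h2E : (2 * h2 <= n - (a + c))%N by rewrite /h2; lia.
(* For [b > 0] the room for [a] single columns comes from the halving, as [h1 + a <= n - (a + b)];
   for [b = 0] it comes from [a + b <= m1]. *)
have le1 : (b * h1 + a <= m1)%N.
  case: (posnP b) => [b0|b0]; first by rewrite b0 in m1a *; lia.
  apply: leq_trans m1b; apply: (@leq_trans (b * (h1 + a))).
    by rewrite mulnDr leq_add2l leq_pmull.
  by rewrite leq_mul2l; apply/orP; right; lia.
have le2 : (c * h2 + a <= m2)%N.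
  case: (posnP c) => [c0|c0]; first by rewrite c0 in m2a *; lia.
  apply: leq_trans m2c; apply: (@leq_trans (c * (h2 + a))).
    by rewrite mulnDr leq_add2l leq_pmull.
  by rewrite leq_mul2l; apply/orP; right; lia.
have [le2'|lt2] := leqP ((a + c) * h2) m2; first exact: plan_left.
have [le1'|lt1] := leqP ((a + b) * h1) m1.
  have [I [rho [B P]]] : exists (I : finType) (rho : I -> nat) (B : I -> {set 'I_(m2 + m1)}),
    @sufficient_plan n m2 m1 a c b I rho B by apply: plan_left.
  by exists I, rho, (fun i => @swap_ord m1 m2 @: B i); apply: plan_right.
exfalso; move: mm; apply/negP; rewrite -ltnNge.
have e1 : (b * h1 <= b * (n - (a + b)))%N by rewrite leq_mul2l; apply/orP; right; lia.
have e2 : (c * h2 <= c * (n - (a + c)))%N by rewrite leq_mul2l; apply/orP; right; lia.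
have e3 : (a * (h1 + h2) <= a * (n - a))%N by rewrite leq_mul2l; apply/orP; right; lia.
move: lt1 lt2; rewrite !mulnDl; move: e3; rewrite mulnDr; lia.
Qed.

End Plan.

(** * Ranks and factorizations *)

Section Ranks.
Local Open Scope ring_scope.

Section Factorization.
Variable K : fieldType.

(** By the dimension formula the two column spaces meet in dimension [a]. Take for [A] a basis of
    the intersection, for [B] and [C] bases of complements of it in each space. The transposes turn
    columns into the row spaces of the matrix calculus. *)
Lemma two_view_factorization n m1 m2 a b c (M1 : 'M[K]_(n, m1)) (M2 : 'M[K]_(n, m2)) :
  \rank M1 = (a + b)%N -> \rank M2 = (a + c)%N -> \rank (row_mx M1 M2) = (a + b + c)%N ->
  exists A B C (T1 : 'M_(a + b, m1)) (T2 : 'M_(a + c, m2)),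
    M1 = row_mx (A : 'M_(n, a)) (B : 'M_(n, b)) *m T1 /\ M2 = row_mx A (C : 'M_(n, c)) *m T2.
Proof.
move=> r1 r2 r; pose S1 := M1^T; pose S2 := M2^T.
have s1 : \rank S1 = (a + b)%N by rewrite mxrank_tr.
have s2 : \rank S2 = (a + c)%N by rewrite mxrank_tr.
have s12 : \rank (S1 + S2)%MS = (a + b + c)%N by rewrite addsmxE -tr_row_mx mxrank_tr.
have cap : \rank (S1 :&: S2)%MS = a.
  by have := mxrank_sum_cap S1 S2; rewrite s1 s2 s12; lia.
have cap' : \rank (S2 :&: S1)%MS = a by rewrite capmxC.
have d1 : \rank (S1 :\: S2)%MS = b by have := mxrank_cap_compl S1 S2; rewrite s1 cap; lia.
have d2 : \rank (S2 :\: S1)%MS = c by have := mxrank_cap_compl S2 S1; rewrite s2 cap'; lia.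
have [PA _ PAE] := row_base_dim cap.
have [PB _ PBE] := row_base_dim d1.
have [PC _ PCE] := row_base_dim d2.
have /submxP[D1 D1E] : (S1 <= col_mx PA PB)%MS.
  rewrite -addsmxE (adds_eqmx PAE PBE) addsmxC.
  by rewrite addsmx_diff_cap_eq.
have /submxP[D2 D2E] : (S2 <= col_mx PA PC)%MS.
  by rewrite -addsmxE (adds_eqmx PAE PCE) addsmxC capmxC addsmx_diff_cap_eq.
exists PA^T, PB^T, PC^T, D1^T, D2^T.
by rewrite -!tr_col_mx -!trmx_mul -D1E -D2E !trmxK.
Qed.

End Factorization.

Definition mx_of m n (M : mat m n) : 'M[R]_(m, n) := \matrix_(i, j) M i j.

Lemma lin_comb_colE m n (M : mat m n) c s i : lin_comb_col M c s i = \sum_(j <- s) c j * M i j.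
Proof.
rewrite /lin_comb_col; elim: s => [|j s IHs]; first by rewrite big_nil.
by rewrite big_cons -IHs.
Qed.

Lemma col_indep_size m n (M : mat m n) s : col_indep M s -> (size s <= \rank (mx_of M))%N.
Proof.
move=> [us ind]; pose f : 'I_(size s) -> 'I_n := tnth (in_tuple s).
have free : row_free (rowsub f (mx_of M)^T).
  rewrite -kermx_eq0; apply/rowV0P => u /sub_kermxP uM.
  pose c j := if insub (index j s) is Some t then u 0 (t : 'I_(size s)) else 0.
  have cf t : c (f t) = u 0 t.
    rewrite /c /f (tnth_nth (f t)) index_uniq // ?valK //; exact: ltn_ord.
  apply/rowP => t; rewrite mxE -cf; apply: ind; last exact: mem_tnth.
  move=> i; rewrite lin_comb_colE (big_tnth _ _ s) /=.
  move/rowP: uM => /(_ i); rewrite !mxE => uM; rewrite -[RHS]uM.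
  by apply: eq_bigr => l _; rewrite -/(f l) cf !mxE.
move: free; rewrite /row_free => /eqP <-; rewrite -[leqRHS]mxrank_tr.
exact: mxrankS (rowsub_sub _ _).
Qed.

Lemma col_indep_rank m n (M : mat m n) :
  exists2 s, size s = \rank (mx_of M) & col_indep M s.
Proof.
pose N := (mx_of M)^T; pose f := maxrankfun N.
have fi : injective f by apply: maxrankfun_inj.
exists [seq f t | t <- enum 'I_(\rank N)].
  by rewrite size_map size_enum_ord mxrank_tr.
split; first by rewrite map_inj_uniq ?enum_uniq.
move=> c c0 _ /mapP[t _ ->].
have /eqP/rowP/(_ t) : \row_t c (f t) == 0 :> 'rV_(\rank N); last by rewrite !mxE.
rewrite -(mulmx_free_eq0 _ (maxrowsub_free N)); apply/eqP/rowP => i.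
rewrite !mxE -[RHS](c0 i) lin_comb_colE big_map big_enum.
by apply: eq_bigr => l _; rewrite !mxE.
Qed.

Lemma has_rank_mxrank m n (M : mat m n) k : has_rank M k -> \rank (mx_of M) = k.
Proof.
move=> [[s [<- sM]] max_k]; apply/eqP; rewrite eqn_leq col_indep_size // andbT.
by have [t <- tM] := col_indep_rank M; apply: max_k.
Qed.

Lemma rank_ok_mxrank n m1 m2 r1 r2 r (X : mat n (m1 + m2)) : rank_ok r1 r2 r X ->
  [/\ \rank (lsubmx (mx_of X)) = r1, \rank (rsubmx (mx_of X)) = r2 & \rank (mx_of X) = r].
Proof.
move=> [/has_rank_mxrank h1 [/has_rank_mxrank h2 /has_rank_mxrank h]]; split=> //.
  by rewrite -h1; congr (\rank _); apply/matrixP => i j; rewrite !mxE.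
by rewrite -h2; congr (\rank _); apply/matrixP => i j; rewrite !mxE.
Qed.

Lemma rank_ok_genm n m1 m2 a b c (X : mat n (m1 + m2)) :
  rank_ok (a + b) (a + c) (a + b + c) X ->
  exists p : pidx n m1 m2 a b c -> R, forall i j, X i j = genm p i j.
Proof.
case/rank_ok_mxrank => r1 r2; rewrite -[mx_of X]hsubmxK => r.
have [A [B [C [T1 [T2 [E1 E2]]]]]] := two_view_factorization r1 r2 r.
exists (mkp A B C T1 T2) => i j; rewrite genm_mkp -E1 -E2 hsubmxK mxE.
by [].
Qed.

Lemma rsumE (I : finType) (f : I -> R) : rsum f = \sum_i f i.
Proof.
rewrite /rsum -big_enum /=; elim: (enum I) => [|i s IHs] /=; first by rewrite big_nil.
by rewrite big_cons -IHs.
Qed.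

Lemma gen_matrixE n m1 m2 r r1 r2 (p : param_index n m1 m2 r r1 r2 -> R) i j :
  gen_matrix p i j =
  genm (p : pidx n m1 m2 (r1 + r2 - r) (r - r2) (r - r1) -> R) i j.
Proof.
rewrite /gen_matrix -[j in RHS]splitK; case: (split j) => j' /=; rewrite !rsumE.
  rewrite row_mxEl mul_row_col !mxE RplusE.
  by congr (_ + _); apply: eq_bigr => k _; rewrite !mxE.
rewrite row_mxEr mul_row_col !mxE RplusE.
by congr (_ + _); apply: eq_bigr => k _; rewrite !mxE.
Qed.

End Ranks.

(** * Finite completability *)

Lemma In_map_mem (T : eqType) (U : Type) (f : T -> U) s x : x \in s -> List.In (f x) (map f s).
Proof. by elim: s => //= y s IHs; rewrite inE => /predU1P[->|/IHs]; [left | right]. Qed.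

Lemma finitely_many_matrices n m (L : 'I_n * 'I_m -> seq R) :
  exists s : seq (mat n m), forall X : mat n m, (forall e, X e.1 e.2 \in L e) ->
    exists Y, List.In Y s /\ forall i j, X i j = Y i j.
Proof.
pose b := \max_e size (L e).
pose Y (phi : {ffun 'I_n * 'I_m -> 'I_b.+1}) : mat n m := fun i j => nth R0 (L (i, j)) (phi (i, j)).
exists [seq Y phi | phi <- enum {ffun 'I_n * 'I_m -> 'I_b.+1}] => X XL.
pose phi : {ffun 'I_n * 'I_m -> 'I_b.+1} := [ffun e => inord (index (X e.1 e.2) (L e))].
exists (Y phi); split; first by apply: In_map_mem; rewrite mem_enum.
move=> i j; have Xij : X i j \in L (i, j) := XL (i, j).
rewrite /Y /phi ffunE inordK /= ?nth_index //.
by rewrite ltnS (leq_trans (index_size _ _)) // (leq_bigmax (i, j)).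
Qed.

Lemma finite_fibre_completable n m1 m2 r r1 r2 (Om : pattern n (m1 + m2))
    (p : param_index n m1 m2 r r1 r2 -> R) :
  (r1 <= r)%N -> (r2 <= r)%N -> (r <= r1 + r2)%N ->
  @finite_fibre _ n m1 m2 (r1 + r2 - r) (r - r2) (r - r1) Om p ->
  finitely_completable r1 r2 r (gen_matrix p) Om.
Proof.
move=> r1r r2r rr [L LP]; have [s sP] := finitely_many_matrices L.
exists s => X [XU rkX]; apply: sP => e.
have : rank_ok ((r1 + r2 - r) + (r - r2)) ((r1 + r2 - r) + (r - r1))
    ((r1 + r2 - r) + (r - r2) + (r - r1)) X.
  have -> : (r1 + r2 - r + (r - r2) + (r - r1) = r)%N by lia.
  have -> : (r1 + r2 - r + (r - r2) = r1)%N by lia.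
  by have -> : (r1 + r2 - r + (r - r1) = r2)%N by lia.
case/rank_ok_genm => q XE; rewrite XE; apply: LP => i j ij.
by rewrite -XE XU // gen_matrixE.
Qed.

Lemma generic_finitely_completable n m1 m2 r r1 r2 :
  (1 <= r1)%N -> (1 <= r2)%N -> (r1 <= r)%N -> (r2 <= r)%N -> (r <= r1 + r2)%N ->
  (6 * r1 <= n)%N -> (6 * r2 <= n)%N -> (r1 <= m1)%N -> (r2 <= m2)%N ->
  ((r - r2) * (n - r1) <= m1)%N -> ((r - r1) * (n - r2) <= m2)%N ->
  ((r - r2) * (n - r1) + (r - r1) * (n - r2)
     + (r1 + r2 - r) * (n - (r1 + r2 - r)) <= m1 + m2)%N ->
  exists (I : finType) (rho : I -> nat) (B : I -> {set 'I_(m1 + m2)}),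
    [/\ (#|I| <= r)%N, forall i, rho i = r1 \/ rho i = r2,
      forall i, #|B i| = ((n - rho i)./2)%N &
      generic (fun p : param_index n m1 m2 r r1 r2 -> R =>
        forall Om : pattern n (m1 + m2), (forall j, (r <= #|Om j|)%N) ->
          (forall i, spread (rho i) Om (B i)) ->
          finitely_completable r1 r2 r (gen_matrix p) Om)].
Proof.
move=> r1_gt0 r2_gt0 r1r r2r rr r16 r26 m1r m2r m1b m2c mm.
have r1E : (r1 + r2 - r + (r - r2) = r1)%N by lia.
have r2E : (r1 + r2 - r + (r - r1) = r2)%N by lia.
have rE : (r1 + r2 - r + (r - r2) + (r - r1) = r)%N by lia.
have := @plan_exists (R : realFieldType) n m1 m2 (r1 + r2 - r) (r - r2) (r - r1).
rewrite r1E r2E => /(_ r1_gt0 r2_gt0 r16 r26 m1r m2r m1b m2c mm).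
move=> [I [rho [B [cI rhoE cB fin]]]]; exists I, rho, B; split=> //.
- by rewrite -rE.
- by move=> i; have := rhoE i; rewrite r1E r2E.
(* There are finitely many patterns, so one exceptional set serves them all; a pattern violating the
   conditions imposes nothing. *)
apply: generic_forall => Om.
have [|] := boolP ([forall j, r <= #|Om j|] && [forall i, spread (rho i) Om (B i)])%N.
  move=> /andP[/forallP bigO /forallP spr].
  have := fin Om; rewrite rE => /(_ bigO spr); apply: generic_mono => p fp _ _.
  exact: finite_fibre_completable.
move=> bad; apply: generic_true => p bigO spr; case/negP: bad.
by apply/andP; split; apply/forallP.
Qed.

Lemma param_index_gt0 n m1 m2 r r1 r2 : (0 < n)%N -> (1 <= r1)%N -> (r1 <= r)%N ->
  (r <= r1 + r2)%N -> (0 < #|param_index n m1 m2 r r1 r2|)%N.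
Proof.
move=> n0 r10 r1r rr; pose i : 'I_n := Ordinal n0; apply/card_gt0P.
have [lt|] := ltnP 0 (r1 + r2 - r); first by exists (inl (i, Ordinal lt)).
have [lt|] := ltnP 0 (r - r2); first by exists (inr (inl (i, Ordinal lt))).
have [lt|] := ltnP 0 (r - r1); first by exists (inr (inr (inl (i, Ordinal lt)))).
by move=> *; exfalso; lia.
Qed.

Lemma exception_set n m1 m2 r r1 r2 (Pr : (param_index n m1 m2 r r1 r2 -> R) -> Prop) :
  (0 < #|param_index n m1 m2 r r1 r2|)%N -> generic Pr ->
  exists Z, lebesgue_null Z /\ forall p, ~ Z p -> Pr p.
Proof.
move=> T0 [f [[F fE] [x fx] fP]]; exists (fun p => F.@[fun i => p (enum_val i)] = 0%R).
split; first by apply: mpoly_zero_set_null => //; apply: contra_neq fx; rewrite fE => ->; rewrite meval0.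
by move=> p pZ; apply: fP; rewrite fE; apply/eqP.
Qed.

Section Count.
Local Open Scope ring_scope.

Lemma many_spread n M (k : 'I_M -> nat) l (eps : R) r (I : finType) (rho : I -> nat)
    (B : I -> {set 'I_M}) :
  Rlt 0 eps /\ Rlt eps 1 -> (0 < n)%N -> (#|I| <= r)%N -> (3 * r <= n)%N ->
  (forall i, [/\ 0 < rho i, 6 * rho i <= n & 2 * rho i < l]%N) ->
  (forall i, #|B i| = ((n - rho i)./2)%N) ->
  (forall j, l <= k j <= n)%N -> (l <= n)%N ->
  Rlt (Rplus (Rmult 9 (ln (Rdiv (INR n) eps))) 9) (INR l) ->
  (1 - eps) * #|valid_patterns n k|%:R <=
    #|[set Om in valid_patterns n k | [forall i, spread (rho i) Om (B i)]]|%:R.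
Proof.
move=> eps01 n0 cI rn rhoP cB lk l_le_n llam.
set V := valid_patterns n k; set G := [set Om in V | _].
pose bad i := [set Om in V | ~~ spread (rho i) Om (B i)].
have VG : (#|V| <= #|G| + \sum_i #|bad i|)%N.
  apply: leq_trans (_ : #|G :|: \bigcup_i bad i| <= _)%N.
    apply/subset_leq_card/subsetP => Om OmV; rewrite in_setU [Om \in G]in_set OmV /=.
    case: (boolP [forall i, spread (rho i) Om (B i)]) => //; rewrite negb_forall => /existsP[i nspr].
    by apply/bigcupP; exists i => //; rewrite in_set OmV.
  apply: leq_trans (leq_card_setU _ _) _; rewrite leq_add2l; exact: leq_card_bigcup.
have nR : 0 < n%:R :> R by rewrite ltr0n.
have eps0 : 0 < eps by apply/RltP; case: eps01.
have badP i : #|bad i|%:R <= 3 / 2 * (eps / n%:R) * #|V|%:R :> R.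
  by have [h1 h2 h3] := rhoP i; apply: (@not_spread_count n M k (rho i) l).
have sumbad : \sum_i #|bad i|%:R <= eps * #|V|%:R :> R.
  apply: le_trans (ler_sum _ (fun i _ => badP i)) _.
  rewrite sumr_const -[leLHS]mulr_natl mulrA ler_wpM2r ?ler0n //.
  have mulE (x : R) : x * (3 / 2 * (eps / n%:R)) = eps * (x * 3 / 2 / n%:R).
    by rewrite !mulrA; congr (_ / _); rewrite mulrC !mulrA.
  rewrite mulE.
  rewrite ger_pMr // ler_pdivrMr // mul1r ler_pdivrMr ?ltr0n // -!natrM ler_nat.
  by apply: leq_trans (leq_mul cI (leqnn 3)) _; lia.
rewrite mulrBl mul1r lerBlDr.
apply: le_trans (_ : (#|G| + \sum_i #|bad i|)%:R <= _); first by rewrite ler_nat.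
by rewrite natrD natr_sum lerD2l.
Qed.

End Count.

Open Scope R_scope.

Theorem theorem3 (n m1 m2 r r1 r2 : nat) (eps : R) (l : nat) :
  (0 < n)%N -> (0 < m1)%N -> (0 < m2)%N ->
  (1 <= r1)%N -> (1 <= r2)%N -> (r1 <= r)%N -> (r2 <= r)%N ->
  (r <= minn n (r1 + r2))%N ->
  0 < eps < 1 ->
  (6 * maxn (maxn r1 r2) (r1 + r2 - r) <= n)%N ->
  ((r - r2) * (n - r1) <= m1)%N ->
  ((r - r1) * (n - r2) <= m2)%N ->
  ((r - r2) * (n - r1) + (r - r1) * (n - r2)
     + (r1 + r2 - r) * (n - (r1 + r2 - r)) <= m1 + m2)%N ->
  INR l > Rmax (Rmax
      (9 * ln (INR n / eps)
       + 3 * Rmax (Rmax (ln (3 * INR (r - r2) / eps))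
                        (ln (3 * INR (r - r1) / eps)))
                  (ln (3 * INR (r1 + r2 - r) / eps))
       + 6)
      (2 * INR r1)) (2 * INR r2) ->
  exists Z : (param_index n m1 m2 r r1 r2 -> R) -> Prop,
    lebesgue_null Z /\
    forall p : param_index n m1 m2 r r1 r2 -> R,
      ~ Z p ->
      rank_ok r1 r2 r (gen_matrix p) ->
      forall k : 'I_(m1 + m2) -> nat,
        (forall j, l <= k j <= n)%N ->
        exists G : {set pattern n (m1 + m2)},
          (forall Om, Om \in G ->
             Om \in valid_patterns n k /\
             finitely_completable r1 r2 r (gen_matrix p) Om) /\
          INR #|G| >= (1 - eps) * INR #|valid_patterns n k|.
Proof.
move=> n0 m1_gt0 m2_gt0 r1_gt0 r2_gt0 r1r r2r; rewrite leq_min => /andP[rn rr] eps01 six.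
move=> m1b m2c mm lbig.
have r16 : (6 * r1 <= n)%N by lia.
have r26 : (6 * r2 <= n)%N by lia.
have T0 := @param_index_gt0 n m1 m2 r r1 r2 n0 r1_gt0 r1r rr.
(* The bound [r_1' (n - r_1) <= m_1] says nothing when [r_1' = 0], and likewise for view 2. If a
   view has fewer columns than its rank, the rank condition on [p] is contradictory. *)
have [/andP[m1r m2r]|few] := boolP ((r1 <= m1) && (r2 <= m2))%N; last first.
  have [Z [Z0 _]] := exception_set T0 (@generic_true _ _ (fun=> True) (fun=> Logic.I)).
  exists Z; split=> // p _ /rank_ok_mxrank[rk1 rk2 _]; case/negP: few.
  have := rank_leq_col (lsubmx (mx_of (gen_matrix p))); rewrite rk1 => ->.
  by have := rank_leq_col (rsubmx (mx_of (gen_matrix p))); rewrite rk2.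
have [I [rho [B [cI rhoE cB gen]]]] :=
  generic_finitely_completable r1_gt0 r2_gt0 r1r r2r rr r16 r26 m1r m2r m1b m2c mm.
have [Z [Z0 ZP]] := exception_set T0 gen.
exists Z; split=> // p pZ _ k lk.
have l_le_n : (l <= n)%N.
  have j0 : 'I_(m1 + m2) := Ordinal (ltn_addr m2 m1_gt0).
  by have /andP[h1 h2] := lk j0; apply: leq_trans h1 h2.
have [l1 l2] : INR l > 2 * INR r1 /\ INR l > 2 * INR r2.
  split; apply: Rle_lt_trans lbig; last exact: Rmax_r.
  by apply: Rle_trans (Rmax_l _ _); apply: Rmax_r.
have lr q : INR l > 2 * INR q -> (2 * q < l)%N.
  by move=> H; rewrite ltnNge; apply/negP => /INR_leq; rewrite INR_mulnE /=; lra.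
have lr1 := lr _ l1; have lr2 := lr _ l2.
have llam : 9 * ln (INR n / eps) + 9 < INR l.
  apply: Rle_lt_trans lbig; apply: Rle_trans (Rmax_l _ _); apply: Rle_trans (Rmax_l _ _).
  (* As [r' + r_1' = r_1 >= 1], one of these logarithms is at least [ln 3 >= 1], and
     [3 * 1 + 6 = 9]. A logarithm at 0 does no harm inside the maximum. *)
  suff : 1 <= Rmax (Rmax (ln (3 * INR (r - r2) / eps)) (ln (3 * INR (r - r1) / eps)))
              (ln (3 * INR (r1 + r2 - r) / eps)) by lra.
  have big q : (0 < q)%N -> 1 <= ln (3 * INR q / eps).
    move=> q0; apply: Rle_trans ln3_ge1 _; apply: ln_le_mono; first lra.
    have := @INR_leq 1 q q0; rewrite /= => q1.
    apply: (Rmult_le_reg_r eps); first lra.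
    by rewrite /Rdiv Rmult_assoc Rinv_l; nra.
  have [/big h|] := ltnP 0 (r1 + r2 - r); first by apply: Rle_trans h (Rmax_r _ _).
  move=> le0; have /big h : (0 < r - r2)%N by lia.
  by apply: Rle_trans h _; apply: Rle_trans (Rmax_l _ _); apply: Rmax_l.
exists [set Om in valid_patterns n k | [forall i, spread (rho i) Om (B i)]]; split.
  move=> Om; rewrite inE => /andP[vOm /forallP spr]; split=> //.
  (* Every column has at least [r] observed entries, because [r <= r_1 + r_2] and both [2 r_1] and
     [2 r_2] are less than [l]. *)
  apply: ZP => // j; move: vOm; rewrite inE => /forallP/(_ j)/eqP->.
  by have /andP[h _] := lk j; apply: leq_trans h; lia.
apply/Rle_ge/RleP; rewrite !INRE RmultE RminusE.
apply: (@many_spread n _ k l eps r) => //; first by lia.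
by move=> i; case: (rhoE i) => ->; split.
Qed.
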